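(* Let $m, s, n$ be positive integers with $s \geq 2$ and $n \geq 3$, and let $r \in \mathbb{Z}_n^*$ be such that $r^{ms} = 1$ or $r^{ms}=-1$ in $\mathbb{Z}_n$. If the graph $\Gamma = \mathrm{CPM}(m,s,n;r)$ is $2$-arc-transitive, then the vertex-stabilizers in $\mathrm{Aut}(\Gamma)$ are of order $24$ and the automorphism group $\mathrm{Aut}(\Gamma)$ is generated by the group $G$ and the automorphism $\nu$ or the restriction of $\bar\nu$ to $\Gamma$ (with $G$, $\nu$, $\bar\nu$ as described in the context).
   Context: Graphs. For positive integers $m,s,n$ with $n\ge 3$ and $r\in\mathbb{Z}_n^*$ with $r^{ms}=1$ or $r^{ms}=-1$ in $\mathbb{Z}_n$, let $\overline{\mathrm{CPM}}(m,s,n;r)$ be the undirected graph with vertices $\langle i;\mathbf v\rangle$, $i\in\mathbb{Z}_{ms}$, $\mathbf v=(v_0,\dots,v_{s-1})\in\mathbb{Z}_n^s$, with adjacencies $\langle i;\mathbf v\rangle\sim\langle i+1;\mathbf v\pm r^i\mathbf e_\ell\rangle$; here $\ell\in\{0,\dots,s-1\}$ is the residue of $i$ modulo $s$ and $\mathbf e_0,\dots,\mathbf e_{s-1}$ are the standard vectors of $\mathbb{Z}_n^s$. $\mathrm{CPM}(m,s,n;r)$ is the connected component containing $\langle 0;\mathbf 0\rangle$. A graph is $2$-arc-transitive if its automorphism group is transitive on the sequences $(v_0,v_1,v_2)$ of vertices with $v_0\sim v_1\sim v_2$, $v_0\ne v_2$. Maps are written on the right. The group $G$. Let $\overline{\Gamma}=\overline{\mathrm{CPM}}(m,s,n;r)$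 and $\Gamma=\mathrm{CPM}(m,s,n;r)$. Define automorphisms of $\overline\Gamma$ by $\langle i;\mathbf v\rangle\bar\rho_0=\langle i;\mathbf v+\mathbf e_0\rangle$; $\langle i;\mathbf v\rangle\bar\tau_0=\langle i;(-v_0,v_1,\dots,v_{s-1})\rangle$; $\langle i;\mathbf v\rangle\bar\sigma=\langle i+1;(rv_{s-1},rv_0,\dots,rv_{s-2})\rangle$. Let $\overline G=\langle\bar\sigma,\bar\rho_0,\bar\tau_0\rangle$ and let $G\le\mathrm{Aut}(\Gamma)$ be the restriction to $V(\Gamma)$ of the action of the setwise stabilizer of $V(\Gamma)$ in $\overline G$. The automorphisms $\bar\nu$ and $\nu$. For an odd integer $k$ and $q\in\mathbb{Z}_k^*$ let $\beta_{k,q}$ be the involutory automorphism of the additive group $\mathbb{Z}_k^3$ given by $$(x,y,z)\beta_{k,q}=\bigl(y-qz,\;2^{-1}(x+y+qz),\;2^{-1}(z-q^{-1}x+q^{-1}y)\bigr).$$ The automorphism $\bar\nu$ is defined for $\overline{\mathrm{CPM}}(n,2,n;1)$ with $n\ge 3$ odd: using $\mathbb{Z}_{2n}\cong\mathbb{Z}_2\times\mathbb{Z}_n$, identify the vertex $\langle i;(y,z)\rangle$ with $\langle i \bmod 2;(i\bmod n,y,z)\rangle\in\mathbb{Z}_2\times\mathbb{Z}_n^3$, and put $\langle e;\mathbf w\rangle\bar\nu=\langle e;\mathbf w\beta_{n,1}\rangle$. The automorphism $\nu$ is defined for $\mathrm{CPM}(m,2,2m;r)$ with $m\equiv 2\pmod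 4$ and $r^2+1=m$ in $\mathbb{Z}_{2m}$, where one may assume $r\equiv 3\pmod 4$ because $\mathrm{CPM}(m,2,2m;r)=\mathrm{CPM}(m,2,2m;-r)$. Write $m=2k$ ($k$ odd), let $q$ be $r$ modulo $k$, and identify the vertex $\langle i;(y,z)\rangle$ with $(i,y,z)\in\mathbb{Z}_{4k}^3$. Let $\wp_4$ and $\wp_k$ denote componentwise reduction of $\mathbb{Z}_{4k}^3$ modulo $4$ and modulo $k$; $\wp_4$ maps $\mathrm{CPM}(m,2,2m;r)$ onto $\mathrm{CPM}(2,2,4;1)$ (the $4$-cube), whose vertices are written as triples in $\mathbb{Z}_4^3$ in the same way. Let $\nu_4$ be the unique nonidentity automorphism of $\mathrm{CPM}(2,2,4;1)$ fixing each of the vertices $(2,3,1),(3,2,1),(0,2,2),(1,3,2)$ of a $4$-cycle (a reflection of a toroidal embedding of the $4$-cube with axis through this $4$-cycle). For a vertex $\mathbf v$ let $\mathbf v\nu$ be the unique element of $\mathbb{Z}_{4k}^3$ with $(\mathbf v\nu)\wp_4=(\mathbf v\wp_4)\nu_4$ and $(\mathbf v\nu)\wp_k=(\mathbf v\wp_k)\beta_{k,q}$. (For $m=2$ this gives $\nu=\nu_4$.)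
   Formalization: For 2-arc-transitive parameters where ν and ν̄ are not literally defined, e.g. CPM(5,2,5;2) or CPM(1,2,4;r), ν or ν̄ is carried over by the isomorphism ⟨i;(y,z)⟩→⟨i;(y,rz)⟩ from CPM(n,2,n;1) (n odd, r²=±1), or by ⟨i;v⟩→⟨i mod ms;v⟩ from CPM(2m,s,n;r). *)

(* Defs.v *)
From mathcomp Require Import all_boot all_algebra all_fingroup.

Set Implicit Arguments.
Unset Strict Implicit.
Unset Printing Implicit Defensive.

Import GRing.Theory GroupScope.
Local Open Scope ring_scope.

Section Graphs.
Variables (T : finType) (e : rel T).

Definition graph_aut : {set {perm T}} :=
  [set g : {perm T} | [forall x, forall y, e (g x) (g y) == e x y]].

Lemma graph_autP (g : {perm T}) :
  reflect (forall x y, e (g x) (g y) = e x y) (g \in graph_aut).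
Proof.
rewrite inE; apply: (iffP forallP) => [H x y | H x].
  by move/forallP/(_ y)/eqP: (H x).
by apply/forallP=> y; rewrite H.
Qed.

Lemma graph_aut_group_set : group_set graph_aut.
Proof.
apply/group_setP; split; first by apply/graph_autP=> x y; rewrite !perm1.
move=> g h /graph_autP Hg /graph_autP Hh.
by apply/graph_autP=> x y; rewrite !permM Hh Hg.
Qed.
Canonical graph_aut_group := Group graph_aut_group_set.

Definition two_arc (v0 v1 v2 : T) : bool := [&& e v0 v1, e v1 v2 & v0 != v2].

Definition two_arc_transitive : Prop :=
  forall u0 u1 u2 v0 v1 v2 : T, two_arc u0 u1 u2 -> two_arc v0 v1 v2 ->
  exists g, [/\ g \in graph_aut, g u0 = v0, g u1 = v1 & g u2 = v2].

End Graphs.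

(* Every n, and every product m * s, used as a modulus below is at least 2 in
   the cases of interest, so that 'Z_n and 'Z_(m * s) are the intended rings. *)
Definition bvertex (m s n : nat) : finType := ('Z_(m * s) * 'rV['Z_n]_s)%type.

Definition stdvec (s n l : nat) : 'rV['Z_n]_s := \row_j ((j : nat) == l)%:R.

Section CPM.
Variables (m s n : nat) (r : {unit 'Z_n}).

(* The arc from level i to level i + 1.  The exponent of r is the
   representative of i in 0 .. ms - 1; as r ^ (ms) = 1 or -1, any other
   representative gives the same pair of vectors. *)
Definition cpm_step : rel (bvertex m s n) := fun x y =>
  let d := val r ^+ (x.1 : nat) *: stdvec s n (x.1 %% s) in
  (y.1 == x.1 + 1) && ((y.2 == x.2 + d) || (y.2 == x.2 - d)).

Definition cpmbar_adj : rel (bvertex m s n) :=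
  fun x y => cpm_step x y || cpm_step y x.

Definition cpm_set : {set bvertex m s n} :=
  [set x | connect cpmbar_adj (0, 0) x].

Definition cpm : finType := {x : bvertex m s n | x \in cpm_set}.

Definition cpm_adj : rel cpm := relpre val cpmbar_adj.

Definition rhobar_fun (x : bvertex m s n) : bvertex m s n :=
  (x.1, x.2 + stdvec s n 0).

Definition taubar_fun (x : bvertex m s n) : bvertex m s n :=
  (x.1, \row_j if (j : nat) == 0%N then - x.2 0 j else x.2 0 j).

Definition sigmabar_fun (x : bvertex m s n) : bvertex m s n :=
  (x.1 + 1, \row_j (val r * x.2 0 (ord_pred j))).

Lemma rhobar_inj : injective rhobar_fun.
Proof. by move=> [i v] [j w] [-> /addIr ->]. Qed.

Lemma taubar_inj : injective taubar_fun.
Proof.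
apply: (inv_inj (f := taubar_fun)) => -[i v]; rewrite /taubar_fun /=.
apply: (congr1 (pair i)); apply/rowP=> j; rewrite !mxE.
by case: (_ == _); rewrite ?opprK.
Qed.

Lemma sigmabar_inj : injective sigmabar_fun.
Proof.
move=> [i v] [j w] H.
have /(addIr 1) -> : i + 1 = j + 1 by move: (congr1 fst H).
apply: (congr1 (pair j)); apply/rowP=> l.
have /rowP/(_ (ordS l)) := congr1 snd H; rewrite !mxE ordSK.
by apply: mulrI; exact: (valP r).
Qed.

Definition rhobar : {perm bvertex m s n} := perm rhobar_inj.
Definition taubar : {perm bvertex m s n} := perm taubar_inj.
Definition sigmabar : {perm bvertex m s n} := perm sigmabar_inj.

Definition cpm_Gbar : {group {perm bvertex m s n}} :=
  <<[set sigmabar; rhobar; taubar]>>%G.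

Definition cpm_G : {set {perm cpm}} :=
  [set g : {perm cpm} |
    [exists h in 'N_cpm_Gbar(cpm_set | 'P),
      [forall x : cpm, val (g x) == h (val x)]]].

End CPM.

Definition triple (d : nat) : Type := ('Z_d * 'Z_d * 'Z_d)%type.

(* <i; (y, z)> |-> (i, y, z), each entry reduced modulo d; meant for d > 1
   dividing both n and 2m. *)
Definition reduce (d m n : nat) (x : bvertex m 2 n) : triple d :=
  ((x.1 : nat)%:R, (x.2 0 0 : nat)%:R, (x.2 0 1 : nat)%:R).

Definition beta (k : nat) (q : 'Z_k) (w : triple k) : triple k :=
  let: (x, y, z) := w in
  (y - q * z, 2%:R^-1 * (x + y + q * z), 2%:R^-1 * (z - q^-1 * x + q^-1 * y)).

(* For n odd, an element of Z_2n amounts to its parity together with its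
   residue modulo n, so that this determines nubar. *)
Definition is_nubar (n : nat) (nubar : {perm bvertex n 2 n}) : Prop :=
  forall x, odd (nubar x).1 = odd x.1 /\
            reduce n (nubar x) = beta 1 (reduce n x).

Definition cube4 : finType := cpm 2 2 (1%g : {unit 'Z_4}).

Definition is_nu4 (nu4 : {perm cube4}) : Prop :=
  [/\ nu4 \in graph_aut (@cpm_adj 2 2 4 1%g), nu4 != 1%g &
      forall y : cube4,
        reduce 4 (val y) \in [:: (2, 3, 1); (3, 2, 1); (0, 2, 2); (1, 3, 2)] ->
        nu4 y = y].

(* Here r0 is the one of r and - r that is 3 modulo 4 (both give the same
   graph) and k = m / 2.  For k = 1 there is no condition modulo k ('Z_1 is not
   the trivial ring). *)
Definition is_nu (m : nat) (r : {unit 'Z_(2 * m)}) (nu : {perm cpm m 2 r}) :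
    Prop :=
  let k := m./2 in
  exists (r0 : 'Z_(2 * m)) (nu4 : {perm cube4}),
  [/\ r0 = val r \/ r0 = - val r,
      (r0 %% 4 = 3)%N,
      is_nu4 nu4,
      forall x, exists2 y, reduce 4 (val y) = reduce 4 (val x) &
                           reduce 4 (val (nu x)) = reduce 4 (val (nu4 y)) &
      (1 < k)%N -> forall x,
        reduce k (val (nu x)) = beta (r0 : nat)%:R (reduce k (val x))].

(* nu is f^-1 nu' f, where f maps CPM(m',s,n;r') onto CPM(m,s,n;r). *)
Definition carried_along (m' m s n : nat) (r' r : {unit 'Z_n})
    (f : bvertex m' s n -> bvertex m s n)
    (nu' : {perm cpm m' s r'}) (nu : {perm cpm m s r}) : Prop :=
  forall y, exists2 x, val y = f (val x) & val (nu y) = f (val (nu' x)).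

(* <i; (y, z)> |-> <i; (y, rz)>; if r^2 = 1 or -1, this is an isomorphism of
   CPM(m,2,n;1) onto CPM(m,2,n;r) that carries G to G. *)
Definition rescale (m n : nat) (r : {unit 'Z_n}) (x : bvertex m 2 n) :
    bvertex m 2 n :=
  (x.1, \row_j (if j == 0 then x.2 0 j else val r * x.2 0 j)).

(* <i; v> |-> <i mod ms; v>; if m is odd, n is even and r^(ms) = 1 or -1, this
   is an isomorphism of CPM(2m,s,n;r) onto CPM(m,s,n;r) that carries G to G,
   since the parities of the entries of v tell i and i + ms apart. *)
Definition fold_levels (m s n : nat) (x : bvertex (2 * m) s n) :
    bvertex m s n :=
  ((x.1 : nat)%:R, x.2).

(* The automorphisms nu and the restrictions of nubar, on the graphs for which
   these are defined, and their counterparts on the same graphs given by other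
   parameters: CPM(n,2,n;r), n odd, r^2 = 1 or -1, is CPM(n,2,n;1) up to
   rescaling (e.g. CPM(5,2,5;2)), and the 4-cube CPM(2,2,4;r) is also
   CPM(1,2,4;r). *)
Inductive nu_or_nubar :
    forall (m s n : nat) (r : {unit 'Z_n}), {perm cpm m s r} -> Prop :=
| IsNubar (n : nat) (nubar : {perm bvertex n 2 n})
    (nu : {perm cpm n 2 (1%g : {unit 'Z_n})}) :
    odd n -> is_nubar nubar -> (forall x, val (nu x) = nubar (val x)) ->
    nu_or_nubar nu
| IsNu (m : nat) (r : {unit 'Z_(2 * m)}) (nu : {perm cpm m 2 r}) :
    (m %% 4 = 2)%N -> val r ^+ 2 + 1 = m%:R -> is_nu nu ->
    nu_or_nubar nu
| Rescaled (n : nat) (r : {unit 'Z_n})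
    (nu' : {perm cpm n 2 (1%g : {unit 'Z_n})}) (nu : {perm cpm n 2 r}) :
    val r ^+ 2 = 1 \/ val r ^+ 2 = -1 ->
    nu_or_nubar nu' -> carried_along (rescale r) nu' nu ->
    nu_or_nubar nu
| Folded (m s n : nat) (r : {unit 'Z_n})
    (nu' : {perm cpm (2 * m) s r}) (nu : {perm cpm m s r}) :
    odd m -> ~~ odd n ->
    nu_or_nubar nu' -> carried_along (@fold_levels m s n) nu' nu ->
    nu_or_nubar nu.

(* Main.v *)
(* Unrolling the levels from Z_ms to the integers turns a closed walk of length at
   most 8 into a word of signed up and down steps whose coefficient sums vanish in
   Z_n, and there are finitely many such words to inspect.  Comparing how many closed
   walks of length 4, 6 and 8 extend the various 3-arcs shows that the graph is
   never 3-arc-transitive.  Since G reflects each coordinate, this forces s = 2, and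
   the stabilizer of a 2-arc has exactly one fixed extension of it, its axial one.
   The edges can then be labelled by four labels such that the axial extension of a
   2-arc with labels c, c' has labels c, c', c.  Hence an automorphism fixing a
   vertex permutes the labels of all walks from it, and by 2-arc-transitivity all 24
   permutations occur: the stabilizer is the symmetric group S_4, and together with G
   any transposition that mixes the two coordinates generates everything.

   The set of closed label words is invariant under S_4.  The words (c c')^k close
   for the same k whether c and c' belong to the same coordinate or not, and this
   (with two similar words) leaves only n = m odd with r^2 = 1 or -1, n = 2m with
   r^2 + 1 = m, and (m, n) = (1, 4).  In these cases nubar and nu are the
   transpositions in question, because beta permutes the four step vectors. *)

Require Import Defs.
From mathcomp Require Import all_boot all_algebra all_fingroup.
From mathcomp Require Import ring zify.
Set Implicit Arguments.
Unset Strict Implicit.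
Unset Printing Implicit Defensive.
Import GRing.Theory GroupScope.
Local Open Scope ring_scope.

(** * Residues *)

(** Length 8 is natural because [generic8] closes for all parameters: in a 3-arc-transitive graph
    every 3-arc therefore lies on a closed walk of length 8. What survives the enumeration are
    relations such as 4 ± 2u = 0 or 3 ± u = 0 with u = r^s, which are refuted modulo 4, 5 and 17.
    The obstacle is formed by small parameters: n in {3, 4, 6, 8}, and small ms, where words close
    by winding around the levels. For n = 8, s >= 3 and for n = 3, s = 2 the existence of closed
    walks does not separate the 3-arcs, and uniqueness of the completion is compared instead. The
    sign [b0] tells whether the axial extension of a straight 2-arc repeats or negates the first
    sign. It stays a parameter: r^2 enters only through v = (-1)^b0 r^2, and the arithmetic settles
    the rest. That [beta] and [nu] yield automorphisms is never checked directly. 2-arc-transitivity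
    supplies an automorphism for each transposition of labels, and this automorphism is recognised
    as [nu] or [nubar] by following label words from the base vertex. *)

Lemma Zp_intr_eq0 n (z : int) : (1 < n)%N ->
  (z%:~R == 0 :> 'Z_n) = (n%:Z %| z)%Z.
Proof.
move=> n_gt1.
have H (k : nat) : (k%:R == 0 :> 'Z_n) = (n %| k)%N.
  by rewrite -val_eqE /= val_Zp_nat.
case: z => k; first by rewrite -[k%:~R]/(k%:R) H.
by rewrite NegzE mulrNz oppr_eq0 -[k.+1%:~R]/(k.+1%:R) H dvdzE abszN.
Qed.

Lemma Zp_intr_mod n (z : int) : (1 < n)%N ->
  exists q : int, z = ((z%:~R : 'Z_n) : nat)%:Z + n%:Z * q.
Proof.
move=> n_gt1; have n_neq0 : n%:Z != 0 by case: n n_gt1.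
have Dz := divz_eq z n%:Z; set q := (z %/ n)%Z in Dz; set k := (z %% n)%Z in Dz.
have k_ge0 : 0 <= k by exact: modz_ge0.
have k_ltn : k < n%:Z by rewrite ltz_pmod; case: n n_gt1 {n_neq0 q k Dz k_ge0}.
exists q; rewrite {1}Dz addrC mulrC; congr (_ + _).
have ->: (z%:~R : 'Z_n) = (absz k)%:R.
  rewrite Dz intrD intrM; have ->: (n%:Z%:~R : 'Z_n) = 0.
    by apply/eqP; rewrite Zp_intr_eq0 ?dvdzz.
  by rewrite mulr0 add0r -[(absz k)%:R]/((absz k)%:Z%:~R) gez0_abs.
by rewrite val_Zp_nat // modn_small ?gez0_abs //; lia.
Qed.

Lemma dvdn_small4 n : (3 <= n)%N -> (n %| 4)%N -> n = 4%N.
Proof. by move=> n3 n4; have := dvdn_leq (isT : 0 < 4)%N n4; case: n n3 n4 => [|[|[|[|[|n]]]]]. Qed.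

Lemma dvdn_small6 n : (3 <= n)%N -> (n %| 6)%N -> n = 3%N \/ n = 6%N.
Proof.
move=> n3 n6; have := dvdn_leq (isT : 0 < 6)%N n6.
by case: n n3 n6 => [|[|[|[|[|[|[|n]]]]]]]; auto.
Qed.

Lemma dvdn_small8 n : (3 <= n)%N -> (n %| 8)%N -> n = 4%N \/ n = 8%N.
Proof.
move=> n3 n8; have := dvdn_leq (isT : 0 < 8)%N n8.
by case: n n3 n8 => [|[|[|[|[|[|[|[|[|n]]]]]]]]]; auto.
Qed.

Lemma dvdn_small10 n : (3 <= n)%N -> (n %| 10)%N -> (5 %| n)%N.
Proof.
move=> n3 n10; have := dvdn_leq (isT : 0 < 10)%N n10.
by case: n n3 n10 => [|[|[|[|[|[|[|[|[|[|[|n]]]]]]]]]]].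
Qed.

(** The numbers 12, 20, 240 and 272 are 4^k - 2^k and 4^k + 2^k for k = 2 and k = 4, the multiples
    of n that [X_dvd] produces. *)
Lemma dvdn_mod4 k n : ~~ (4 %| n)%N -> (n %| k)%N ->
  (3 <= n)%N -> (k \in [:: 12; 20; 240; 272])%N ->
  [\/ n = 3%N, n = 6%N, (5 %| n)%N | (17 %| n)%N].
Proof.
move=> n4 nk n3 kin.
have k0 : (0 < k <= 272)%N by move: kin; rewrite !inE => /or4P[] /eqP->.
have test : all (fun k => all (fun n => [&& ~~ (4 %| n)%N, (n %| k)%N & (3 <= n)%N] ==>
   [|| n == 3%N, n == 6%N, (5 %| n)%N | (17 %| n)%N]) (iota 0 273)) [:: 12; 20; 240; 272].
  by vm_compute.
have k_gt0 : (0 < k)%N by case/andP: k0.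
have n_le : (n < 273)%N.
  by rewrite ltnS; apply: leq_trans (dvdn_leq k_gt0 nk) _; case/andP: k0.
have := allP (allP test k kin) n; rewrite mem_iota n_le n4 nk n3 => /(_ isT).
by case/or4P => [/eqP|/eqP||] H; [constructor 1 | constructor 2 | constructor 3 | constructor 4].
Qed.

Lemma Zp_natr_eq0 n k : (1 < n)%N -> (k%:R == 0 :> 'Z_n) = (n %| k)%N.
Proof. by move=> n_gt1; have := Zp_intr_eq0 k n_gt1; rewrite dvdzE. Qed.

Lemma Zp_natr_eq n k l : (1 < n)%N -> (k%:R == l%:R :> 'Z_n) = (k == l %[mod n])%N.
Proof. by move=> n_gt1; rewrite -val_eqE /= !val_Zp_nat. Qed.

(** * Solving the closing conditions of label words for m, n and r *)

Section Arithmetic.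
Variables (m n : nat) (r : {unit 'Z_n}) (b0 : bool).
Hypotheses (m_gt0 : (0 < m)%N) (n_ge3 : (3 <= n)%N).
Let n_gt1 : (1 < n)%N := ltnW n_ge3.
Let natr_eq0 k := Zp_natr_eq0 k n_gt1.
Let natr_eq k l := Zp_natr_eq k l n_gt1.
Let v : 'Z_n := (-1) ^+ b0 * val r ^+ 2.
Let geom c : 'Z_n := \sum_(t < c) v ^+ t.
Hypothesis v2 : v *+ 2 = 2%:R.
Hypothesis order02 : forall c, (n %| 2 * c)%N <-> (m %| c)%N /\ geom c = 0.
Hypothesis order0213 : forall c,
  (n %| 2 * c)%N <-> (m %| 2 * c)%N /\ (1 - v ^+ c) * geom c = 0.

Lemma double_eq0 (x : 'Z_n) : (x *+ 2 == 0) = (n %| 2 * x)%N.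
Proof. by rewrite -{1}[x]natr_Zp -mulrnA mulnC natr_eq0. Qed.

Lemma geom1 c : v = 1 -> geom c = c%:R.
Proof.
move=> v1; rewrite /geom (eq_bigr (fun=> 1)) => [|t _]; last by rewrite v1 expr1n.
by rewrite sumr_const card_ord.
Qed.

(** For odd n the factor 2 cancels, so v = 1; then [order02] at c = n gives m | n and [order0213] at
    c = m gives n | m. *)
Lemma odd_params : odd n -> m = n /\ v = 1.
Proof.
move=> n_odd; have cop k : (n %| 2 * k)%N = (n %| k)%N.
  by rewrite Gauss_dvdr // coprimen2.
have v1 : v = 1.
  apply/eqP; rewrite -subr_eq0 -[v - 1]natr_Zp natr_eq0 -cop -double_eq0.
  by rewrite mulrnBl v2 subrr.
split=> //; apply/eqP; rewrite eqn_dvd; apply/andP; split.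
  by have /order02[] : (n %| 2 * n)%N by rewrite dvdn_mull.
rewrite -cop; apply/order0213; rewrite dvdn_mull // v1 expr1n subrr mul0r; split=> //.
Qed.

Lemma sum_involution (w : 'Z_n) k : w ^+ 2 = 1 -> \sum_(t < 2 * k) w ^+ t = k%:R * (1 + w).
Proof.
move=> w2; elim: k => [|k IHk]; first by rewrite muln0 big_ord0 mul0r.
rewrite mulnS addnC addn2 !big_ord_recr /= IHk exprS exprM w2 expr1n -natr1; ring.
Qed.

(** Put N = n / 2. Since 2v = 2, v is 1 or 1 + N, and v = 1 would make [geom N] equal to N instead
    of 0. For odd N one would get v^2 = v with v a unit other than 1; so N = 2k and v^2 = 1. Now
    [geom N] = k(1 + v) forces k to be odd. Finally [order0213] is read at an exponent c with v^c =
    1: c = m for even m, c = 2m for odd m. *)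
Lemma even_params : val r ^+ (m * 2) = 1 \/ val r ^+ (m * 2) = -1 -> ~~ odd n ->
  b0 /\ ([/\ n = (2 * m)%N, (m %% 4 = 2)%N & val r ^+ 2 + 1 = m%:R] \/ m = 1%N /\ n = 4%N).
Proof.
move=> rp n_ev; pose N := n./2; have Dn : n = (2 * N)%N by rewrite mul2n even_halfK.
have d2 k : (n %| 2 * k)%N = (N %| k)%N by rewrite Dn dvdn_pmul2l.
have N_ge2 : (1 < N)%N by lia.
have [mN gN] : (m %| N)%N /\ geom N = 0 by apply/order02; rewrite -Dn.
have dN k : (n %| N * k)%N = (2 %| k)%N by rewrite Dn [(2 * N)%N]mulnC dvdn_pmul2l //; lia.
have Nn0 : (N%:R == 0 :> 'Z_n) = false by rewrite natr_eq0 -[N]muln1 dN.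
have vN : v = 1 + N%:R.
  have : (v - 1) *+ 2 == 0 by rewrite mulrnBl v2 subrr.
  have : ((v - 1)%R < n)%N by have := ltn_ord (v - 1); rewrite [X in (_ < X)%N -> _]Zp_cast.
  rewrite double_eq0; move E: (nat_of_ord (v - 1)) => a lt_an.
  rewrite d2 => /dvdnP[[|[|k]] Da]; last by lia.
    by move/eqP: gN; rewrite geom1 ?Nn0 //; apply/eqP; rewrite -subr_eq0 -[v - 1]natr_Zp E Da.
  by rewrite -[v](subrK 1) -[v - 1]natr_Zp E Da mul1n addrC.
have v_unit : v \is a GRing.unit.
  by rewrite /v unitrM unitrX ?unitrN1 // unitrX //; exact: (valP r).
have N2 : N%:R *+ 2 = 0 :> 'Z_n by apply/eqP; rewrite -mulrnA mulnC natr_eq0 Dn.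
have NN k : (N * k)%:R = (odd k)%:R * N%:R :> 'Z_n.
  apply/eqP; rewrite -natrM natr_eq -{1}[k]odd_double_half.
  by rewrite (_ : N * _ = k./2 * n + odd k * N)%N ?modnMDl //; lia.
have N_ev : ~~ odd N.
  apply/negP => N_odd; have : v * v == v * 1.
    have E : N%:R * N%:R = N%:R :> 'Z_n by rewrite -natrM NN N_odd mul1r.
    by rewrite mulr1 {2}vN mulrDr mulr1 vN mulrDl mul1r E -[X in _ + X]mulr2n N2 addr0.
  rewrite (inj_eq (mulrI v_unit)) vN -subr_eq0 addrC addKr Nn0 //.
pose k := N./2; have DN : N = (2 * k)%N by rewrite mul2n even_halfK.
have v_sq : v ^+ 2 = 1.
  have E : N%:R * N%:R = 0 :> 'Z_n by rewrite -natrM NN (negPf N_ev) mul0r.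
  by rewrite vN expr2 mulrDr mulr1 mulrDl E mul1r addr0 -addrA -mulr2n N2 addr0.
have k_odd : odd k.
  have gk : geom N = k%:R * (1 + v) by rewrite DN; apply: sum_involution.
  have EN : N%:R = k%:R *+ 2 :> 'Z_n by rewrite DN mulnC mulrnA.
  have E : k%:R * (1 + (1 + N%:R)) = N%:R + (N * k)%:R :> 'Z_n by rewrite natrM EN; ring.
  move/eqP: gN; rewrite gk vN E NN; case: (odd k) => //.
  by rewrite mul0r addr0 Nn0.
(* Otherwise r^2 = 1 + 2k with k odd, which is 3 modulo 4, whereas r is odd. *)
have b0T : b0.
  rewrite -[b0]negbK; apply/negP => /negPf b0F; have := vN.
  rewrite /v b0F mul1r -[val r]natr_Zp -natrX -[1]/(1%:R) -natrD => /eqP; rewrite natr_eq => /eqP E.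
  have r_odd : odd (val r).
    have co : coprime n (val r) by rewrite -unitZpE // natr_Zp; exact: (valP r).
    by rewrite -coprime2n; apply: coprime_dvdl co; rewrite Dn dvdn_mulr.
  have n4 : (4 %| n)%N by rewrite Dn DN mulnA dvdn_mulr.
  have : (val r ^ 2 = 1 + N %[mod 4])%N by rewrite -(modn_dvdm _ n4) E modn_dvdm.
  rewrite DN; move: r_odd; move: (nat_of_ord (val r)) => a a_odd.
  have -> : (a = 1 + 2 * a./2)%N by lia.
  have -> : (k = 1 + 2 * k./2)%N by lia.
  by move: a./2 k./2 => h h'; rewrite -mulnn; lia.
have r_sq : val r ^+ 2 = - v by rewrite /v b0T expr1 mulN1r opprK.
split=> //; case: (boolP (odd m)) => [m_odd|m_ev].
- right; have vm2 : v ^+ (2 * m) = 1 by rewrite exprM v_sq expr1n.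
  have : (n %| 2 * (2 * m))%N.
    apply/order0213; rewrite vm2 subrr mul0r; split=> //; by rewrite mulnA dvdn_mull.
  rewrite d2 DN dvdn_pmul2l // => km.
  have mk : (m %| k)%N by move: mN; rewrite DN Gauss_dvdr // coprimen2.
  have Dm : m = k by apply/eqP; rewrite eqn_dvd mk.
  (* So -v is 1 or -1. As v is not 1, this means 1 + N = -1 modulo 2N, that is N = 2. *)
  have vm : val r ^+ (m * 2) = - v.
    rewrite mulnC exprM r_sq exprNn -signr_odd m_odd expr1 mulN1r.
    by rewrite -[m]odd_double_half m_odd -mul2n exprD expr1 exprM v_sq expr1n mulr1.
  suff k1 : k = 1%N by rewrite Dm Dn DN k1.
  case: rp; rewrite vm => /eqP.
    rewrite eqr_oppLR -addr_eq0 vN.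
    rewrite (_ : 1 + N%:R + 1 = (N + 2)%:R) ?natr_eq0 //; last by rewrite natrD; ring.
    by move/dvdn_leq; lia.
  by rewrite eqr_opp vN -subr_eq0 addrC addKr Nn0.
have vm : v ^+ m = 1 by rewrite -[m]odd_double_half (negPf m_ev) -mul2n exprM v_sq expr1n.
have : (n %| 2 * m)%N.
  apply/order0213; rewrite vm subrr mul0r; split=> //; by rewrite dvdn_mull.
rewrite d2 => Nm.
have Dm : m = N by apply/eqP; rewrite eqn_dvd mN.
left; split; [by rewrite Dm | by lia |].
rewrite r_sq vN Dm.
rewrite (_ : - (1 + N%:R) + 1 = - N%:R); last by ring.
by apply/eqP; rewrite eq_sym -addr_eq0 -mulr2n N2.
Qed.
End Arithmetic.

(** * Closed walks and words *)

Section ClosedWalks.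
Variables (T : finType) (e : rel T).

Fixpoint nonback (p : seq T) : bool :=
  if p is x :: p' then
    (if p' is _ :: z :: _ then x != z else true) && nonback p'
  else true.

(* The closed walk x, p_1, ..., p_L = x; nothing is backtracked, not even at x. *)
Definition closed_walk (x : T) (p : seq T) : bool :=
  [&& path e x p, last x p == x & nonback (x :: rcons p (head x p))].

Definition has_closed L x a :=
  exists2 q, size (a ++ q) = L & closed_walk x (a ++ q).

(** Existence and uniqueness of completions are the invariants by which 3-arcs are told apart. *)
Definition uniq_closed L x a := forall q q',
  size (a ++ q) = L -> size (a ++ q') = L ->
  closed_walk x (a ++ q) -> closed_walk x (a ++ q') -> q = q'.

Variable g : {perm T}.
Hypothesis gA : g \in graph_aut e.

Lemma nonback_map p : nonback (map g p) = nonback p.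
Proof.
elim: p => [|x p IHp] //=; rewrite IHp; congr (_ && _).
by case: p {IHp} => [|y [|z p]] //=; rewrite (inj_eq perm_inj).
Qed.

Lemma closed_walk_map x p : closed_walk (g x) (map g p) = closed_walk x p.
Proof.
have /graph_autP gE := gA; rewrite /closed_walk last_map (inj_eq perm_inj).
congr [&& _, _ & _]; first by elim: p x => [|y p IHp] x //=; rewrite gE IHp.
by rewrite -[in RHS]nonback_map map_cons map_rcons; case: p.
Qed.

Lemma has_closed_map L x a : has_closed L x a -> has_closed L (g x) (map g a).
Proof.
by case=> q sq cq; exists (map g q); rewrite -map_cat ?size_map ?closed_walk_map.
Qed.
End ClosedWalks.

Lemma has_closed_aut (T : finType) (e : rel T) (g : {perm T}) L x a : g \in graph_aut e ->
  has_closed e L (g x) (map g a) -> has_closed e L x a.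
Proof.
move=> gA /(has_closed_map (groupVr gA)); rewrite permK -map_comp.
by rewrite (eq_map (g := id)) ?map_id // => y; rewrite /= permK.
Qed.

Lemma uniq_closed_aut (T : finType) (e : rel T) (g : {perm T}) L x a : g \in graph_aut e ->
  uniq_closed e L (g x) (map g a) -> uniq_closed e L x a.
Proof.
move=> gA gU q q' sq sq' cq cq'; have := gU (map g q) (map g q').
rewrite -!map_cat !size_map !(closed_walk_map gA) => /(_ sq sq' cq cq').
by apply: inj_map; apply: perm_inj.
Qed.

(** Walking an arc backwards reverses its direction and subtracts its vector, so both bits flip. *)
Definition inv_step (st : bool * bool) := (~~ st.1, ~~ st.2).

Fixpoint nonbackw (w : seq (bool * bool)) : bool :=
  if w is a :: w' then
    (if w' is b :: _ then b != inv_step a else true) && nonbackw w'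
  else true.

Lemma nonbackw_rcons w a : nonbackw (rcons w a) -> nonbackw w.
Proof. by elim: w => [|b [|c w] IHw] //= /andP[-> /IHw]. Qed.

(** Backtracking reverses the direction, so a step in the direction of the last one is admissible
    whatever its sign. This serves closed walks of nonzero net level, where the sign of the repeated
    first step is not under control. *)
Lemma nonbackw_rcons_dir w a b : nonbackw (a :: w) -> (last a w).1 = b.1 ->
  nonbackw (rcons (a :: w) b).
Proof.
elim: w a => [|c w IHw] a /=.
  by case: a b => [[] ?] [[] ?] //= _ _.
by move=> /andP[-> nb] /(IHw c nb).
Qed.

Fixpoint net (w : seq (bool * bool)) : int :=
  if w is a :: w' then (if a.1 then 1 else -1) + net w' else 0.

Fixpoint incr_at (l : seq int) (i : nat) (c : int) : seq int :=
  if i is i'.+1 then head 0 l :: incr_at (behead l) i' c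
  else (head 0 l + c) :: behead l.

(* Coefficients, in powers of r ^ s, of the displacement along the coordinate
   that belongs to the layers congruent to c - 8 modulo s; the word starts at
   level t - 8, so that all layers have natural indices. *)
Fixpoint class_coefs (s c t : nat) (w : seq (bool * bool)) : seq int :=
  if w is a :: w' then
    let lay := if a.1 then t else t.-1 in
    let l := class_coefs s c (if a.1 then t.+1 else t.-1) w' in
    if (lay %% s == c)%N then incr_at l (lay %/ s) (if a.2 then -1 else 1) else l
  else [::].

Section Eval.
Variables (R : comUnitRingType) (u : R).
Definition lev (l : seq int) : R := foldr (fun a acc => a%:~R + u * acc) 0 l.

Lemma lev_behead l : lev l = (head 0 l)%:~R + u * lev (behead l).
Proof. by case: l => [|a l] //=; rewrite mulr0 addr0. Qed.

Lemma lev_incr l i c : lev (incr_at l i c) = lev l + c%:~R * u ^+ i.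
Proof.
elim: i l => [|i IHi] l /=; rewrite (lev_behead l).
  by rewrite intrD expr0 mulr1 addrAC.
by rewrite IHi exprS; ring.
Qed.

(** Leading zeros amount to factors of the unit u, trailing zeros contribute nothing, and a global
    sign is irrelevant; [normal] removes all three, so that conditions can be looked up in short
    tables. *)
Fixpoint strip (l : seq int) : seq int :=
  if l is a :: l' then if a == 0 then strip l' else l else [::].
Definition normal (l : seq int) : seq int :=
  let l' := rev (strip (rev (strip l))) in
  if head 0 l' < 0 then map -%R l' else l'.

Lemma lev_strip l : u \is a GRing.unit -> (lev (strip l) == 0) = (lev l == 0).
Proof.
move=> uU; elim: l => [|a l IHl] //=; case: (eqVneq a 0) => [->|//].
by rewrite IHl add0r mulrI_eq0 //; apply: mulrI.
Qed.

Lemma lev_cat l l' : lev (l ++ l') = lev l + u ^+ size l * lev l'.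
Proof.
elim: l => [|a l IHl] /=; first by rewrite add0r expr0 mul1r.
by rewrite IHl exprS; ring.
Qed.

Lemma lev_strip_rev l : lev (rev (strip (rev l))) = lev l.
Proof.
elim/last_ind: l => [|l a IHl] //; rewrite rev_rcons /=; case: eqP => [->|_].
  by rewrite IHl -cats1 lev_cat /= mulr0 addr0 mulr0 addr0.
by rewrite rev_cons revK.
Qed.

Lemma levN l : lev (map -%R l) = - lev l.
Proof. by elim: l => [|a l IHl] /=; rewrite ?oppr0 // IHl intrN; ring. Qed.

Lemma lev_normal l : u \is a GRing.unit -> (lev (normal l) == 0) = (lev l == 0).
Proof.
move=> uU; rewrite /normal; case: ifP => _; rewrite ?levN ?oppr_eq0 lev_strip_rev.
  exact: lev_strip.
exact: lev_strip.
Qed.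
End Eval.

(* A list [:: c0; c1; c2] stands for the condition c0 + c1 u + c2 u ^ 2 = 0, where
   u = r ^ s; a word closes up if its net level and all these sums vanish. For
   words of length at most 8, classes beyond the 16 levels in reach do not occur. *)
Definition conds (s : nat) (w : seq (bool * bool)) : seq (seq int) :=
  [seq normal (class_coefs s c 8 w) | c <- iota 0 (minn s 16)].

(** After a return with nonzero net level the first step is read on another level, where its sign
    may differ. Hence the wrap-around is tested only for net level 0, which keeps the test a
    necessary condition. *)
Definition wrap_ok (w : seq (bool * bool)) :=
  nonbackw w && ((net w == 0) ==> nonbackw (rcons w (head (true, true) w))).

Definition oddz (j : int) : bool := odd (absz j).

Lemma oddzD1 j : oddz (j + 1) = ~~ oddz j.
Proof. rewrite /oddz; lia. Qed.

Lemma oddzB1 j : oddz (j - 1) = ~~ oddz j.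
Proof. rewrite /oddz; lia. Qed.

(** The sign (-1)^(b0 t) of the layers 2t and 2t + 1; it turns r^(2t) into the power v^t of v =
    (-1)^b0 r^2. *)
Definition half_sign (b0 : bool) (lay : int) : bool := b0 && oddz (lay %/ 2)%Z.

Lemma half_signD2 b0 lay : half_sign b0 (lay + 2) = half_sign b0 lay (+) b0.
Proof.
rewrite /half_sign; have -> : ((lay + 2) %/ 2)%Z = (lay %/ 2)%Z + 1 by lia.
rewrite oddzD1.
by case: b0 => //=; rewrite addbT.
Qed.

(** * Enumeration of short closed words *)

Local Notation U := (true, false).
Local Notation U' := (true, true).
Local Notation D := (false, false).
Local Notation D' := (false, true).

Fixpoint allw (k : nat) : seq (seq (bool * bool)) :=
  if k is k'.+1 then [seq a :: q | a <- [:: U; U'; D; D'], q <- allw k'] else [:: [::]].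

Lemma mem_allw q : q \in allw (size q).
Proof.
elim: q => [|a q IHq] //=; rewrite !mem_cat.
by case: a => [[] []]; rewrite map_f ?orbT.
Qed.

Definition walk_test (L : nat) (p : seq (bool * bool)) (ok : pred (seq (bool * bool))) :=
  all (fun q => wrap_ok (p ++ q) ==> ok (p ++ q)) (allw (L - size p)).

Definition hits (K : seq (seq int)) s w := has (fun l => l \in K) (conds s w).

(** The tables list relations in u = r^s. Those of [K2] fail for all n >= 3, those of [K4] unless n
    = 4, those of [K6] unless n is 3, 4 or 6; the other tables are named after the absolute values
    of the coefficients. *)
Definition K2 : seq (seq int) := [:: [:: 1]; [:: 2]].
Definition K4 : seq (seq int) := [:: [:: 1]; [:: 2]; [:: 4]].
Definition K6 : seq (seq int) := [:: [:: 1]; [:: 2]; [:: 4]; [:: 3]; [:: 6]].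
Definition K11 : seq (seq int) := [:: [:: 1; 1]; [:: 1; -1]].
Definition K31 : seq (seq int) := [:: [:: 3; 1]; [:: 3; -1]].
Definition K22 : seq (seq int) := [:: [:: 2; 2]; [:: 2; -2]].
Definition K111 : seq (seq int) :=
  [:: [:: 1; 1; 1]; [:: 1; 1; -1]; [:: 1; -1; 1]; [:: 1; -1; -1]].
Definition K1111 : seq (seq int) :=
  [seq [:: 1, x.1 & x.2] | x <- [seq (a, l) | a <- [:: 1; -1 : int],
     l <- [:: [:: 1; 1]; [:: 1; -1]; [:: -1; 1]; [:: -1; -1]]]].
Definition X42 (c : int) : seq (seq int) := [:: [:: 4; c * 2]; [:: 2; c * 4]].

Definition okK K s w := (s%:Z %| net w)%Z ==> hits K s w.

(** The value s = 16 stands for all larger ones: the conditions on a word of length at most 8 are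
    the same, and its net level must be 0. *)
Lemma test_UUD4 : all (fun s => walk_test 4 [:: U; U; D] (okK K2 s)) (iota 2 15).
Proof. by vm_compute. Qed.

Lemma test_UDU4 : walk_test 4 [:: U; D; U] (okK K4 2).
Proof. by vm_compute. Qed.

(** Words that close by winding around the levels, for which ms has to divide 2 or 4. *)
Definition wind24 (w : seq (bool * bool)) :=
  (absz (net w) == 2%N) || (absz (net w) == 4%N) && hits K11 2 w.

Lemma test_UDU6 : walk_test 6 [:: U; D; U]
  (fun w => (2%:Z %| net w)%Z ==> hits K6 2 w || wind24 w).
Proof. by vm_compute. Qed.

Definition zigzag8 := [:: U; D; U; D; U; D; U; D].

Lemma test_UDU8_ge3 : all (fun s => walk_test 8 [:: U; D; U]
  (fun w => (s%:Z %| net w)%Z ==> hits K4 s w || (w == zigzag8) && hits [:: [:: 8]] s w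
     || [&& s == 3%N, hits K11 s w & hits K31 s w])) (iota 3 14).
Proof. by vm_compute. Qed.

Lemma test_UUU8_ge5 : all (fun s => walk_test 8 [:: U; U; U] (okK K4 s)) (iota 5 12).
Proof. by vm_compute. Qed.

Lemma test_UUU8_4 : walk_test 8 [:: U; U; U]
  (fun w => (4%:Z %| net w)%Z ==> hits K4 4 w || (absz (net w) == 8%N)).
Proof. by vm_compute. Qed.

Definition wind246 (w : seq (bool * bool)) :=
  wind24 w || (absz (net w) == 6%N) && hits K111 2 w.

Lemma test_UDU8_2 : walk_test 8 [:: U; D; U]
  (fun w => (2%:Z %| net w)%Z ==> hits (K4 ++ K22) 2 w || wind246 w
    || (net w == 0) && hits (X42 1 ++ X42 (-1) ++ [:: [:: 8]]) 2 w
    || (absz (net w) == 4%N) && hits K31 2 w).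
Proof. by vm_compute. Qed.

Lemma test_UUU8_2 (b : bool) : walk_test 8 [:: U; U; (true, b)]
  (fun w => (2%:Z %| net w)%Z ==> hits (K4 ++ K22) 2 w || wind246 w
    || (net w == 0) && hits (X42 (if b then -1 else 1)) 2 w
    || (absz (net w) == 4%N)
    || (absz (net w) == 8%N) && hits K1111 2 w).
Proof. by case: b; vm_compute. Qed.

(* For n = 6 and n = 3 one has r ^ 2 = 1. *)
Definition zero1 (n : nat) (l : seq int) := (n%:Z %| lev 1 l)%Z.

Lemma test_UUU6_n6 : walk_test 6 [:: U; U; U]
  (fun w => (2%:Z %| net w)%Z ==> ~~ all (zero1 6) (conds 2 w) || wind24 w).
Proof. by vm_compute. Qed.

Lemma test_UUU6_n3 : walk_test 6 [:: U; U; U]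
  (fun w => (2%:Z %| net w)%Z ==> ~~ all (zero1 3) (conds 2 w) || wind24 w
     || (absz (net w) == 6%N)).
Proof. by vm_compute. Qed.

Definition n3_word := [:: U; U; D; D; D'; D'; U'; U'].

Lemma test_UUDD8_n3 : walk_test 8 [:: U; U; D; D]
  (fun w => (6%:Z %| net w)%Z ==> all (zero1 3) (conds 2 w) ==> (w == n3_word)).
Proof. by vm_compute. Qed.

(** Two completions for each of the three possible fourth steps after U D U. *)
Definition n3_words := [::
  [:: U; D; U; U; U; U; U'; U]; [:: U; D; U; U; U; D; D'; D];
  [:: U; D; U; U'; U; U'; U'; U']; [:: U; D; U; U'; U; D; D; D];
  [:: U; D; U; D; D; D; U; U']; [:: U; D; U; D; D'; D; U; U]].

(* Sufficient for a word to be a closed walk once it closes up. *)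
Definition walk_ok (w : seq (bool * bool)) :=
  wrap_ok w && ((net w == 0) || ((head U' w).1 == (last U' w).1)).

Lemma test_n3_words : all (fun w => [&& walk_ok w, (6%:Z %| net w)%Z &
  all (zero1 3) (conds 2 w)]) (n3_word :: n3_words).
Proof. by vm_compute. Qed.

(** The word stays in two adjacent layers and crosses each of them twice with either sign, so
    everything cancels. *)
Definition generic8 := [:: U; U; D; D'; U'; U'; D'; D].

Lemma test_generic : all (fun s => all (pred1 [::]) (conds s generic8)) (iota 2 15).
Proof. by vm_compute. Qed.

Definition zigzag4 := [:: U; D; U; D].
Definition zigzag6 := [:: U; D; U; D; U; D].

Lemma test_zigzag : all (fun s =>
  [&& all (mem [:: [::]; [:: 4]]) (conds s zigzag4),
      all (mem [:: [::]; [:: 6]]) (conds s zigzag6) &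
      all (mem [:: [::]; [:: 8]]) (conds s zigzag8)]) (iota 2 15).
Proof. by vm_compute. Qed.
(** * The cover with integer levels *)

Section Cover.
Variables (m s n : nat) (r : {unit 'Z_n}).
Hypotheses (m_gt0 : (0 < m)%N) (s_ge2 : (2 <= s)%N) (n_ge3 : (3 <= n)%N).
Hypothesis r_pow : val r ^+ (m * s) = 1 \/ val r ^+ (m * s) = -1.

Local Notation R := 'Z_n.
Local Notation M := (m * s)%N.
Let n_gt1 : (1 < n)%N. Proof. exact: ltnW. Qed.
Let natr_eq0 k := Zp_natr_eq0 k n_gt1.
Let M_gt1 : (1 < M)%N. Proof. by rewrite (leq_trans s_ge2) // leq_pmull. Qed.

Definition cover : Type := (int * 'rV['Z_n]_s)%type.
Definition cls (j : int) : nat := absz (j %% s%:Z)%Z.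
Definition dvec (lay : int) (b : bool) : 'rV['Z_n]_s :=
  ((-1) ^+ b * val r ^ lay) *: stdvec s n (cls lay).
(* A step is a pair (up, neg). *)
Definition mv (x : cover) (st : bool * bool) : cover :=
  if st.1 then (x.1 + 1, x.2 + dvec x.1 st.2)
  else (x.1 - 1, x.2 + dvec (x.1 - 1) st.2).
Lemma mv_level x st : (mv x st).1 = if st.1 then x.1 + 1 else x.1 - 1.
Proof. by case: st => [[] b]. Qed.
Definition proj (x : cover) : bvertex m s n := (x.1%:~R, x.2).

Lemma r_unit : val r \is a GRing.unit. Proof. exact: valP. Qed.

Lemma cls_lt j : (cls j < s)%N.
Proof.
have s0 : s%:Z != 0 by lia.
have := modz_ge0 j s0; have := ltz_mod j s0; rewrite /cls; lia.
Qed.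

Lemma cls_eq j k : (cls j == cls k) = (s%:Z %| j - k)%Z.
Proof.
have s0 : s%:Z != 0 by lia.
rewrite -eqz_mod_dvd /cls.
have := modz_ge0 j s0; have := modz_ge0 k s0; lia.
Qed.

Lemma stdvec_neq0 (c : R) j : c != 0 -> c *: stdvec s n (cls j) != 0.
Proof.
apply: contra => /eqP/rowP/(_ (Ordinal (cls_lt j))).
by rewrite !mxE eqxx mulr1 => ->.
Qed.

Lemma two_neq0 : (2%:R : R) != 0.
Proof. by rewrite (Zp_intr_eq0 2 n_gt1); apply/negP => /dvdn_leq; lia. Qed.

Lemma one_neqN1 : (1 : R) != -1.
Proof. by rewrite -subr_eq0 opprK -[1 + 1]/(2%:R) two_neq0. Qed.

Lemma unitXz_eq0 (c : R) j : (c * val r ^ j == 0) = (c == 0).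
Proof. by rewrite (mulIr_eq0 _ (mulIr (unitrXz j r_unit))). Qed.

Lemma sign_inj : injective (fun b : bool => (-1) ^+ b : R).
Proof.
move=> [] [] //= /eqP; rewrite expr1 expr0 eq_sym ?(negPf one_neqN1) //.
by rewrite eq_sym (negPf one_neqN1).
Qed.

Lemma dvec_inj j : injective (dvec j).
Proof.
move=> b c /eqP; rewrite -subr_eq0 -scalerBl -mulrBl => H.
apply/sign_inj/eqP; rewrite -subr_eq0.
by apply: contraLR H => neq; apply: stdvec_neq0; rewrite unitXz_eq0.
Qed.

Lemma dvecN j b : dvec j (~~ b) = - dvec j b.
Proof. by rewrite /dvec signrN mulNr scaleNr. Qed.

Lemma dvec_cls_neq j k b c : cls j != cls k -> dvec j b != dvec k c.
Proof.
move=> neq; apply/eqP => /rowP/(_ (Ordinal (cls_lt j)))/eqP.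
by rewrite !mxE /= eqxx (negPf neq) mulr0 mulr1 unitXz_eq0 signr_eq0.
Qed.

Lemma r_powz : exists b : bool, val r ^+ M = (-1) ^+ b.
Proof. by case: r_pow => ->; [exists false | exists true]. Qed.

Lemma cls_mod (j : int) : (((j%:~R : 'Z_M) : nat) %% s)%N = cls j.
Proof.
have [q Dj] := Zp_intr_mod j M_gt1; set i : nat := nat_of_ord _ in Dj *.
by rewrite /cls Dj addrC PoszM mulrAC modzMDl modz_nat absz_nat.
Qed.

(** Passing from an integer level to its residue modulo ms multiplies the step vector by a power of
    r^(ms) = 1 or -1, which can only exchange the two signs. *)
Lemma level_dvec (j : int) : exists c : bool, forall b : bool,
  ((-1) ^+ b * val r ^+ ((j%:~R : 'Z_M) : nat))
    *: stdvec s n (((j%:~R : 'Z_M) : nat) %% s) = dvec j (b (+) c).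
Proof.
have [q Dj] := Zp_intr_mod j M_gt1; have [b0 Db0] := r_powz.
have Dc : exists c : bool, val r ^ (M%:Z * q) = (-1) ^+ c.
  rewrite -exprz_exp -[val r ^ M%:Z]/(val r ^+ M) Db0.
  case: q {Dj} => q; first by exists (odd (b0 * q)); rewrite signr_odd exprM.
  exists (odd (b0 * q.+1)); rewrite signr_odd exprM NegzE -exprz_inv.
  by rewrite (_ : ((-1) ^+ b0)^-1 = (-1) ^+ b0 :> R) //; case: (b0); rewrite ?invrN1 ?invr1.
case: Dc => c Dc; exists c => b; rewrite cls_mod /dvec; congr (_ *: _).
have -> : val r ^ j = val r ^+ ((j%:~R : 'Z_M) : nat) * (-1) ^+ c.
  by rewrite [in LHS]Dj exprzDr ?r_unit // Dc.
by rewrite mulrCA -signr_addb -addbA addbb addbF mulrC.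
Qed.

Lemma cpm_step_proj x y :
  reflect (exists b, y = proj (mv x (true, b))) (cpm_step r (proj x) y).
Proof.
apply: (iffP andP); have [c Hc] := level_dvec x.1;
  have := Hc false; rewrite expr0 mul1r addFb => Hd; rewrite /= Hd.
  case=> /eqP y1 /orP[] /eqP y2; [exists c | exists (~~ c)].
    by rewrite [LHS]surjective_pairing y1 y2 /proj /= intrD.
  by rewrite [LHS]surjective_pairing y1 y2 /proj /= intrD dvecN.
case=> b ->; rewrite /= intrD eqxx; split=> //.
have [->|->] : b = c \/ b = ~~ c by case: b (c) => [] []; auto.
  by rewrite eqxx.
by rewrite dvecN eqxx orbT.
Qed.

Lemma mvK x st : mv (mv x st) (inv_step st) = x.
Proof.
case: x st => j v [[] b] /=; rewrite /mv /= ?addrK ?subrK dvecN ?addrK //.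
Qed.

Lemma cpmbar_adj_proj x y :
  reflect (exists st, y = proj (mv x st)) (cpmbar_adj r (proj x) y).
Proof.
apply: (iffP orP) => [[/cpm_step_proj [b ->] | H] | [[[] b] ->]].
- by exists (true, b).
- pose z : cover := (x.1 - 1, y.2).
  have Dy : y = proj z.
    rewrite [LHS]surjective_pairing /proj /=; congr (_, _).
    case/andP: H => /eqP /= H _.
    by rewrite intrB H -[X in _ = _ - X]/(1 : 'Z_M) addrK.
  rewrite Dy in H *; case/cpm_step_proj: H => b; rewrite /proj /= => -[_ Db].
  by exists (false, ~~ b); rewrite /mv /= Db dvecN addrK.
- by left; apply/cpm_step_proj; exists b.
right; apply/cpm_step_proj; exists (~~ b).
by rewrite -{1}(mvK x (false, b)).
Qed.

(** The vectors alone separate the four neighbours, since adjacent layers move different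
    coordinates; the levels would not, as up and down coincide for ms = 2. *)
Lemma proj_mv_inj x : injective (fun st => proj (mv x st)).
Proof.
have s0 : ~~ (s%:Z %| 1)%Z by rewrite dvdzE /= dvdn1; lia.
move=> [a b] [a' b'] [].
case: a; case: a' => /= _ /addrI; try by move/dvec_inj ->.
  move/eqP; rewrite (negPf (dvec_cls_neq _ _ _)) // cls_eq.
  by rewrite (_ : _ - _ = 1) //; ring.
move/eqP; rewrite eq_sym (negPf (dvec_cls_neq _ _ _)) // cls_eq.
by rewrite (_ : _ - _ = 1) //; ring.
Qed.

Lemma projP y : exists x, y = proj x.
Proof.
by exists ((y.1 : nat)%:Z, y.2); rewrite [LHS]surjective_pairing /proj /= -[_%:~R]/(_%:R) natr_Zp.
Qed.

Lemma cpm_set_adj x y : x \in cpm_set m s r -> cpmbar_adj r x y -> y \in cpm_set m s r.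
Proof. by rewrite !inE => /connect_trans x0 xy; apply: x0; apply: connect1. Qed.

Lemma proj_mv_set x st : proj x \in cpm_set m s r -> proj (mv x st) \in cpm_set m s r.
Proof.
by move=> /cpm_set_adj; apply; apply/cpmbar_adj_proj; exists st.
Qed.

(* The levels of the cover are integers, so that its vertices carry no winding
   condition; only the part above the component of the origin is used. *)
Definition ccover : Type := {x : cover | proj x \in cpm_set m s r}.
Definition mvc (x : ccover) st : ccover :=
  exist _ (mv (val x) st) (proj_mv_set st (valP x)).
Definition pr (x : ccover) : cpm m s r := exist _ (proj (val x)) (valP x).
Definition mvs (x : ccover) (w : seq (bool * bool)) : ccover := foldl mvc x w.

Lemma ccover_inj (x y : ccover) : val x = val y -> x = y.
Proof. exact: val_inj. Qed.

Lemma mvs_cat x w w' : mvs x (w ++ w') = mvs (mvs x w) w'.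
Proof. exact: foldl_cat. Qed.

Lemma mvs_rcons x w a : mvs x (rcons w a) = mvc (mvs x w) a.
Proof. by rewrite -cats1 mvs_cat. Qed.

Lemma mvcK x st : mvc (mvc x st) (inv_step st) = x.
Proof. by apply: ccover_inj; rewrite /= mvK. Qed.

Lemma base_in : proj (0, 0) \in cpm_set m s r.
Proof. by rewrite inE connect0. Qed.
Definition base : ccover := exist _ (0, 0) base_in.

Lemma cpm_adj_pr x y :
  reflect (exists st, y = pr (mvc x st)) (cpm_adj (pr x) y).
Proof.
apply: (iffP (cpmbar_adj_proj _ _)) => -[st H]; exists st; last by rewrite H.
exact: val_inj.
Qed.

Lemma pr_mvc_inj x a b : pr (mvc x a) = pr (mvc x b) -> a = b.
Proof. by move/(congr1 val)/proj_mv_inj. Qed.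

Lemma prP y : exists x, y = pr x.
Proof.
have [x Dx] := projP (val y).
have Hx : proj x \in cpm_set m s r by rewrite -Dx (valP y).
by exists (exist _ x Hx); apply: val_inj; rewrite Dx.
Qed.

Lemma cpmbar_adj_sym : symmetric (@cpmbar_adj m s n r).
Proof. by move=> x y; exact: orbC. Qed.

Lemma cpm_adj_sym : symmetric (@cpm_adj m s n r).
Proof. by move=> x y; apply: cpmbar_adj_sym. Qed.

Lemma pr_connected x y : exists w, pr (mvs x w) = pr y.
Proof.
have /connectP[p] : connect (@cpmbar_adj m s n r) (proj (val x)) (proj (val y)).
  have := valP x; have := valP y; rewrite !inE => cy cx.
  by apply: connect_trans cy; rewrite (sym_connect_sym cpmbar_adj_sym).
elim: p x => [|z p IHp] x /=; first by exists [::]; apply: val_inj.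
case/andP => /cpmbar_adj_proj[st ->] /(IHp (mvc x st)) H /H [w Hw].
by exists (st :: w).
Qed.

(** * Lifting the generators of the group G to the cover *)

Definition cover_shift (x : cover) : cover :=
  (x.1 + 1, \row_k (val r * x.2 0 (ord_pred k))).
Definition cover_trans (w : 'rV['Z_n]_s) (x : cover) : cover := (x.1, x.2 + w).
Definition cover_flip (l : nat) (x : cover) : cover :=
  (x.1, \row_k if (k : nat) == l then - x.2 0 k else x.2 0 k).
Definition layer (j : int) (st : bool * bool) : int := if st.1 then j else j - 1.
Definition flip_step (l : nat) (j : int) (st : bool * bool) : bool * bool :=
  (st.1, st.2 (+) (cls (layer j st) == l)).

Lemma ord_cls (k : 'I_s) j : (k == cls j :> nat) = (s%:Z %| (k : nat)%:Z - j)%Z.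
Proof. by rewrite -cls_eq {2}/cls modz_nat absz_nat modn_small. Qed.

Lemma ord_pred_int (k : 'I_s) :
  exists q : int, ((ord_pred k : nat)%:Z = (k : nat)%:Z - 1 + q * s%:Z).
Proof.
have := divn_eq ((k + s).-1) s; rewrite -[(_ %% s)%N]/(ord_pred k : nat) => D.
exists (1 - ((k + s).-1 %/ s)%N%:Z); move: D; move: (nat_of_ord (ord_pred k)) => a.
move: (_ %/ s)%N => b; nia.
Qed.

Lemma ord_pred_cls (k : 'I_s) j :
  (ord_pred k == cls j :> nat) = (k == cls (j + 1) :> nat).
Proof.
rewrite !ord_cls; have [q ->] := ord_pred_int k.
have -> : (k : nat)%:Z - 1 + q * s%:Z - j = q * s%:Z + ((k : nat)%:Z - (j + 1)).
  by ring.
by rewrite rpredDl // dvdz_mull.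
Qed.

Lemma cls_nat (l : nat) : (l < s)%N -> cls l = l.
Proof. by move=> lt_ls; rewrite /cls modz_nat absz_nat modn_small. Qed.

Lemma shift_dvec j b :
  \row_k (val r * dvec j b 0 (ord_pred k)) = dvec (j + 1) b.
Proof.
apply/rowP => k; rewrite !mxE mulrA mulrCA exprzDr ?r_unit // expr1z.
by rewrite [val r * val r ^ j]mulrC mulrA ord_pred_cls.
Qed.

Lemma shift_mv x st : cover_shift (mv x st) = mv (cover_shift x) st.
Proof.
case: x st => j v [[] b]; rewrite /mv /cover_shift /=; congr (_, _).
- by apply/rowP => k; rewrite -shift_dvec !mxE mulrDr.
- by ring.
by rewrite (_ : j + 1 - 1 = j - 1 + 1); last ring;
   apply/rowP => k; rewrite -shift_dvec !mxE mulrDr.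
Qed.

Lemma trans_mv w x st : cover_trans w (mv x st) = mv (cover_trans w x) st.
Proof.
by case: x st => j v [[] b]; rewrite /mv /cover_trans /= addrAC.
Qed.

Lemma flip_dvec l j b : \row_k (if (k : nat) == l then - dvec j b 0 k else dvec j b 0 k)
  = dvec j (b (+) (cls j == l)).
Proof.
apply/rowP => k; rewrite !mxE.
have [Dk|neq] := eqVneq (k : nat) (cls j); last by rewrite !mulr0 oppr0 if_same.
by rewrite -Dk; case: eqP => _; rewrite ?addbT ?addbF // signrN !mulNr.
Qed.

Lemma flip_mv l x st : cover_flip l (mv x st) = mv (cover_flip l x) (flip_step l x.1 st).
Proof.
case: x st => j v [[] b]; rewrite /mv /cover_flip /flip_step /layer /=;
  congr (_, _); rewrite -flip_dvec; apply/rowP => k; rewrite !mxE;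
  by case: eqP; rewrite ?opprD.
Qed.

Lemma sigmabar_proj x : sigmabar m s r (proj x) = proj (cover_shift x).
Proof. by rewrite permE /sigmabar_fun /proj /= intrD. Qed.

Lemma trans_inj (w : 'rV['Z_n]_s) :
  injective (fun x : bvertex m s n => (x.1, x.2 + w) : bvertex m s n).
Proof. by move=> [i v] [j u] [-> /addIr ->]. Qed.

Definition transbar w : {perm bvertex m s n} := perm (@trans_inj w).

Lemma flip_inj (l : nat) : injective (fun x : bvertex m s n =>
  (x.1, \row_k if (k : nat) == l then - x.2 0 k else x.2 0 k) : bvertex m s n).
Proof.
move=> [i v] [j w] [-> H]; congr (_, _); apply/rowP => k.
move/rowP/(_ k): H; rewrite !mxE; by case: eqP => // _ /oppr_inj.
Qed.

Definition flipbar l : {perm bvertex m s n} := perm (@flip_inj l).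

Lemma transbar_proj w x : transbar w (proj x) = proj (cover_trans w x).
Proof. by rewrite permE. Qed.

Lemma flipbar_proj l x : flipbar l (proj x) = proj (cover_flip l x).
Proof. by rewrite permE. Qed.

Local Notation Gbar := (cpm_Gbar m s r).

Lemma sigmabar_in : sigmabar m s r \in Gbar.
Proof. by apply: mem_gen; rewrite !inE eqxx. Qed.

Lemma transbarD w w' : transbar (w + w') = (transbar w * transbar w')%g.
Proof. by apply/permP => x; rewrite permM !permE /= addrA. Qed.

Lemma transbarJ w : (transbar w ^ sigmabar m s r)%g =
  transbar (\row_k (val r * w 0 (ord_pred k))).
Proof.
apply/permP => y; have [z ->] : exists z, y = sigmabar m s r z.
  by exists ((sigmabar m s r)^-1%g y); rewrite permKV.
rewrite permJ; have [x ->] := projP z.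
rewrite transbar_proj !sigmabar_proj transbar_proj; congr proj.
by congr (_, _); apply/rowP => k; rewrite !mxE mulrDr.
Qed.

(** Conjugation by [sigmabar] moves coordinate l to l + 1 and multiplies it by r, whence the
    multiplier divided by r in the induction; for l = 0 the translations are powers of [rhobar]. *)
Lemma transbar_stdvec c (l : nat) : (l < s)%N -> transbar (c *: stdvec s n l) \in Gbar.
Proof.
elim: l c => [|l IHl] c lt_ls.
  rewrite -[c]natr_Zp scaler_nat; elim: (nat_of_ord c) => [|k IHk].
    rewrite mulr0n; suff -> : transbar 0 = 1%g by exact: group1.
    by apply/permP => x; rewrite !permE /= addr0 -surjective_pairing.
  rewrite mulrS transbarD groupM //.
  suff -> : transbar (stdvec s n 0) = rhobar m s n.
    by apply: mem_gen; rewrite !inE eqxx orbT.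
  by apply/permP => x; rewrite !permE.
have := groupJ (IHl ((val r)^-1 * c) (ltnW lt_ls)) sigmabar_in.
rewrite transbarJ.
rewrite (_ : \row_k _ = c *: stdvec s n l.+1) //; apply/rowP => k.
rewrite !mxE -mulrA mulVKr ?r_unit //.
have := ord_pred_cls k l; rewrite (cls_nat (ltnW lt_ls)) => ->.
by rewrite -[(l : int) + 1]/((l + 1)%N : int) cls_nat addn1.
Qed.

Lemma transbar_in w : transbar w \in Gbar.
Proof.
rewrite (_ : w = \sum_k w 0 k *: stdvec s n k); last first.
  apply/rowP => k; rewrite summxE (bigD1 k) //= !mxE eqxx mulr1 big1 ?addr0 // => i.
  by rewrite !mxE eq_sym -val_eqE => /negPf /= ->; rewrite mulr0.
apply: (big_ind (fun w => transbar w \in Gbar)).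
- have := transbar_stdvec 0 (ltnW s_ge2).
  by rewrite scale0r.
- by move=> u v uG vG; rewrite transbarD groupM.
by move=> k _; apply: transbar_stdvec.
Qed.

Lemma flipbar_in l : (l < s)%N -> flipbar l \in Gbar.
Proof.
elim: l => [|l IHl] lt_ls.
  have -> : flipbar 0 = taubar m s n by apply/permP => x; rewrite !permE.
  by apply: mem_gen; rewrite !inE eqxx !orbT.
have := groupJ (IHl (ltnW lt_ls)) sigmabar_in.
rewrite (_ : (flipbar l ^ _)%g = flipbar l.+1) //.
apply/permP => y; have [z ->] : exists z, y = sigmabar m s r z.
  by exists ((sigmabar m s r)^-1%g y); rewrite permKV.
rewrite permJ; have [x ->] := projP z.
rewrite flipbar_proj !sigmabar_proj flipbar_proj; congr proj.
congr (_, _); apply/rowP => k; rewrite !mxE.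
have := ord_pred_cls k l; rewrite (cls_nat (ltnW lt_ls)) => ->.
rewrite -[(l : int) + 1]/((l + 1)%N : int) addn1 cls_nat //.
by case: eqP; rewrite ?mulrN.
Qed.

Lemma gen_aut (g : {perm bvertex m s n}) (f : cover -> cover) :
  (forall x, g (proj x) = proj (f x)) ->
  (forall x st, exists st', f (mv x st) = mv (f x) st') ->
  (forall x st', exists st, f (mv x st) = mv (f x) st') ->
  g \in graph_aut (@cpmbar_adj m s n r).
Proof.
move=> gf f1 f2; apply/graph_autP => a b; have [x ->] := projP a.
rewrite gf; apply/cpmbar_adj_proj/cpmbar_adj_proj => -[st].
  by have [st' D] := f2 x st; rewrite -D -gf => /perm_inj ->; exists st'.
by move=> ->; have [st' D] := f1 x st; exists st'; rewrite gf D.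
Qed.

Lemma Gbar_aut : Gbar \subset graph_aut (@cpmbar_adj m s n r).
Proof.
rewrite gen_subG; apply/subsetP => g /setUP[/setUP[]|] /set1P ->.
- by apply: (gen_aut sigmabar_proj) => x st; exists st; apply: shift_mv.
- have H x : rhobar m s n (proj x) = proj (cover_trans (stdvec s n 0) x) by rewrite permE.
  by apply: (gen_aut H) => x st; exists st; apply: trans_mv.
have H x : taubar m s n (proj x) = proj (cover_flip 0 x) by rewrite permE.
apply: (gen_aut H) => x st.
  by exists (flip_step 0 x.1 st); apply: flip_mv.
exists (flip_step 0 x.1 st); rewrite flip_mv; congr mv.
by case: st => a b; rewrite /flip_step /layer /= -addbA addbb addbF.
Qed.

Lemma Gbar_set h x : h \in Gbar -> x \in cpm_set m s r -> h x \in cpm_set m s r ->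
  forall y, y \in cpm_set m s r -> h y \in cpm_set m s r.
Proof.
move=> /(subsetP Gbar_aut) /graph_autP hA Dx hx y Dy.
have /connectP[p] : connect (@cpmbar_adj m s n r) x y.
  move: Dx Dy; rewrite !inE => cx cy; apply: connect_trans cy.
  by rewrite (sym_connect_sym cpmbar_adj_sym).
elim: p x {Dx} hx => [|z p IHp] x hx /=; first by move=> _ ->.
case/andP => xz /IHp H /H -> //; apply: cpm_set_adj hx _.
by rewrite hA.
Qed.

Lemma cpm_G_of h x : h \in Gbar -> h (val (pr x)) \in cpm_set m s r ->
  exists2 g, g \in cpm_G m s r & forall y, val (g y) = h (val y).
Proof.
move=> hG hx; have hset := Gbar_set hG (valP (pr x)) hx.
pose f (y : cpm m s r) : cpm m s r := exist _ (h (val y)) (hset _ (valP y)).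
have f_inj : injective f by move=> y z /(congr1 val) /perm_inj /val_inj.
exists (perm f_inj); last by move=> y; rewrite permE.
rewrite inE; apply/existsP; exists h; apply/andP; split; last first.
  by apply/forallP => y; rewrite permE.
rewrite !inE hG /=; apply/subsetP => y Dy; rewrite inE; exact: (hset y Dy).
Qed.

Lemma cpm_G_aut : cpm_G m s r \subset graph_aut (@cpm_adj m s n r).
Proof.
apply/subsetP => g; rewrite inE => /existsP[h /andP[]].
rewrite inE => /andP[/(subsetP Gbar_aut)/graph_autP hA _] /forallP H.
by apply/graph_autP => x y; rewrite /cpm_adj /= !(eqP (H _)) hA.
Qed.

Lemma cover_shift_mvs (f : cover -> cover) (h : {perm bvertex m s n})
    (g : {perm cpm m s r}) (x y : ccover) :
  (forall z st, f (mv z st) = mv (f z) st) ->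
  (forall z, h (proj z) = proj (f z)) -> (forall z, val (g z) = h (val z)) ->
  f (val x) = val y -> forall w, g (pr (mvs x w)) = pr (mvs y w).
Proof.
move=> fmv hf gh fxy w; apply: val_inj; rewrite gh hf /=; congr proj.
elim: w x y fxy => [|a w IHw] x y fxy //=.
by apply: IHw; rewrite /= fmv fxy.
Qed.

Lemma cpm_G_trans_le (x y : ccover) : (0 <= (val y).1 - (val x).1) ->
  exists2 h, h \in cpm_G m s r & forall w, h (pr (mvs x w)) = pr (mvs y w).
Proof.
move=> le_xy; pose k := absz ((val y).1 - (val x).1).
have lv j z : (iter j cover_shift z).1 = z.1 + j%:Z.
  by elim: j => [|j IHj] /=; rewrite ?addr0 // IHj; lia.
pose u := (val y).2 - (iter k cover_shift (val x)).2.
pose f z := cover_trans u (iter k cover_shift z).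
pose h := (sigmabar m s r ^+ k * transbar u)%g.
have hG : h \in Gbar by rewrite groupM ?groupX ?sigmabar_in ?transbar_in.
have hf z : h (proj z) = proj (f z).
  rewrite permM -transbar_proj; congr (transbar _ _).
  by rewrite permX; elim: (k) => //= j ->; rewrite sigmabar_proj.
have fxy : f (val x) = val y.
  rewrite /f /cover_trans lv /u [RHS]surjective_pairing.
  by congr (_, _); [rewrite /k; lia | rewrite [LHS]addrC subrK].
have hx : h (val (pr x)) \in cpm_set m s r by rewrite hf fxy (valP y).
have [g gG gh] := cpm_G_of hG hx; exists g => //.
apply: (cover_shift_mvs _ hf gh fxy) => z st; rewrite /f -trans_mv.
suff -> : forall j, iter j cover_shift (mv z st) = mv (iter j cover_shift z) st by [].
by elim=> [//|j IHj]; rewrite 2!iterS IHj; exact: shift_mv.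
Qed.

Lemma cpm_G_group_set : group_set (cpm_G m s r).
Proof.
apply/group_setP; split.
  rewrite inE; apply/existsP; exists 1%g; rewrite group1.
  by apply/forallP => x; rewrite !perm1.
move=> g1 g2; rewrite !inE => /existsP[h1 /andP[h1N /forallP H1]].
move=> /existsP[h2 /andP[h2N /forallP H2]]; apply/existsP; exists (h1 * h2)%g.
by rewrite groupM //; apply/forallP => x; rewrite !permM (eqP (H2 _)) (eqP (H1 _)).
Qed.
Canonical cpm_G_group := Group cpm_G_group_set.

(** Lifted powers of [sigmabar] and translations commute with [mv], so a signed word is carried to
    the same word read from another vertex. *)
Lemma cpm_G_trans (x y : ccover) :
  exists2 h, h \in cpm_G m s r & forall w, h (pr (mvs x w)) = pr (mvs y w).
Proof.
have [le_xy|lt_yx] := boolP (0 <= (val y).1 - (val x).1).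
  exact: cpm_G_trans_le.
have [|h hG hw] := @cpm_G_trans_le y x; first by lia.
by exists h^-1%g; rewrite ?groupV // => w; rewrite -hw permK.
Qed.

Fixpoint flip_word (l : nat) (j : int) (w : seq (bool * bool)) :=
  if w is a :: w' then flip_step l j a :: flip_word l (if a.1 then j + 1 else j - 1) w'
  else [::].

(** The reflection of coordinate l is followed by the translation that brings x back. *)
Lemma cpm_G_flip (x : ccover) l : (l < s)%N ->
  exists2 h, h \in cpm_G m s r &
    forall w, h (pr (mvs x w)) = pr (mvs x (flip_word l (val x).1 w)).
Proof.
move=> lt_ls; pose u := (val x).2 - (cover_flip l (val x)).2.
pose f z := cover_trans u (cover_flip l z).
pose h := (flipbar l * transbar u)%g.
have hG : h \in Gbar by rewrite groupM ?flipbar_in ?transbar_in.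
have hf z : h (proj z) = proj (f z) by rewrite permM flipbar_proj transbar_proj.
have fx : f (val x) = val x.
  rewrite /f /cover_trans /u [RHS]surjective_pairing.
  by congr (_, _); rewrite [LHS]addrC subrK.
have hx : h (val (pr x)) \in cpm_set m s r by rewrite hf fx (valP x).
have [g gG gh] := cpm_G_of hG hx; exists g => // w.
apply: val_inj; rewrite gh hf /=; congr proj.
suff H z (y : ccover) : f (val z) = val y -> (val z).1 = (val y).1 ->
    f (val (mvs z w)) = val (mvs y (flip_word l (val y).1 w)) by exact: H.
elim: w z y => [|a w IHw] z y fzy Dz //.
pose a' := flip_step l (val y).1 a.
have -> : flip_word l (val y).1 (a :: w) = a' :: flip_word l (val (mvc y a')).1 w.
  by rewrite mv_level.
apply: (IHw (mvc z a) (mvc y a')).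
  by rewrite /= /f flip_mv trans_mv -/(f _) fzy Dz.
by rewrite [LHS]mv_level [RHS]mv_level Dz.
Qed.

Local Notation e := (@cpm_adj m s n r).
Implicit Types (x y : ccover) (w : seq (bool * bool)).

(** * Closed walks as words *)

Fixpoint vs x w : seq (cpm m s r) :=
  if w is a :: w' then pr (mvc x a) :: vs (mvc x a) w' else [::].

Lemma size_vs x w : size (vs x w) = size w.
Proof. by elim: w x => //= a w IHw x; rewrite IHw. Qed.

Lemma path_vs x w : path e (pr x) (vs x w).
Proof.
elim: w x => //= a w IHw x; rewrite IHw andbT.
by apply/cpm_adj_pr; exists a.
Qed.

Lemma vs_path x p : path e (pr x) p -> exists w, p = vs x w.
Proof.
elim: p x => [|y p IHp] x /=; first by exists [::].
case/andP=> /cpm_adj_pr; case=> a -> /IHp [w ->].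
by exists (a :: w).
Qed.

Lemma last_vs x w : last (pr x) (vs x w) = pr (mvs x w).
Proof. by elim: w x => //= a w IHw x; rewrite IHw. Qed.

Lemma vs_cat x w w' : vs x (w ++ w') = vs x w ++ vs (mvs x w) w'.
Proof. by elim: w x => //= a w IHw x; rewrite IHw. Qed.

Lemma vs_inj x : injective (vs x).
Proof.
move=> w w'; elim: w w' x => [|a w IHw] [|b w'] x //= /eqP.
by rewrite eqseq_cons => /andP[/eqP/pr_mvc_inj -> /eqP/IHw ->].
Qed.

Lemma nonback_vs x w : nonback (pr x :: vs x w) = nonbackw w.
Proof.
elim: w x => [|a w IHw] x //=; move: (IHw (mvc x a)) => /= ->.
congr (_ && _); case: w {IHw} => [|b w] //=.
rewrite -[X in pr X != _](mvcK x a).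
rewrite eq_sym; congr (~~ _); apply/eqP/eqP => [|-> //].
by move=> H; apply: (@pr_mvc_inj (mvc x a)); exact: H.
Qed.

Lemma level_mvs x w : (val (mvs x w)).1 = (val x).1 + net w.
Proof.
elim: w x => [|a w IHw] x /=; rewrite ?addr0 // IHw /= mv_level.
by case: a.1; lia.
Qed.

Lemma pr_eq x y : pr x = pr y ->
  (M%:Z %| (val x).1 - (val y).1)%Z /\ (val x).2 = (val y).2.
Proof.
case=> /eqP H ->; split=> //.
by rewrite -Zp_intr_eq0 ?intrB ?subr_eq0 //; lia.
Qed.

Lemma eq_pr x y : (M%:Z %| (val x).1 - (val y).1)%Z -> (val x).2 = (val y).2 ->
  pr x = pr y.
Proof.
move=> H1 H2; apply: val_inj; rewrite /= /proj H2; congr (_, _).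
by apply/eqP; rewrite -subr_eq0 -intrB Zp_intr_eq0 //; lia.
Qed.

Lemma mv2 z st : (mv z st).2 = z.2 + dvec (layer z.1 st) st.2.
Proof. by case: st => [[] b]. Qed.

(** Equal projections have levels congruent modulo s, so the coordinate that moves still tells up
    from down; only the sign may change. *)
Lemma pr_eq_step x y a : pr x = pr y ->
  exists b, pr (mvc x a) = pr (mvc y (a.1, b)).
Proof.
move=> Exy.
have : cpm_adj (pr y) (pr (mvc x a)).
  by rewrite -Exy; apply/cpm_adj_pr; exists a.
case/cpm_adj_pr => -[a1 b] E; suff D : a1 = a.1 by exists b; rewrite -D.
have [Hl Hv] := pr_eq Exy; have [_] := pr_eq E.
rewrite [LHS]mv2 [RHS]mv2 Hv => /addrI/eqP; apply: contraTeq => neq.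
have sl : (s%:Z %| (val x).1 - (val y).1)%Z.
  by apply: dvdz_trans Hl; rewrite dvdzE /= dvdn_mull.
apply: dvec_cls_neq; rewrite cls_eq /layer; apply/negP => sd.
have : (s%:Z %| 1)%Z; last by rewrite dvdzE /= dvdn1; lia.
have := rpredB sl sd; case: (a.1) (a1) neq => [] [] // _ /=.
  set d := (X in X \in _); have -> : d = -1 by rewrite /d; ring.
  by rewrite rpredN.
by set d := (X in X \in _); have -> : d = 1 by rewrite /d; ring.
Qed.

Lemma closed_words x w q : closed_walk e (pr x) (vs x w ++ q) -> w != [::] ->
  exists2 w', q = vs (mvs x w) w' & wrap_ok (w ++ w') /\ pr (mvs x (w ++ w')) = pr x.
Proof.
case/and3P => px lx nx w0; case/vs_path: (px) => w1 D1.
have sw : (size w <= size w1)%N.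
  by rewrite -(size_vs x w1) -D1 size_cat size_vs leq_addr.
have Dw : w = take (size w) w1.
  apply: (@vs_inj x); rewrite -[LHS](take_size_cat q (size_vs x w)) D1.
  by rewrite -{1}(cat_take_drop (size w) w1) vs_cat take_size_cat // size_vs size_take_min; lia.
pose w' := drop (size w) w1.
have Dw1 : w ++ w' = w1 by rewrite [w in LHS]Dw cat_take_drop.
exists w'.
  by move/eqP: D1; rewrite -Dw1 vs_cat eqseq_cat // eqxx => /eqP.
rewrite Dw1; move: lx; rewrite D1 last_vs => /eqP Dx; split=> //.
case: w1 Dx D1 nx {sw Dw Dw1 w' px} => [|a w1] Dx D1 nx.
  by move: D1; case: (w) w0.
move: nx; rewrite D1 [head _ _]/=.
(* The first step is read again from the end of the walk, where its sign b may be new. For net level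
   0 the end is x itself in the cover, and b is the old sign. *)
have [b Db] := pr_eq_step a (esym Dx).
have -> : rcons (vs x (a :: w1)) (pr (mvc x a)) = vs x (rcons (a :: w1) (a.1, b)).
  by rewrite -[in RHS]cats1 vs_cat cats1 Db.
rewrite nonback_vs => nb; apply/andP; split; first exact: nonbackw_rcons nb.
apply/implyP => /eqP n0; rewrite [head _ _]/=.
have Exx : mvs x (a :: w1) = x.
  apply: ccover_inj; have [_ H2] := pr_eq Dx.
  by rewrite [LHS]surjective_pairing H2 level_mvs n0 addr0 -surjective_pairing.
by move: Db; rewrite Exx => /pr_mvc_inj Db; rewrite -Db in nb.
Qed.

Lemma closed_walk_words x w : wrap_ok w -> pr (mvs x w) = pr x ->
  (net w == 0) || ((head (true, true) w).1 == (last (true, true) w).1) ->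
  closed_walk e (pr x) (vs x w).
Proof.
case: w => [_ _ _|a w]; first by rewrite /closed_walk /= eqxx.
case/andP => nb /implyP nb0 Dx Hw; rewrite /closed_walk path_vs last_vs Dx eqxx.
have [b Db] := pr_eq_step a (esym Dx).
rewrite [head _ _]/=.
have -> : rcons (vs x (a :: w)) (pr (mvc x a)) = vs x (rcons (a :: w) (a.1, b)).
  by rewrite -[in RHS]cats1 vs_cat cats1 Db.
rewrite nonback_vs; have [n0|n0] := eqVneq (net (a :: w)) 0.
  have Exx : mvs x (a :: w) = x.
    apply: ccover_inj; have [_ H2] := pr_eq Dx.
    by rewrite [LHS]surjective_pairing H2 level_mvs n0 addr0 -surjective_pairing.
  move: Db; rewrite Exx => /pr_mvc_inj Db.
  by rewrite -Db; apply: nb0; rewrite n0.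
apply: nonbackw_rcons_dir nb _.
by move: Hw; rewrite (negPf n0) orFb => /eqP Hw; rewrite -[LHS]Hw.
Qed.

(** A layer of class c is c plus a multiple of s, so all contributions to one coordinate share the
    factor r^(c - 8) and leave a polynomial in r^s. *)
Lemma pos_mvs x w (t : nat) : (val x).1 = t%:Z - 8 -> (size w <= t)%N ->
  forall k : 'I_s, (val (mvs x w)).2 0 k = (val x).2 0 k +
    val r ^ (((k + 8) %% s)%N%:Z - 8) * lev (val r ^+ s) (class_coefs s ((k + 8) %% s) t w).
Proof.
elim: w x t => [|a w IHw] x t Dx sw k; first by rewrite /= mulr0 addr0.
pose lay := if a.1 then t else t.-1.
have Dl : (if a.1 then (val x).1 else (val x).1 - 1) = lay%:Z - 8.
  by rewrite /lay; case: a.1; rewrite Dx //; move: sw => /=; lia.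
rewrite [mvs x _]/= (IHw _ (if a.1 then t.+1 else t.-1)); first last.
- by move: sw => /=; case: a.1; lia.
- by rewrite /= mv_level Dx; move: sw => /=; case: a.1; lia.
set c := ((k + 8) %% s)%N.
have -> : (val (mvc x a)).2 0 k = (val x).2 0 k + dvec (lay%:Z - 8) a.2 0 k.
  by rewrite -Dl /= /mv; case: (a.1); rewrite !mxE.
have Ec : (k == cls (lay%:Z - 8) :> nat) = (lay %% s == c)%N.
  rewrite ord_cls (_ : _ - _ = (k + 8)%N%:Z - lay%:Z); last by lia.
  by rewrite -eqz_mod_dvd !modz_nat eqz_nat eq_sym.
rewrite [class_coefs _ _ _ (a :: w)]/= -/lay !mxE Ec -addrA; congr (_ + _).
case: eqP => Dc; last by rewrite mulr0 add0r.
rewrite lev_incr mulrDr addrC mulr1; congr (_ + _).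
have -> : lay%:Z - 8 = (c%:Z - 8) + s%:Z * (lay %/ s)%N%:Z.
  by rewrite {1}(divn_eq lay s) Dc; lia.
rewrite exprzDr ?r_unit // -exprz_exp mulrCA -!exprnP.
by congr (_ * (_ * _)); case: a.2.
Qed.

Lemma class_coefs_ge16 c t w : (16 <= s)%N -> (size w <= t)%N -> (t + size w <= 16)%N ->
  class_coefs s c t w = if (c < 16)%N then class_coefs 16 c t w else [::].
Proof.
move=> s16; elim: w t => [|a w IHw] t /= sw tw; first by case: ifP.
set t' := if a.1 then t.+1 else t.-1; set lay := if a.1 then t else t.-1.
have ltl : (lay < 16)%N by rewrite /lay; case: (a.1); lia.
have [st' tl'] : (size w <= t')%N /\ (t' + size w <= 16)%N.
  by rewrite /t'; case: (a.1); lia.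
rewrite (IHw t') // !modn_small ?divn_small ?(leq_trans ltl s16) //.
by case: (ltnP c 16) => // c16; case: eqP => // Dc; lia.
Qed.

Lemma closed_conds w : (size w <= 8)%N ->
  (pr (mvs base w) == pr base) =
  (M%:Z %| net w)%Z && all (fun l => lev (val r ^+ s) l == 0) (conds s w).
Proof.
move=> sw.
have rs_unit : val r ^+ s \is a GRing.unit by rewrite unitrX ?r_unit.
have pos := @pos_mvs base w 8 (erefl _) sw.
have zero c (k : 'I_s) : c = ((k + 8) %% s)%N ->
  ((val (mvs base w)).2 0 k == 0) = (lev (val r ^+ s) (class_coefs s c 8 w) == 0).
  by move=> ->; rewrite pos mxE add0r mulrI_eq0 //; apply/mulrI/unitrXz/r_unit.
apply/eqP/andP => [/pr_eq[E1 E2]|[Hl Hc]].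
  move: E1; rewrite level_mvs /= add0r subr0 => E1; split=> //.
  apply/allP => _ /mapP[c c_in ->]; move: c_in.
  rewrite mem_iota leq_min => /= /andP[c_lt _].
  rewrite lev_normal //.
  (* This is the coordinate k with k + 8 congruent to c modulo s. *)
  have lt_s : ((c + 8 * (s - 1)) %% s < s)%N by rewrite ltn_mod; lia.
  have E : (c + 8 * (s - 1) + 8 = 8 * s + c)%N.
    by rewrite -addnA addnC; congr (_ + _)%N; rewrite mulnBr muln1 subnK // leq_pmulr // ltnW.
  rewrite -(zero _ (Ordinal lt_s)) ?E2 ?mxE //= modnDml E modnMDl modn_small //.
apply: eq_pr; first by rewrite level_mvs /= add0r subr0.
apply/rowP => k; rewrite [RHS]mxE; apply/eqP; rewrite (zero _ _ (erefl _)).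
set c := ((k + 8) %% s)%N; have c_lt : (c < s)%N by rewrite ltn_mod; lia.
have [c16|c16] := ltnP c 16; last first.
  have s16 : (16 <= s)%N by apply: leq_trans c16 (ltnW c_lt).
  by rewrite (class_coefs_ge16 _ s16) ?(leq_trans sw) // ?(leq_add2l 8 _ 8) // ltnNge c16.
by rewrite -lev_normal //; apply: (allP Hc); apply: map_f; rewrite mem_iota leq_min c_lt.
Qed.

Lemma conds_ge16 w : (16 <= s)%N -> (size w <= 8)%N -> conds s w = conds 16 w.
Proof.
move=> s16 sw; rewrite /conds (minn_idPr s16) minnn; apply/eq_in_map => c.
by rewrite mem_iota => /andP[_ c_lt]; rewrite class_coefs_ge16 ?c_lt ?(leq_add2l 8 _ 8).
Qed.

Let u : 'Z_n := val r ^+ s.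
Let u_unit : u \is a GRing.unit. Proof. by rewrite unitrX ?r_unit. Qed.
Local Notation zero l := (lev u l == 0).
Local Notation hc L w := (has_closed e L (pr base) (vs base w)).

Lemma has_closed_word p q : (size (p ++ q) <= 8)%N -> walk_ok (p ++ q) ->
  (M%:Z %| net (p ++ q))%Z -> all (fun l => zero l) (conds s (p ++ q)) ->
  has_closed e (size (p ++ q)) (pr base) (vs base p).
Proof.
move=> sw /andP[wo hd] Mn cz; exists (vs (mvs base p) q); rewrite -vs_cat ?size_vs //.
apply: closed_walk_words => //; apply/eqP.
have := closed_conds sw; by rewrite Mn cz.
Qed.

Lemma closed_test L p ok q : (size p <= L <= 8)%N -> p != [::] -> walk_test L p ok ->
  size (vs base p ++ q) = L -> closed_walk e (pr base) (vs base p ++ q) ->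
  exists2 w, q = vs (mvs base p) w &
    [/\ size (p ++ w) = L, ok (p ++ w), (M%:Z %| net (p ++ w))%Z &
        all (fun l => zero l) (conds s (p ++ w))].
Proof.
case/andP=> pL L8 p0 /allP test sz /closed_words /(_ p0) [w' Dq [wo /eqP cl]].
move: sz; rewrite Dq -vs_cat size_vs => sz.
exists w' => //; move: cl; rewrite closed_conds ?sz // => /andP[Mn cz]; split=> //.
have /test /implyP -> // : w' \in allw (L - size p).
by rewrite -sz size_cat addKn mem_allw.
Qed.

Lemma conds_min w : (size w <= 8)%N -> conds s w = conds (minn s 16) w.
Proof.
by case: (ltnP s 16) => [//|s16]; apply: conds_ge16.
Qed.

Lemma net_le w : (absz (net w) <= size w)%N.
Proof. by elim: w => [|a w IHw] //=; case: a.1; lia. Qed.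

Lemma net_min w : (size w <= 8)%N -> (M%:Z %| net w)%Z -> ((minn s 16)%:Z %| net w)%Z.
Proof.
move=> sw Mn; have sn : (s%:Z %| net w)%Z.
  by apply: dvdz_trans Mn; rewrite dvdzE /= dvdn_mull.
case: (ltnP s 16) => // s16.
move: sn; rewrite !dvdzE /=; have [-> //|n0] := posnP (absz (net w)).
by move/(dvdn_leq n0); have := net_le w; lia.
Qed.

Lemma hits_zero K k w : hits K k w -> all (fun l => zero l) (conds k w) ->
  exists2 l, l \in K & zero l.
Proof. by case/hasP => l l_in lK /allP /(_ l l_in) lz; exists l. Qed.

Lemma lev1 c : lev u [:: c] = c%:~R. Proof. by rewrite /= mulr0 addr0. Qed.
Lemma lev2 b c : lev u [:: b; c] = b%:~R + c%:~R * u.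
Proof. by rewrite /= mulr0 addr0 mulrC. Qed.

Lemma zero1E c : zero [:: c] = (n%:Z %| c)%Z.
Proof. by rewrite lev1 Zp_intr_eq0. Qed.

Lemma K4_false l : n != 4%N -> l \in K4 -> ~~ zero l.
Proof.
move=> n4; rewrite !inE => /or3P[]/eqP->; rewrite zero1E dvdzE /=; apply/negP.
- by rewrite dvdn1; lia.
- by move/dvdn_leq; lia.
by move/(dvdn_small4 n_ge3); lia.
Qed.

Lemma K2_false l : l \in K2 -> ~~ zero l.
Proof.
rewrite !inE => /orP[]/eqP->; rewrite zero1E dvdzE /=; apply/negP.
  by rewrite dvdn1; lia.
by move/dvdn_leq; lia.
Qed.

Lemma K6_false l : n != 4%N -> n != 3%N -> n != 6%N -> l \in K6 -> ~~ zero l.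
Proof.
move=> n4 n3 n6; rewrite !inE => /orP[|/orP[|/orP[|/orP[]]]] /eqP->; rewrite zero1E dvdzE /=; apply/negP.
- by rewrite dvdn1; lia.
- by move/dvdn_leq; lia.
- by move/(dvdn_small4 n_ge3); lia.
- by move/dvdn_leq; lia.
by move/(dvdn_small6 n_ge3); lia.
Qed.

Lemma min_iota lo : (lo <= s)%N -> (lo <= 16)%N -> minn s 16 \in iota lo (17 - lo).
Proof. by move=> ls l16; rewrite mem_iota leq_min ls l16 /= subnKC ?ltnS ?geq_minr // ltnW. Qed.

Lemma closed_test_s lo L p (ok : nat -> pred (seq (bool * bool))) q :
  (lo <= s)%N -> (lo <= 16)%N -> (size p <= L <= 8)%N -> p != [::] ->
  all (fun s => walk_test L p (fun w => (s%:Z %| net w)%Z ==> ok s w)) (iota lo (17 - lo)) ->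
  (forall w, (size w <= 8)%N -> ok (minn s 16) w -> ok s w) ->
  size (vs base p ++ q) = L -> closed_walk e (pr base) (vs base p ++ q) ->
  exists2 w, q = vs (mvs base p) w &
    [/\ size (p ++ w) = L, ok s (p ++ w), (M%:Z %| net (p ++ w))%Z &
        all (fun l => zero l) (conds s (p ++ w))].
Proof.
move=> ls l16 pL p0 /allP/(_ _ (min_iota ls l16)) test okE sq cq.
have [w Dq [sz okw Mn cz]] := closed_test pL p0 test sq cq; exists w => //; split=> //.
have s8 : (size (p ++ w) <= 8)%N by rewrite sz; case/andP: pL.
by apply: okE => //; apply: (implyP okw); apply: net_min.
Qed.

Lemma hits_min K w : (size w <= 8)%N -> hits K (minn s 16) w -> hits K s w.
Proof. by move=> sw; rewrite /hits -conds_min. Qed.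

Lemma no_UUD4 : ~ hc 4 [:: U; U; D].
Proof.
case=> q sq; case/(closed_test_s (lo := 2) s_ge2 _ _ _ test_UUD4 (@hits_min _) sq) => //.
move=> w _ [_ h _ cz]; by have [l /K2_false/negP] := hits_zero h cz.
Qed.

Lemma zigzag_closed k p q c : (size (p ++ q) <= 8)%N -> walk_ok (p ++ q) ->
  net (p ++ q) = 0 -> size (p ++ q) = k -> (n %| c)%N ->
  all (fun l => l \in [:: [::]; [:: c%:Z]]) (conds (minn s 16) (p ++ q)) -> hc k p.
Proof.
move=> s8 wo n0 <- nc /allP H; apply: has_closed_word => //; first by rewrite n0 dvdz0.
apply/allP => l; rewrite conds_min // => /H; rewrite !inE => /orP[]/eqP-> //.
by rewrite lev1 Zp_intr_eq0.
Qed.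

Lemma UDU4 : n = 4%N -> hc 4 [:: U; D; U].
Proof.
move=> n4; have /and3P[H _ _] := allP test_zigzag _ (min_iota s_ge2 isT).
by apply: (@zigzag_closed 4 [:: U; D; U] [:: D] 4) H; rewrite // n4.
Qed.

Lemma UDU6 : (n %| 6)%N -> hc 6 [:: U; D; U].
Proof.
move=> n6; have /and3P[_ H _] := allP test_zigzag _ (min_iota s_ge2 isT).
exact: (@zigzag_closed 6 [:: U; D; U] [:: D; U; D] 6) H.
Qed.

Lemma UUD8 : hc 8 [:: U; U; D].
Proof.
have H := allP test_generic _ (min_iota s_ge2 isT).
apply: (@zigzag_closed 8 [:: U; U; D] [:: D'; U'; U'; D'; D] 0) => //.
by apply/allP => l /(allP H)/eqP->.
Qed.

(** * The graph is not 3-arc-transitive *)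

Definition three_arc_trans : Prop := forall x w y w',
  size w = 3 -> size w' = 3 -> nonbackw w -> nonbackw w' ->
  exists g, [/\ g \in graph_aut e, g (pr x) = pr y & map g (vs x w) = vs y w'].

Lemma hc_move L w w' : three_arc_trans -> size w = 3 -> size w' = 3 ->
  nonbackw w -> nonbackw w' -> hc L w -> hc L w'.
Proof.
move=> T3 sw sw' nw nw'; have [g [gA gx gw]] := T3 base w base w' sw sw' nw nw'.
by move/(has_closed_map gA); rewrite gx gw.
Qed.

Lemma T3_neq4 : three_arc_trans -> n != 4%N.
Proof.
by move=> T3; apply/eqP => n4; apply: no_UUD4; apply: (hc_move T3 _ _ _ _ (UDU4 n4)).
Qed.

(** Besides relations of [K4], the enumeration leaves the zigzag with 8 = 0 and, for s = 3, the pair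
    1 ± u = 0, 3 ± u = 0, which yields 2 = 0 or 4 = 0. *)
Lemma UDU8_zigzag q : (3 <= s)%N -> n != 4%N ->
  size (vs base [:: U; D; U] ++ q) = 8 -> closed_walk e (pr base) (vs base [:: U; D; U] ++ q) ->
  n = 8%N /\ q = vs (mvs base [:: U; D; U]) [:: D; U; D; U; D].
Proof.
move=> s3 n4 sq.
case/(closed_test_s s3 _ _ _ test_UDU8_ge3 _ sq) => //.
  move=> w sw; case/orP => [/orP[/(hits_min sw) -> //|/andP[-> /(hits_min sw) ->]]|].
    by rewrite orbT.
  case/and3P => /eqP s3'; have Ds : minn s 16 = s by case: (ltnP s 16) s3'; lia.
  move=> /(hits_min sw) h1 /(hits_min sw) h2; apply/orP; right.
  by rewrite h1 h2 -Ds s3'.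
move=> w -> [_ okw _ cz].
case/orP: okw => [/orP[h|/andP[/eqP Dw h]]|/and3P[_ h1 h2]].
- by have [l /(K4_false n4)/negP] := hits_zero h cz.
- have [l] := hits_zero h cz; rewrite inE => /eqP ->.
  rewrite zero1E dvdzE => /(dvdn_small8 n_ge3) n8; split; last by case: Dw => ->.
  by case: n8 => // n8; rewrite n8 in n4.
have [l1 K1 /eqP z1] := hits_zero h1 cz; have [l3 K3 /eqP z3] := hits_zero h2 cz.
have [] : 2%:R = 0 :> 'Z_n \/ 4%:R = 0 :> 'Z_n.
  have E c c' : 1 + c * u = 0 -> 3%:R + c' * u = 0 -> c' = c \/ c' = - c ->
      2%:R = 0 :> 'Z_n \/ 4%:R = 0 :> 'Z_n.
    move=> z1' z3' [E|E]; [left|right]; rewrite {}E in z3'.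
      by rewrite -[RHS](subr0 0) -{1}z3' -z1'; ring.
    by rewrite -[RHS](addr0 0) -{1}z3' -z1'; ring.
  move: K1 K3 z1 z3; rewrite !inE.
  by do 2![case/orP=> /eqP ->]; rewrite !lev2; move/E => H /H; apply;
     rewrite ?opprK; auto.
- by move/eqP; rewrite natr_eq0 => /dvdn_leq; lia.
by move/eqP; rewrite natr_eq0 => /(dvdn_small4 n_ge3) E; rewrite E in n4.
Qed.

Lemma r_nat : exists a : nat, [/\ (a < n)%N, coprime n a & val r = a%:R].
Proof.
exists (val r : nat); split; last by rewrite natr_Zp.
  by have := ltn_ord (val r); rewrite [X in (_ < X)%N -> _]Zp_cast.
by rewrite -unitZpE // natr_Zp r_unit.
Qed.

(** The divisors of 24 are the moduli whose units all square to 1. *)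
Lemma sqr_unit_small : (n %| 24)%N -> val r ^+ 2 = 1.
Proof.
move=> n24; have n_le := dvdn_leq (isT : 0 < 24)%N n24.
have [a [lt_a cop_a ->]] := r_nat.
have a0 : (0 < a)%N by case: (a) cop_a; rewrite // /coprime gcdn0; lia.
apply/eqP; rewrite -natrX -subr_eq0 -[X in _ - X]/(1%N%:R) -natrB ?expn_gt0 ?a0 //.
have test : all (fun k => (k %| 24)%N ==> all (fun a => coprime k a ==> (k %| a ^ 2 - 1)%N)
    (iota 0 k)) (iota 3 22) by vm_compute.
have n_in : n \in iota 3 22 by rewrite mem_iota n_ge3 ltnS.
have /allP/(_ a) H := implyP (allP test n n_in) n24.
by rewrite natr_eq0; apply: implyP cop_a; apply: H; rewrite mem_iota.
Qed.

Lemma all_zero l w : zero l -> all (mem [:: [::]; l]) (conds s w) -> all (fun l => zero l) (conds s w).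
Proof. by move=> lz /allP H; apply/allP => l' /H; rewrite !inE => /orP[]/eqP->. Qed.

(** For s >= 3, [UDU8_zigzag] gives n = 8 and a unique completion of U D U to length 8, so U U U
    must have exactly one too. For s >= 5 it has none. For s = 4, where u = 1, and for s = 3, where
    u = r is odd and thus 2 + 2u or 2 - 2u vanishes, two distinct ones are exhibited. *)
Lemma T3_s2 : three_arc_trans -> s = 2%N.
Proof.
move=> T3; apply/eqP; rewrite eqn_leq s_ge2 andbT leqNgt; apply/negP => s3.
have n4 := T3_neq4 T3.
have [q sq cq] : hc 8 [:: U; D; U] by apply: (hc_move T3 _ _ _ _ UUD8).
have [n8 _] := UDU8_zigzag s3 n4 sq cq.
have r2 : val r ^+ 2 = 1 by apply: sqr_unit_small; rewrite n8.
have uniqU : uniq_closed e 8 (pr base) (vs base [:: U; U; U]).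
  have [g [gA gx gw]] := T3 base [:: U; U; U] base [:: U; D; U] erefl erefl erefl erefl.
  apply: (uniq_closed_aut gA); rewrite gx gw => q1 q2 sq1 sq2.
  by move=> /(UDU8_zigzag s3 n4 sq1)[_ ->] /(UDU8_zigzag s3 n4 sq2)[_ ->].
have two w1 w2 : size w1 = 5%N -> size w2 = 5%N ->
    walk_ok ([:: U; U; U] ++ w1) -> walk_ok ([:: U; U; U] ++ w2) ->
    (M%:Z %| net ([:: U; U; U] ++ w1))%Z -> (M%:Z %| net ([:: U; U; U] ++ w2))%Z ->
    all (fun l => zero l) (conds s ([:: U; U; U] ++ w1)) ->
    all (fun l => zero l) (conds s ([:: U; U; U] ++ w2)) -> w1 = w2.
  move=> s1 s2 /andP[wo1 hd1] /andP[wo2 hd2] M1 M2 c1 c2.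
  have cl w : size w = 5%N -> (M%:Z %| net ([:: U; U; U] ++ w))%Z ->
    all (fun l => zero l) (conds s ([:: U; U; U] ++ w)) ->
    pr (mvs base ([:: U; U; U] ++ w)) = pr base.
    by move=> sw Mw cw; apply/eqP; rewrite closed_conds ?Mw ?cw // size_cat sw.
  apply: (@vs_inj (mvs base [:: U; U; U])); apply: uniqU;
    rewrite -?vs_cat ?size_vs ?size_cat ?s1 ?s2 //.
    exact: closed_walk_words wo1 (cl _ s1 M1 c1) hd1.
  exact: closed_walk_words wo2 (cl _ s2 M2 c2) hd2.
have [q' sq' cq'] : hc 8 [:: U; U; U] by apply: (hc_move T3 _ _ _ _ UUD8).
have [s5|s5] := leqP 5 s.
  have [//|//|//|w _ [_ h _ cz]] := closed_test_s s5 _ _ _ test_UUU8_ge5 (@hits_min _) sq' cq'.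
  by have [l /(K4_false n4)/negP] := hits_zero h cz.
have [s4|s4] := eqVneq s 4%N.
  have u1 : u = 1 by rewrite /u s4 (exprM _ 2 2) r2 expr1n.
  have [//|//|w _ [_ okw Mw cz]] := closed_test _ _ test_UUU8_4 sq' cq'.
  have sM : (s%:Z %| net ([:: U; U; U] ++ w))%Z.
    by apply: dvdz_trans Mw; rewrite dvdzE /= dvdn_mull.
  rewrite s4 in sM; move: okw; rewrite sM => /orP[h|/eqP n8w].
    have {}h : hits K4 s ([:: U; U; U] ++ w) by rewrite s4.
    by have [l /(K4_false n4)/negP] := hits_zero h cz.
  have M8 : (M%:Z %| 8)%Z by move: Mw; rewrite dvdzE n8w => Mw; rewrite dvdzE; exact: Mw.
  suff: [:: U; U'; U'; U'; U'] = [:: U'; U'; U'; U'; U] by [].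
  have z : zero [:: 1; -1] by rewrite lev2 u1 mulr1 subrr.
  have H := two [:: U; U'; U'; U'; U'] [:: U'; U'; U'; U'; U] erefl erefl isT isT M8 M8.
  by apply: H; apply: (all_zero z);
     rewrite s4; vm_compute.
have s3' : s = 3%N by lia.
have u8 : zero [:: 2; 2] \/ zero [:: 2; -2].
  have test : all (fun a => coprime 8 a ==> (8 %| 2 + 2 * a)%N || (8 %| 2 * a - 2)%N)
    (iota 0 8) by [].
  have Du : u = val r by rewrite /u s3' exprS r2 mulr1.
  rewrite !lev2 Du; have [a [lt_a cop_a ->]] := r_nat.
  have a0 : (0 < a)%N by case: (a) cop_a; rewrite // /coprime gcdn0; lia.
  move: lt_a cop_a; rewrite {1 2}n8 => lt_a cop_a.
  have := allP test a; rewrite mem_iota cop_a => /(_ lt_a) /orP[].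
    by rewrite -[8%N in X in X -> _]n8 -natr_eq0 natrD natrM; left.
  rewrite -[8%N in X in X -> _]n8 -natr_eq0 natrB ?natrM => [H|]; last by lia.
  by right; move: H; rewrite -oppr_eq0; apply: etrans; congr (_ == _); ring.
have M0 : (M%:Z %| 0)%Z by rewrite dvdz0.
case: u8 => z.
  have H := two [:: U; D; D'; D'; D] [:: D; D'; D'; D; U] erefl erefl isT isT M0 M0.
  by suff: [:: U; D; D'; D'; D] = [:: D; D'; D'; D; U] by []; apply: H;
     apply: (all_zero z); rewrite s3'; vm_compute.
have H := two [:: U'; D'; D'; D'; D] [:: D; D'; D'; D'; U'] erefl erefl isT isT M0 M0.
by suff: [:: U'; D'; D'; D'; D] = [:: D; D'; D'; D'; U'] by []; apply: H;
   apply: (all_zero z); rewrite s3'; vm_compute.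
Qed.

Lemma closed_test2 L p ok q : s = 2%N -> (size p <= L <= 8)%N -> p != [::] ->
  walk_test L p (fun w => (2%:Z %| net w)%Z ==> ok w) ->
  size (vs base p ++ q) = L -> closed_walk e (pr base) (vs base p ++ q) ->
  exists2 w, q = vs (mvs base p) w &
    [/\ size (p ++ w) = L, ok (p ++ w), (M%:Z %| net (p ++ w))%Z &
        all (fun l => zero l) (conds 2 (p ++ w))].
Proof.
move=> s2 pL p0 test sq cq; have [w Dq [sz okw Mn cz]] := closed_test pL p0 test sq cq.
exists w => //; rewrite s2 in cz; split=> //; apply: (implyP okw).
by apply: dvdz_trans Mn; rewrite s2 dvdzE /= dvdn_mull.
Qed.

Lemma hc2 p q (K : seq (seq int)) : s = 2%N -> (size (p ++ q) <= 8)%N -> walk_ok (p ++ q) ->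
  (M%:Z %| net (p ++ q))%Z -> (forall l, l \in K -> zero l) ->
  all (mem K) (conds 2 (p ++ q)) -> hc (size (p ++ q)) p.
Proof.
move=> s2 sw wo Mn Kz cK; apply: has_closed_word => //; rewrite s2.
by apply/allP => l /(allP cK)/Kz.
Qed.

Lemma no_UDU4 : s = 2%N -> n != 4%N -> ~ hc 4 [:: U; D; U].
Proof.
move=> s2 n4 [q sq].
case/(closed_test2 (ok := hits K4 2) s2 _ _ _ sq); rewrite ?test_UDU4 //.
move=> w _ [_ h _ cz].
by have [l /(K4_false n4)/negP] := hits_zero h cz.
Qed.

(** U U U U closes if 1 + u = 0 and U U U' U' closes if 1 - u = 0, but U D U has no completion of
    length 4. *)
Lemma T3_wind4 l : three_arc_trans -> s = 2%N -> (M%:Z %| 4)%Z -> l \in K11 -> ~~ zero l.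
Proof.
move=> T3 s2 M4 lK; apply/negP => lz; apply: (no_UDU4 s2 (T3_neq4 T3)).
have Kz : forall l', l' \in [:: l] -> zero l' by move=> l'; rewrite inE => /eqP->.
move: lK; rewrite !inE => /orP[] /eqP Dl; rewrite Dl in Kz.
  apply: (hc_move (w := [:: U; U; U]) T3) => //.
  by apply: (@hc2 [:: U; U; U] [:: U]) Kz _.
apply: (hc_move (w := [:: U; U; U']) T3) => //.
by apply: (@hc2 [:: U; U; U'] [:: U']) Kz _.
Qed.

(** Here m = 1, so u = r^(ms) is itself 1 or -1. *)
Lemma T3_wind2 : three_arc_trans -> s = 2%N -> ~~ (M%:Z %| 2)%Z.
Proof.
move=> T3 s2; apply/negP => M2; have M4 : (M%:Z %| 4)%Z by apply: dvdz_trans M2 _.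
have m1 : m = 1%N.
  by move: M2; rewrite s2 dvdzE /= => /dvdn_leq; lia.
have : zero [:: 1; 1] \/ zero [:: 1; -1].
  rewrite !lev2 /u s2; have := r_pow; rewrite m1 s2 => -[]->.
    by right; rewrite mulr1 subrr.
  by left; rewrite mul1r subrr.
by case=> z; [have := T3_wind4 (l := [:: 1; 1]) T3 s2 M4 isT
            | have := T3_wind4 (l := [:: 1; -1]) T3 s2 M4 isT]; rewrite z.
Qed.

Lemma T3_wind24 w : three_arc_trans -> s = 2%N -> (M%:Z %| net w)%Z ->
  all (fun l => zero l) (conds 2 w) -> ~~ wind24 w.
Proof.
move=> T3 s2 Mn cz; apply/negP => /orP[/eqP n2|/andP[/eqP n4 h]].
  by case/negP: (T3_wind2 T3 s2); rewrite dvdzE /= -n2; move: Mn; rewrite dvdzE.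
have M4 : (M%:Z %| 4)%Z by rewrite dvdzE /= -n4; move: Mn; rewrite dvdzE.
by have [l /(T3_wind4 T3 s2 M4)/negP] := hits_zero h cz.
Qed.

Lemma no_UDU6 : three_arc_trans -> s = 2%N -> n != 3%N -> n != 6%N -> ~ hc 6 [:: U; D; U].
Proof.
move=> T3 s2 n3 n6 [q sq].
case/(closed_test2 (ok := fun w => hits K6 2 w || wind24 w) s2 _ _ _ sq); rewrite ?test_UDU6 //.
move=> w _ [_ h Mn cz]; case/orP: h => [h|]; last by apply/negP/T3_wind24.
by have [l /(K6_false (T3_neq4 T3) n3 n6)/negP] := hits_zero h cz.
Qed.

(** The relation would close U U U D D' D or U U U' D' D' D, of length 6. *)
Lemma T3_K22 l : three_arc_trans -> s = 2%N -> n != 3%N -> n != 6%N ->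
  l \in K22 -> ~~ zero l.
Proof.
move=> T3 s2 n3 n6 lK; apply/negP => lz; apply: (no_UDU6 T3 s2 n3 n6).
have Kz : forall l', l' \in [:: l; [::]] -> zero l'.
  by move=> l'; rewrite !inE => /orP[] /eqP->.
have M0 : (M%:Z %| 0)%Z by rewrite dvdz0.
move: lK; rewrite !inE => /orP[] /eqP Dl; rewrite Dl in Kz.
  apply: (hc_move (w := [:: U; U; U]) T3) => //.
  by apply: (@hc2 [:: U; U; U] [:: D; D'; D]) Kz _.
apply: (hc_move (w := [:: U; U; U']) T3) => //.
by apply: (@hc2 [:: U; U; U'] [:: D'; D'; D]) Kz _.
Qed.

Lemma T3_K111 l : three_arc_trans -> s = 2%N -> n != 3%N -> n != 6%N ->
  (M%:Z %| 6)%Z -> l \in K111 -> ~~ zero l.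
Proof.
move=> T3 s2 n3 n6 M6 lK; apply/negP => lz; apply: (no_UDU6 T3 s2 n3 n6).
have Kz : forall l', l' \in [:: l] -> zero l' by move=> l'; rewrite inE => /eqP->.
have W a b : l = [:: 1; (if a then -1 else 1); (if b then -1 else 1)] -> hc 6 [:: U; U; (true, a)].
  move=> Dl; apply: (@hc2 [:: U; U; (true, a)] [:: (true, a); (true, b); (true, b)] [:: l] s2 isT _ M6 Kz).
    by case: (a) (b) => [] [].
  by rewrite Dl; case: (a) (b) => [] [].
move: lK; rewrite !inE => /or4P[] /eqP Dl.
- by apply: hc_move T3 _ _ _ _ (W false false Dl).
- by apply: hc_move T3 _ _ _ _ (W false true Dl).
- by apply: hc_move T3 _ _ _ _ (W true false Dl).
by apply: hc_move T3 _ _ _ _ (W true true Dl).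
Qed.

Lemma lev1_int l : lev (1 : 'Z_n) l = (lev (1 : int) l)%:~R.
Proof. by elim: l => [|a l IHl] //=; rewrite IHl !mul1r intrD intz. Qed.

Lemma u1_small : s = 2%N -> (n %| 24)%N -> u = 1.
Proof. by move=> s2 /sqr_unit_small; rewrite /u s2. Qed.

Lemma zero1_all ls : u = 1 -> all (fun l => zero l) ls = all (zero1 n) ls.
Proof. by move=> u1; apply: eq_all => l; rewrite u1 lev1_int Zp_intr_eq0. Qed.

Lemma T3_n6 : three_arc_trans -> s = 2%N -> n != 6%N.
Proof.
move=> T3 s2; apply/eqP => n6; have u1 : u = 1 by apply: u1_small; rewrite // n6.
have [q sq] : hc 6 [:: U; U; U] by apply: hc_move T3 _ _ _ _ (UDU6 _); rewrite // n6.
case/(closed_test2 (ok := fun w => ~~ all (zero1 6) (conds 2 w) || wind24 w) s2 _ _ _ sq);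
  rewrite ?test_UUU6_n6 //.
move=> w _ [_ h Mn cz]; case/orP: h => [|]; last by apply/negP/T3_wind24.
by rewrite -[6%N]n6 -zero1_all // cz.
Qed.

(** U D U closes in length 6, so U U U does too, which forces ms = 6. Then U U D D has exactly one
    completion to length 8, so some fourth step after U D U should have exactly one; but each has
    two, by [n3_words]. *)
Lemma T3_n3 : three_arc_trans -> s = 2%N -> n != 3%N.
Proof.
move=> T3 s2; apply/eqP => n3; have u1 : u = 1 by apply: u1_small; rewrite // n3.
have M6 : M = 6%N.
  have [q sq] : hc 6 [:: U; U; U] by apply: hc_move T3 _ _ _ _ (UDU6 _); rewrite // n3.
  case/(closed_test2 (ok := fun w => ~~ all (zero1 3) (conds 2 w) || wind24 w
    || (absz (net w) == 6%N)) s2 _ _ _ sq); rewrite ?test_UUU6_n3 //.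
  move=> w _ [_ h Mn cz]; have := T3_wind24 T3 s2 Mn cz; have := T3_wind2 T3 s2.
  move: h Mn; rewrite -[in zero1 3]n3 -zero1_all // cz /= => /orP[->//|/eqP n6].
  rewrite !dvdzE n6 => /= M6 M2 _; have := dvdn_leq (isT : 0 < 6)%N M6.
  move: M6 M2; rewrite s2; case: (m) => [|[|[|[|k]]]] //; lia.
have zeroE w : all (fun l => zero l) (conds 2 w) = all (zero1 3) (conds 2 w).
  by rewrite zero1_all ?n3.
have hc3 p q : size (p ++ q) = 8 -> p ++ q \in n3_word :: n3_words ->
    closed_walk e (pr base) (vs base p ++ vs (mvs base p) q).
  move=> sz pq_in; have /and3P[/andP[wo hd] Mn cz] := allP test_n3_words _ pq_in.
  rewrite -vs_cat; apply: closed_walk_words => //; apply/eqP.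
  by rewrite closed_conds ?sz // -/u M6 Mn s2 zeroE.
have [x4 [hx4 ux4]] : exists x4 : cpm m s r, has_closed e 8 (pr base) (vs base [:: U; D; U] ++ [:: x4])
    /\ uniq_closed e 8 (pr base) (vs base [:: U; D; U] ++ [:: x4]).
  have [g [gA gx gw]] := T3 base [:: U; D; U] base [:: U; U; D] erefl erefl erefl erefl.
  pose y4 := pr (mvs base [:: U; U; D; D]).
  exists ((g^-1)%g y4).
  have E : map g (vs base [:: U; D; U] ++ [:: (g^-1)%g y4]) = vs base [:: U; U; D; D].
    by rewrite map_cat gw /= permKV.
  split; [apply: (has_closed_aut gA) | apply: (uniq_closed_aut gA)]; rewrite gx E.
    exists (vs (mvs base [:: U; U; D; D]) [:: D'; D'; U'; U']).
      by rewrite -vs_cat size_vs.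
    exact: hc3.
  suff H q : size (vs base [:: U; U; D; D] ++ q) = 8 ->
    closed_walk e (pr base) (vs base [:: U; U; D; D] ++ q) ->
    q = vs (mvs base [:: U; U; D; D]) [:: D'; D'; U'; U'].
    by move=> q1 q2 s1 s2' /(H _ s1) -> /(H _ s2') ->.
  move=> sq; case/(closed_test _ _ test_UUDD8_n3 sq) => // w -> [_ ok Mn cz].
  move: ok; rewrite M6 in Mn; rewrite s2 zeroE in cz; rewrite Mn cz /=.
  by move=> /eqP[->].
have [q sq cq] := hx4; move: cq; rewrite -catA => /closed_words[] // w Dq [wo _].
case: w Dq wo => // a w /eqP; rewrite [vs _ (a :: w)]/= eqseq_cons => /andP[/eqP Dx _].
move=> /andP[nb _].
have ax : vs base [:: U; D; U] ++ [:: x4] = vs base [:: U; D; U; a] by rewrite Dx.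
rewrite ax in ux4.
have uw w1 w2 : size w1 = 4 -> size w2 = 4 -> [:: U; D; U; a] ++ w1 \in n3_words ->
    [:: U; D; U; a] ++ w2 \in n3_words -> w1 = w2.
  move=> s1 s2' in1 in2; apply: (@vs_inj (mvs base [:: U; D; U; a])).
  apply: ux4; rewrite ?size_cat ?size_vs ?s1 ?s2' //.
    by apply: hc3; rewrite ?size_cat ?s1 // inE in1 orbT.
  by apply: hc3; rewrite ?size_cat ?s2' // inE in2 orbT.
case: a nb uw {Dx ax ux4} => [[] []] // nb uw.
- by have := uw [:: U; U'; U'; U'] [:: U; D; D; D] erefl erefl isT isT.
- by have := uw [:: U; U; U'; U] [:: U; D; D'; D] erefl erefl isT isT.
by have := uw [:: D; D; U; U'] [:: D'; D; U; U] erefl erefl isT isT.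
Qed.

Lemma lev_mod p l a : (1 < p)%N -> (p %| n)%N -> val r = a%:R -> s = 2%N -> zero l ->
  lev ((a%:R : 'Z_p) ^+ 2) l == 0.
Proof.
move=> p1 pn Da s2.
have levE (k : nat) : lev ((a%:R : 'Z_k) ^+ 2) l = (lev ((a ^ 2)%N%:Z : int) l)%:~R.
  elim: l => [|b l IHl] //=; rewrite IHl intrD intrM intz; congr (_ + _ * _).
  by rewrite -natrX.
rewrite /u s2 Da !levE !Zp_intr_eq0 //; apply: dvdz_trans.
by rewrite dvdzE.
Qed.

Lemma X42E c l : l \in X42 c -> zero l ->
  4%:R + 2%:R * (c%:~R * u) = 0 \/ 2%:R + 4%:R * (c%:~R * u) = 0.
Proof.
rewrite !inE => /orP[] /eqP->; rewrite lev2 intrM => /eqP H; [left|right].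
  by rewrite -[RHS]H; ring.
by rewrite -[RHS]H; ring.
Qed.

(** For n = 4k, multiply the relation by k: the term with coefficient 4 vanishes, and 2k times a
    unit would be 0. *)
Lemma X_not4 c l : c = 1 \/ c = -1 -> l \in X42 c -> zero l -> ~~ (4 %| n)%N.
Proof.
move=> c1 lX lz; apply/negP => /dvdnP[k Dk].
have k2 : (k * 2)%:R != 0 :> 'Z_n.
  by rewrite natr_eq0; apply/negP => /dvdn_leq; move: n_ge3; rewrite Dk; lia.
have n0 : (4%:R * k%:R = 0 :> 'Z_n).
  by apply/eqP; rewrite -natrM natr_eq0 Dk mulnC.
have cu : c%:~R * u \is a GRing.unit.
  by case: c1 => ->; rewrite ?mulN1r ?unitrN ?mul1r u_unit.
set v := c%:~R * u in cu; case/negP: k2; rewrite natrM; have [z|z] := X42E lX lz.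
  rewrite -(mulrI_eq0 _ (mulrI cu)); apply/eqP.
  have -> : v * (k%:R * 2%:R) = k%:R * (4%:R + 2%:R * v) - 4%:R * k%:R by ring.
  by rewrite z n0 mulr0 subrr.
apply/eqP.
have -> : k%:R * 2%:R = k%:R * (2%:R + 4%:R * v) - 4%:R * k%:R * v by ring.
by rewrite z n0 mulr0 mul0r subrr.
Qed.

(** Modulo 5 each relation forces u = 2 or u = 3, the nonsquares, whereas u = r^2. *)
Lemma X_not5 c l : c = 1 \/ c = -1 -> l \in X42 c ++ K31 -> zero l -> s = 2%N -> ~~ (5 %| n)%N.
Proof.
move=> c1 lX lz s2; apply/negP => n5; have [a [_ _ Da]] := r_nat.
have := lev_mod (isT : 1 < 5)%N n5 Da s2 lz; move: (a%:R : 'Z_5) => z.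
have test : all (fun c => all (fun l => all (fun i => lev ((inZp i : 'Z_5) ^+ 2) l != 0)
  (iota 0 5)) (X42 c ++ K31)) [:: 1; -1] by vm_compute.
have c_in : c \in [:: 1; -1] by case: c1 => ->.
have := allP (allP (allP test c c_in) l lX) (z : nat).
by rewrite mem_iota ltn_ord valZpK => /(_ isT)/negPf ->.
Qed.

(** Modulo 17 the first relation makes u one of 2, -2, 1/2, -1/2. Up to a unit the second is then a
    sum ±1 ±2 ±4 ±8, which is odd and at most 15 in absolute value. *)
Lemma X_not17 c l l' : c = 1 \/ c = -1 -> l \in X42 c -> zero l ->
  l' \in K1111 -> zero l' -> s = 2%N -> ~~ (17 %| n)%N.
Proof.
move=> c1 lX lz lK lz' s2; apply/negP => n17; have [a [_ _ Da]] := r_nat.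
have := lev_mod (isT : 1 < 17)%N n17 Da s2 lz'.
have := lev_mod (isT : 1 < 17)%N n17 Da s2 lz; move: (a%:R : 'Z_17) => z.
have test : all (fun c => all (fun l => all (fun l' => all (fun i =>
    (lev ((inZp i : 'Z_17) ^+ 2) l == 0) ==> (lev ((inZp i : 'Z_17) ^+ 2) l' != 0))
  (iota 0 17)) K1111) (X42 c)) [:: 1; -1] by vm_compute.
have c_in : c \in [:: 1; -1] by case: c1 => ->.
have := allP (allP (allP (allP test c c_in) l lX) l' lK) (z : nat).
by rewrite mem_iota ltn_ord valZpK => /(_ isT)/implyP H /H/negPf ->.
Qed.

Lemma u_pow k : s = 2%N -> (M%:Z %| (k * 2)%N%:Z)%Z -> u ^+ k = 1 \/ u ^+ k = -1.
Proof.
move=> s2; rewrite dvdzE /= => /dvdnP[j Dj].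
rewrite /u s2 -exprM mulnC Dj mulnC exprM.
case: r_pow => ->; first by left; rewrite expr1n.
by rewrite -signr_odd; case: odd; [right|left].
Qed.

(** Up to sign the relation says 4 = 2u or 2 = 4u; take k-th powers. *)
Lemma X_dvd c l k : c = 1 \/ c = -1 -> l \in X42 c -> zero l ->
  u ^+ k = 1 \/ u ^+ k = -1 -> ~~ odd k ->
  (n %| 4 ^ k - 2 ^ k)%N \/ (n %| 4 ^ k + 2 ^ k)%N.
Proof.
move=> c1 lX lz uk k_even.
have ck : (c%:~R * u) ^+ k = 1 \/ (c%:~R * u) ^+ k = -1.
  rewrite exprMn; have -> : c%:~R ^+ k = 1 :> 'Z_n; last by rewrite mul1r.
  by case: c1 => ->; [exact: expr1n | rewrite -signr_odd (negPf k_even)].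
have opp2 (a b : 'Z_n) : a + b = 0 -> a ^+ k = b ^+ k.
  by move/eqP; rewrite addr_eq0 => /eqP->; rewrite exprNn -signr_odd (negPf k_even) mul1r.
have le42 : (2 ^ k <= 4 ^ k)%N by case: (k) => [|k'] //; rewrite leq_exp2r.
rewrite -2!natr_eq0 natrB // natrD !natrX.
have [->|->] : 4%:R ^+ k = 2%:R ^+ k :> 'Z_n \/ 4%:R ^+ k = - 2%:R ^+ k :> 'Z_n.
- case: (X42E lX lz) => /opp2; rewrite exprMn; case: ck => ->; rewrite ?mulr1 ?mulrN1 => ->;
  by rewrite ?opprK; auto.
- by left; rewrite subrr.
by right; rewrite addNr.
Qed.

(** By [generic8] also U D U, U U U and U U U' have completions of length 8. Without winding, the
    last two force relations from [X42 1] and [X42 (-1)], which together give 8 = 0, 10 = 0 or 4 =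
    0. In the winding cases ms divides 4 or 8, so u^2 or u^4 is 1 or -1, and a relation from [X42]
    can then survive only at the prime 17. *)
Lemma T3_false : ~ three_arc_trans.
Proof.
move=> T3; have s2 := T3_s2 T3; have n4 := T3_neq4 T3.
have n3 := T3_n3 T3 s2; have n6 := T3_n6 T3 s2.
have H22 l : l \in K22 -> zero l -> False.
  by move=> lK; apply/negP; apply: T3_K22 lK.
have n8 : n != 8%N.
  apply/eqP => n8; have u1 : u = 1 by apply: u1_small; rewrite // n8.
  by apply: (H22 [:: 2; -2]) => //; rewrite lev2 u1 mulr1 subrr.
have n5 c l : c = 1 \/ c = -1 -> l \in X42 c ++ K31 -> zero l -> ~~ (5 %| n)%N.
  by move=> c1 lX lz; apply: X_not5 c1 lX lz s2.
have n_10 : (n %| 10)%N -> (5 %| n)%N by exact: dvdn_small10.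
have n_8 : ~~ (n %| 8)%N by apply/negP => /(dvdn_small8 n_ge3); lia.
have A1 : (exists c l, [/\ c = 1 \/ c = -1, l \in X42 c & zero l]) \/
          (M%:Z %| 4)%Z /\ exists2 l, l \in K31 & zero l.
  have [q sq] : hc 8 [:: U; D; U] by apply: (hc_move T3 _ _ _ _ UUD8).
  case/(closed_test2 (ok := fun w => hits (K4 ++ K22) 2 w || wind246 w
    || (net w == 0) && hits (X42 1 ++ X42 (-1) ++ [:: [:: 8]]) 2 w
    || (absz (net w) == 4%N) && hits K31 2 w) s2 _ _ _ sq); rewrite ?test_UDU8_2 //.
  move=> w _ [_ ok Mn cz]; case/orP: ok => [/orP[/orP[h|]|/andP[_ h]]|/andP[/eqP nw h]].
  - have [l] := hits_zero h cz; rewrite mem_cat => /orP[/(K4_false n4)/negP //|].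
    by move=> /H22 H /H.
  - case/orP => [w24|/andP[/eqP nw h]]; first by case/negP: (T3_wind24 T3 s2 Mn cz).
    have M6 : (M%:Z %| 6)%Z by rewrite dvdzE /= -nw; move: Mn; rewrite dvdzE.
    by have [l /(T3_K111 T3 s2 n3 n6 M6)/negP] := hits_zero h cz.
  - have [l] := hits_zero h cz; rewrite !mem_cat => /or3P[lX lz|lX lz|].
    + by left; exists 1, l; split=> //; left.
    + by left; exists (-1), l; split=> //; right.
    by rewrite inE => /eqP->; rewrite zero1E dvdzE (negPf n_8).
  right; split; first by rewrite dvdzE /= -nw; move: Mn; rewrite dvdzE.
  by have [l lK lz] := hits_zero h cz; exists l.
have A2 (b : bool) : let c : int := if b then -1 else 1 in
    [\/ exists2 l, l \in X42 c & zero l, (M%:Z %| 4)%Z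
      | (M%:Z %| 8)%Z /\ exists2 l, l \in K1111 & zero l].
  have [q sq] : hc 8 [:: U; U; (true, b)].
    by apply: (hc_move T3 _ _ _ _ UUD8) => //; case: (b).
  have := test_UUU8_2 b.
  move=> test /(closed_test2 s2 _ _ test sq)[] // w _ [_ ok Mn cz].
  case/orP: ok => [/orP[/orP[/orP[h|]|/andP[_ h]]|/eqP nw]|/andP[/eqP nw h]].
  - have [l] := hits_zero h cz; rewrite mem_cat => /orP[/(K4_false n4)/negP //|].
    by move=> /H22 H /H.
  - case/orP => [w24|/andP[/eqP nw h]]; first by case/negP: (T3_wind24 T3 s2 Mn cz).
    have M6 : (M%:Z %| 6)%Z by rewrite dvdzE /= -nw; move: Mn; rewrite dvdzE.
    by have [l /(T3_K111 T3 s2 n3 n6 M6)/negP] := hits_zero h cz.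
  - by constructor 1; have [l lK lz] := hits_zero h cz; exists l.
  - by constructor 2; rewrite dvdzE /= -nw; move: Mn; rewrite dvdzE.
  constructor 3; split; first by rewrite dvdzE /= -nw; move: Mn; rewrite dvdzE.
  by have [l lK lz] := hits_zero h cz; exists l.
have finX c l k : c = 1 \/ c = -1 -> l \in X42 c -> zero l -> k = 2%N \/ k = 4%N ->
    u ^+ k = 1 \/ u ^+ k = -1 -> (17 %| n)%N.
  move=> c1 lX lz k24 uk; have k_even : ~~ odd k by case: k24 => ->.
  have no4 := X_not4 c1 lX lz.
  have no5 : ~~ (5 %| n)%N by apply: (n5 c l) => //; rewrite mem_cat lX.
  have [k' nk' k'_in] : exists2 k', (n %| k')%N & (k' \in [:: 12; 20; 240; 272])%N.
    have := X_dvd c1 lX lz uk k_even; case: k24 => -> [] nk.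
    - by exists 12.
    - by exists 20.
    - by exists 240.
    by exists 272.
  case: (dvdn_mod4 no4 nk' n_ge3 k'_in) => // [/eqP|/eqP|n_5].
  - by rewrite (negPf n3).
  - by rewrite (negPf n6).
  by rewrite n_5 in no5.
have u_k k : (M%:Z %| (k * 2)%N%:Z)%Z -> u ^+ k = 1 \/ u ^+ k = -1 by apply: u_pow.
have [M4|M4] := boolP (M%:Z %| 4)%Z.
  have u2 := u_k 2%N M4.
  case: A1 => [[c [l [c1 lX lz]]]|[_ [l lK lz]]].
    have n17 := finX c l 2%N c1 lX lz (or_introl erefl) u2.
    by case: (X_dvd c1 lX lz u2 isT) => /(dvdn_trans n17).
  have no5 : ~~ (5 %| n)%N.
    by apply: (n5 1 l) => //; [left | rewrite mem_cat lK orbT].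
  (* From 3 ± u = 0; as u^2 is 1 or -1, n would divide 8 or 10. *)
  have : 9%:R = u ^+ 2.
    move: lK lz; rewrite !inE => /orP[] /eqP->; rewrite lev2 => /eqP.
      rewrite mul1r => /eqP; rewrite addr_eq0 => /eqP E.
      by rewrite -[u ^+ 2]sqrrN -E -natrX.
    rewrite mulN1r => /eqP; rewrite subr_eq0 => /eqP <-.
    by rewrite -natrX.
  case: u2 => -> /eqP.
    by rewrite -subr_eq0 -[1]/(1%N%:R) -natrB // natr_eq0 (negPf n_8).
  rewrite -subr_eq0 opprK -[X in _ + X]/(1%N%:R) -natrD natr_eq0 => /n_10.
  by rewrite (negPf no5).
case: A1 => [[c [l [c1 lX lz]]]|[]]; last by rewrite (negPf M4).
have W8 : (M%:Z %| 8)%Z -> (exists2 l, l \in K1111 & zero l) -> False.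
  move=> M8 [l' lK lz']; have u4 := u_k 4%N M8.
  have n17 := finX c l 4%N c1 lX lz (or_intror erefl) u4.
  by have := X_not17 c1 lX lz lK lz' s2; rewrite n17.
have [[l1 l1X z1]||[M8 K]] := A2 false; last exact: W8 M8 K.
  have [[l2 l2X z2]||[M8 K]] := A2 true; last exact: W8 M8 K.
    have no5 : ~~ (5 %| n)%N.
      by apply: (n5 1 l1) => //; [left | rewrite mem_cat l1X].
    case: (X42E l1X z1) (X42E l2X z2); rewrite !mulrNz !mul1r !mulN1r => E1 [] E2.
    - have : 8%:R = 0 :> 'Z_n by rewrite -[RHS](addr0 0) -{1}E1 -E2; ring.
      by move/eqP; rewrite natr_eq0 (negPf n_8).
    - have : 10%:R = 0 :> 'Z_n.
        have -> : 10%:R = 2%:R * (4%:R + 2%:R * u) + (2%:R + 4%:R * - u) by ring.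
        by rewrite E1 E2 mulr0 addr0.
      by move/eqP; rewrite natr_eq0 => /n_10; rewrite (negPf no5).
    - have : 10%:R = 0 :> 'Z_n.
        have -> : 10%:R = (2%:R + 4%:R * u) + 2%:R * (4%:R + 2%:R * - u) by ring.
        by rewrite E1 E2 mulr0 addr0.
      by move/eqP; rewrite natr_eq0 => /n_10; rewrite (negPf no5).
    have : 4%:R = 0 :> 'Z_n by rewrite -[RHS](addr0 0) -{1}E1 -E2; ring.
    by move/eqP; rewrite natr_eq0 => /(dvdn_small4 n_ge3) E; rewrite E in n4.
  by rewrite (negPf M4).
by rewrite (negPf M4).
Qed.

Lemma scale_pair (a b c : 'Z_n) (v d1 d2 : 'rV['Z_n]_s) : b = a * c ->
  v + a *: d1 + b *: d2 = v + a *: (d1 + c *: d2).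
Proof. by move=> ->; rewrite scalerDr scalerA addrA. Qed.

(** * Edge labels *)

Section Labels.
Variable b0 : bool.
Local Notation half_sign := (half_sign b0).

(* The four neighbours of a vertex are labelled by pairs (a, b), where a is the
   parity of the layer of the edge and b a sign, so that both ends of an edge
   give it the same label and the zigzag word c, c', c runs straight on; the
   sign (-1) ^ b0 is to be chosen accordingly. *)
Definition lstep (j : int) (c : bool * bool) : bool * bool :=
  (c.1 == oddz j,
   c.2 (+) oddz j (+) half_sign (layer j (c.1 == oddz j, true))).
Definition next_level (j : int) (st : bool * bool) : int :=
  if st.1 then j + 1 else j - 1.
Definition lmv (x : ccover) c : ccover := mvc x (lstep (val x).1 c).
Definition lmvs (x : ccover) (w : seq (bool * bool)) : ccover := foldl lmv x w.

Lemma lmvs_cat x w w' : lmvs x (w ++ w') = lmvs (lmvs x w) w'.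
Proof. exact: foldl_cat. Qed.

Lemma level_lmv x c : (val (lmv x c)).1 = next_level (val x).1 (lstep (val x).1 c).
Proof. exact: mv_level. Qed.

Lemma oddz_next j st : oddz (next_level j st) = ~~ oddz j.
Proof. by rewrite /next_level; case: st.1; rewrite ?oddzD1 ?oddzB1. Qed.

Lemma lstep_back j c : lstep (next_level j (lstep j c)) c = inv_step (lstep j c).
Proof.
rewrite /lstep oddz_next /inv_step /=; congr (_, _).
  by case: (c.1) (oddz j) => [] [].
rewrite /next_level /layer /=; case: (c.1) (oddz j) => [] [] /=;
  rewrite ?addrK ?subrK; move: (half_sign _) => h; by case: (c.2) h => [] [].
Qed.

(** The sign in a label is relative to the parity of the level. Crossing a layer back with the same
    signed vector, as in U D, therefore uses the other label of that coordinate. *)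
Lemma lstep_zigzag j c : lstep (next_level j (lstep j c)) (c.1, ~~ c.2) =
  (~~ (lstep j c).1, (lstep j c).2).
Proof.
rewrite /lstep oddz_next /=; congr (_, _).
  by case: (c.1) (oddz j) => [] [].
rewrite /next_level /layer /=; case: (c.1) (oddz j) => [] [] /=;
  rewrite ?addrK ?subrK; move: (half_sign _) => h; by case: (c.2) h => [] [].
Qed.

(** Labels of different coordinates lead on in one direction, and two layers further [half_sign] has
    changed by [b0]: the sign change that the axial extension of a straight 2-arc requires. *)
Lemma lstep_straight j c c' : c'.1 != c.1 ->
  let st := lstep j c in let j1 := next_level j st in let st' := lstep j1 c' in
  st'.1 = st.1 /\ lstep (next_level j1 st') c = (st.1, st.2 (+) b0).
Proof.
move=> neq; rewrite /= oddz_next.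
have E : (c'.1 == ~~ oddz j) = (c.1 == oddz j).
  by case: (c'.1) (c.1) (oddz j) neq => [] [] [].
split=> //; rewrite /lstep !oddz_next negbK /=; congr (_, _).
rewrite /next_level /layer /= E; case: (c.1 == oddz j).
  by rewrite (_ : j + 1 + 1 = j + 2) ?half_signD2 ?addbA //; ring.
rewrite (_ : half_sign (j - 1) = half_sign (j - 1 - 1 - 1) (+) b0).
  by rewrite -!addbA addbb addbF.
by rewrite -half_signD2; congr half_sign; ring.
Qed.

Lemma lmvK x c : lmv (lmv x c) c = x.
Proof. by rewrite /lmv [val (mvc _ _)]/= mv_level lstep_back mvcK. Qed.

Lemma lstep_inj j : injective (lstep j).
Proof.
move=> [a b] [a' b'] /=; rewrite /lstep /= => -[].
case: (eqVneq a a') => [<- _|neq E]; last by case: (a) (a') (oddz j) neq E => [] [] [].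
by move/addIb/addIb ->.
Qed.

Lemma pr_lmv_inj x c c' : pr (lmv x c) = pr (lmv x c') -> c = c'.
Proof. by move/pr_mvc_inj/lstep_inj. Qed.

Lemma adj_lmvP x (v : cpm m s r) : reflect (exists c, v = pr (lmv x c)) (e (pr x) v).
Proof.
apply: (iffP (cpm_adj_pr x v)) => -[st ->]; last by exists (lstep (val x).1 st).
set j := (val x).1.
pose c := (st.1 == oddz j, st.2 (+) oddz j (+) half_sign (layer j (st.1, true))).
exists c; rewrite /lmv; congr (pr (mvc x _)); rewrite /lstep /c /= -/j.
have -> : ((st.1 == oddz j) == oddz j) = st.1 by case: (st.1) (oddz j) => [] [].
case: st {c} => d b /=; congr (_, _).
by move: (half_sign _) (oddz j) => p q; case: b p q => [] [] [].
Qed.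

Lemma lmvs_connected x y : exists w, pr (lmvs x w) = pr y.
Proof.
have [w <-] := pr_connected x y.
elim/last_ind: w => [|w a [w' IHw]]; first by exists [::].
have /adj_lmvP[c Dc] : e (pr (lmvs x w')) (pr (mvs x (rcons w a))).
  by rewrite IHw mvs_rcons; apply/cpm_adj_pr; exists a.
by exists (rcons w' c); rewrite -cats1 lmvs_cat -Dc.
Qed.

Fixpoint lword (j : int) (w : seq (bool * bool)) : seq (bool * bool) :=
  if w is c :: w' then lstep j c :: lword (next_level j (lstep j c)) w' else [::].

Lemma size_lword j w : size (lword j w) = size w.
Proof. by elim: w j => //= c w IHw j; rewrite IHw. Qed.

Lemma lmvs_mvs x w : lmvs x w = mvs x (lword (val x).1 w).
Proof. by elim: w x => //= c w IHw x; rewrite IHw level_lmv. Qed.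

Definition dv (lay : int) : 'rV['Z_n]_s := dvec lay (half_sign lay).

Lemma lmv_vec x c : (val (lmv x c)).2 = (val x).2 +
  (-1) ^+ (c.2 (+) oddz (val x).1) *: dv (layer (val x).1 (lstep (val x).1 c)).
Proof.
rewrite [LHS]mv2; congr (_ + _); rewrite /dv /dvec scalerA mulrA; congr (_ * _ *: _).
by rewrite -signr_addb.
Qed.

Lemma lmv2_vec x c c' : (c'.1 == c.1) = (c'.2 != c.2) ->
  (val (lmvs x [:: c; c'])).2 = (val x).2 +
    (-1) ^+ (c.2 (+) oddz (val x).1) *:
      (dv (layer (val x).1 (lstep (val x).1 c)) +
       (if c'.1 == c.1 then 1 else -1) *: dv (layer (next_level (val x).1 (lstep (val x).1 c))
          (lstep (next_level (val x).1 (lstep (val x).1 c)) c'))).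
Proof.
move=> cc; rewrite -[lmvs x _]/(lmv (lmv x c) c') lmv_vec level_lmv lmv_vec.
rewrite oddz_next; move: (dv _) (dv _) (val x).2 => d1 d2 v.
apply: (@scale_pair _ _ (if c'.1 == c.1 then 1 else -1)); rewrite cc.
case: (c'.2) (c.2) (oddz _) => [] [] [] /=;
  by rewrite ?expr0 ?expr1 ?mulr1 ?mul1r ?mulrN1 ?opprK.
Qed.

Lemma vec_zigzag01 x : oddz (val x).1 = false ->
  val (lmvs x [:: (false, false); (false, true)]) = ((val x).1, (val x).2 + dv (val x).1 *+ 2).
Proof.
move=> ev; rewrite [LHS]surjective_pairing lmv2_vec // !level_lmv /= ev /=.
rewrite /lstep /next_level /layer /= !ev /= oddzD1 ev /= addrK scale1r.
by rewrite expr0 !scale1r mulr2n.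
Qed.

Lemma vec_zigzag23 x : oddz (val x).1 = false ->
  val (lmvs x [:: (true, false); (true, true)]) =
    ((val x).1, (val x).2 + dv ((val x).1 - 1) *+ 2).
Proof.
move=> ev; rewrite [LHS]surjective_pairing lmv2_vec // !level_lmv /= ev /=.
rewrite /lstep /next_level /layer /= !ev /= oddzB1 ev /= subrK.
by rewrite expr0 !scale1r mulr2n.
Qed.

Lemma vec_straight b x : oddz (val x).1 = false ->
  val (lmvs x [:: (false, b); (true, b)]) =
    ((val x).1 + 2, (val x).2 + (-1) ^+ b *: (dv (val x).1 - dv ((val x).1 + 1))).
Proof.
have cc : ((true, b).1 == (false, b).1) = ((true, b).2 != (false, b).2) by rewrite /= eqxx.
move=> ev; rewrite [LHS]surjective_pairing (lmv2_vec _ cc) !level_lmv /= ev /=.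
rewrite /lstep /next_level /layer /= !ev /= oddzD1 ev /= addbF scaleN1r.
by congr (_, _); ring.
Qed.

End Labels.

(** * Closing of powers of two-label words *)

Section Powers.
Hypothesis s2 : s = 2%N.
Variable b0 : bool.
Local Notation lmvs := (lmvs b0).
Let E0 := stdvec s n 0.
Let E1 := stdvec s n 1.
Let u' : 'Z_n := (-1) ^+ b0 * val r ^+ 2.

Definition pw (c : nat) (w : seq (bool * bool)) := flatten (nseq c w).

Lemma std_eq0 (a b : 'Z_n) : a *: E0 + b *: E1 = 0 -> a = 0 /\ b = 0.
Proof.
move=> /rowP H; have l0 : (0 < s)%N by rewrite s2. have l1 : (1 < s)%N by rewrite s2.
have := H (Ordinal l0); have := H (Ordinal l1).
by rewrite !mxE /= !mulr0 !mulr1 add0r addr0.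
Qed.

Lemma half_sign_pow (a : 'Z_n) (t : nat) lay : (lay %/ 2)%Z = t ->
  (-1) ^+ half_sign b0 lay * a ^+ (2 * t) = ((-1) ^+ b0 * a ^+ 2) ^+ t.
Proof.
move=> Dt; rewrite exprMn (exprM a); congr (_ * _).
rewrite /half_sign Dt /oddz absz_nat.
by case: b0; rewrite ?expr1n //= signr_odd.
Qed.

Lemma dv_even (t : nat) : dv b0 (t%:Z * 2) = u' ^+ t *: E0.
Proof.
rewrite /dv /dvec; have -> : cls (t%:Z * 2) = 0%N.
  by rewrite /cls s2 -PoszM modz_nat absz_nat modnMl.
congr (_ *: _); have Dt : ((t%:Z * 2) %/ 2)%Z = t by lia.
by rewrite -(half_sign_pow _ Dt) mulrC [in RHS]mulrC -PoszM mulnC.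
Qed.

Lemma dv_odd (t : nat) : dv b0 (t%:Z * 2 + 1) = (val r * u' ^+ t) *: E1.
Proof.
rewrite /dv /dvec; have -> : cls (t%:Z * 2 + 1) = 1%N.
  by rewrite /cls s2; lia.
congr (_ *: _); have Dt : ((t%:Z * 2 + 1) %/ 2)%Z = t by lia.
rewrite -(half_sign_pow _ Dt) exprzDr ?r_unit // expr1z [RHS]mulrC -PoszM mulnC.
by rewrite -mulrA.
Qed.

Lemma mulrn_step (v d : 'rV['Z_n]_s) c : v + d *+ 2 + d *+ (2 * c) = v + d *+ (2 * c.+1).
Proof. by rewrite mulnS [d *+ (2 + _)]mulrnDr [RHS]addrA. Qed.

Lemma pwS c w : pw c.+1 w = w ++ pw c w. Proof. by []. Qed.

Lemma vec_pw01 c x : oddz (val x).1 = false ->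
  val (lmvs x (pw c [:: (false, false); (false, true)])) =
    ((val x).1, (val x).2 + dv b0 (val x).1 *+ (2 * c)).
Proof.
elim: c x => [|c IHc] x ev; first by rewrite muln0 mulr0n addr0 -surjective_pairing.
rewrite pwS lmvs_cat IHc (vec_zigzag01 b0 ev) //=.
by rewrite mulrn_step.
Qed.

Lemma vec_pw23 c x : oddz (val x).1 = false ->
  val (lmvs x (pw c [:: (true, false); (true, true)])) =
    ((val x).1, (val x).2 + dv b0 ((val x).1 - 1) *+ (2 * c)).
Proof.
elim: c x => [|c IHc] x ev; first by rewrite muln0 mulr0n addr0 -surjective_pairing.
rewrite pwS lmvs_cat IHc (vec_zigzag23 b0 ev) //=.
by rewrite mulrn_step.
Qed.

Definition geom (v : 'Z_n) (c : nat) : 'Z_n := \sum_(t < c) v ^+ t.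

Lemma straight_step (a p q v g : 'Z_n) (E F : 'rV['Z_n]_s) :
  a *: (p *: E - (q * p) *: F) + (a * (v * p) * g) *: (E - q *: F) =
    (a * p * (1 + v * g)) *: (E - q *: F).
Proof.
have -> : p *: E - (q * p) *: F = p *: (E - q *: F) by rewrite scalerBr scalerA [q * p]mulrC.
by rewrite scalerA -scalerDl; congr (_ *: _); ring.
Qed.

(** Each repetition climbs two levels, so the displacements form a geometric sum with ratio [u']. *)
Lemma vec_pw_straight b c x (t : nat) : (val x).1 = t%:Z * 2 ->
  val (lmvs x (pw c [:: (false, b); (true, b)])) =
    ((t + c)%N%:Z * 2,
     (val x).2 + ((-1) ^+ b * u' ^+ t * geom u' c) *: (E0 - val r *: E1)).
Proof.
elim: c x t => [|c IHc] x t Dt.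
  by rewrite /geom big_ord0 mulr0 scale0r addr0 addn0 -Dt -surjective_pairing.
have ev : oddz (val x).1 = false by rewrite Dt /oddz -PoszM absz_nat oddM andbF.
have V := vec_straight b0 b ev.
rewrite pwS lmvs_cat (IHc _ t.+1); last by rewrite V /= Dt; lia.
rewrite V /= Dt dv_even dv_odd; congr (_, _); first by lia.
rewrite -addrA; congr (_ + _); rewrite /geom big_ord_recl expr0.
have -> : \sum_(i < c) u' ^+ (bump 0 i) = u' * geom u' c.
  by rewrite mulr_sumr; apply: eq_bigr => i _; rewrite exprS.
by rewrite exprS straight_step.
Qed.

Lemma pr_base_eq x : pr x = pr base <-> (M%:Z %| (val x).1)%Z /\ (val x).2 = 0.
Proof.
split=> [/pr_eq /= []|[H1 H2]]; first by rewrite subr0.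
by apply: eq_pr; rewrite ?subr0.
Qed.

Lemma closed_pw01 c : pr (lmvs base (pw c [:: (false, false); (false, true)])) = pr base
  <-> (n %| 2 * c)%N.
Proof.
rewrite pr_base_eq (vec_pw01 c (x := base)) //= (_ : dv b0 0 = E0); last first.
  by have := dv_even 0; rewrite expr0 scale1r.
rewrite add0r -scaler_nat dvdz0; split=> [[_ H]|H]; last split=> //.
  have [/eqP] : (2 * c)%:R = 0 :> 'Z_n /\ 0 = 0 :> 'Z_n.
    by apply: std_eq0; rewrite scale0r addr0.
  by rewrite natr_eq0.
by apply/eqP; move: H; rewrite -natr_eq0 => /eqP ->; rewrite scale0r.
Qed.

Lemma closed_pw0123 c : pr (lmvs base (pw c [:: (false, false); (false, true)] ++
    pw c [:: (true, false); (true, true)])) = pr base <-> (n %| 2 * c)%N.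
Proof.
have ev : oddz (val base).1 = false by [].
have V := vec_pw01 c ev.
have D0 : dv b0 0 = E0 by have := dv_even 0; rewrite expr0 scale1r.
rewrite pr_base_eq lmvs_cat (vec_pw23 c) V //= D0 dvdz0 add0r sub0r.
have [a Da] : exists a, dv b0 (-1) = a *: E1.
  have c1 : cls (-1) = 1%N by rewrite /cls s2.
  by rewrite /dv /dvec c1; eexists.
rewrite Da -!scaler_nat scalerA; split=> [[_ /std_eq0[/eqP]]|H]; first by rewrite natr_eq0.
by split=> //; move: H; rewrite -natr_eq0 => /eqP ->; rewrite mul0r !scale0r addr0.
Qed.

Lemma W_eq0 (a : 'Z_n) : a *: (E0 - val r *: E1) = 0 <-> a = 0.
Proof.
split=> [|->]; last by rewrite scale0r.
by rewrite scalerBr scalerA -scaleNr => /std_eq0[].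
Qed.

Lemma level2_dvd (k : nat) : (M%:Z %| (k%:Z * 2))%Z = (m %| k)%N.
Proof. by rewrite s2 -PoszM dvdzE /= dvdn_pmul2r. Qed.

Lemma closed_pw02 c : pr (lmvs base (pw c [:: (false, false); (true, false)])) = pr base
  <-> (m %| c)%N /\ geom u' c = 0.
Proof.
rewrite pr_base_eq (@vec_pw_straight false c base 0) //= level2_dvd add0n add0r W_eq0.
by rewrite !expr0 !mul1r.
Qed.

(** The second half repeats the climb with opposite signs from level 2c on, whence the factor 1 -
    u'^c. *)
Lemma closed_pw0213 c : pr (lmvs base (pw c [:: (false, false); (true, false)] ++
    pw c [:: (false, true); (true, true)])) = pr base
  <-> (m %| 2 * c)%N /\ (1 - u' ^+ c) * geom u' c = 0.
Proof.
have V := @vec_pw_straight false c base 0 erefl.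
rewrite pr_base_eq lmvs_cat (@vec_pw_straight true c _ c); last by rewrite V add0n.
rewrite V /= addnn -mul2n level2_dvd add0r -scalerDl W_eq0.
rewrite !expr0 expr1; move: (geom u' c) (u' ^+ c) => g v.
by rewrite (_ : 1 * 1 * g + -1 * v * g = (1 - v) * g) //; ring.
Qed.

End Powers.

(** * Axial extensions of 2-arcs *)

Section TwoArcTransitive.
Hypothesis T2 : two_arc_transitive e.
Local Notation A := (graph_aut e).

Lemma adj_mvc x a : e (pr x) (pr (mvc x a)).
Proof. by apply/cpm_adj_pr; exists a. Qed.

Lemma two_arc_word x a b : b != inv_step a ->
  two_arc e (pr x) (pr (mvc x a)) (pr (mvc (mvc x a) b)).
Proof.
move=> nb; rewrite /two_arc !adj_mvc /=; apply: contraNneq nb.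
by rewrite -{1}(mvcK x a) => /pr_mvc_inj <-.
Qed.

Lemma T2_word x a b y a' b' : b != inv_step a -> b' != inv_step a' ->
  exists g, [/\ g \in A, g (pr x) = pr y, g (pr (mvc x a)) = pr (mvc y a') &
                g (pr (mvc (mvc x a) b)) = pr (mvc (mvc y a') b')].
Proof. by move=> nb nb'; apply: T2; apply: two_arc_word. Qed.

(** An equivalence relation whose classes are the orbits of the 2-arc stabilizer on the
    extensions. *)
Definition linked x a b c c' := exists g, [/\ g \in A,
  [/\ g (pr x) = pr x, g (pr (mvc x a)) = pr (mvc x a) &
      g (pr (mvc (mvc x a) b)) = pr (mvc (mvc x a) b)] &
  g (pr (mvs x [:: a; b; c])) = pr (mvs x [:: a; b; c'])].

Lemma linked_refl x a b c : linked x a b c c.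
Proof. by exists 1%g; rewrite group1 !perm1. Qed.

Lemma linked_sym x a b c c' : linked x a b c c' -> linked x a b c' c.
Proof.
case=> g [gA [g1 g2 g3] g4]; exists g^-1%g; split; first by rewrite groupV.
  by split; [rewrite -{1}g1 | rewrite -{1}g2 | rewrite -{1}g3]; rewrite permK.
by rewrite -g4 permK.
Qed.

Lemma linked_trans x a b c c' c'' :
  linked x a b c c' -> linked x a b c' c'' -> linked x a b c c''.
Proof.
case=> g [gA [g1 g2 g3] g4] [h [hA [h1 h2 h3] h4]]; exists (g * h)%g.
by rewrite groupM // !permM g1 g2 g3 g4.
Qed.

Lemma ext_preim x a b y a' b' g c' : g \in A ->
  g (pr (mvc x a)) = pr (mvc y a') ->
  g (pr (mvc (mvc x a) b)) = pr (mvc (mvc y a') b') -> c' != inv_step b' ->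
  exists2 c, c != inv_step b & g (pr (mvs x [:: a; b; c])) = pr (mvs y [:: a'; b'; c']).
Proof.
move=> /graph_autP gE g2 g3 nb.
have : e (pr (mvs x [:: a; b])) ((g^-1)%g (pr (mvs y [:: a'; b'; c']))).
  by rewrite -gE g3 permKV; apply: adj_mvc.
case/cpm_adj_pr => c Dc; exists c; last by rewrite -[RHS](permKV g) Dc.
apply: contraNneq nb => Ec; move: Dc; rewrite Ec [mvc _ _]/= mvcK => /(congr1 g).
rewrite permKV g2 -[pr (mvc y a') in X in X -> _](congr1 pr (mvcK (mvc y a') b')).
by move/pr_mvc_inj ->.
Qed.

(** All 2-arcs being equivalent, it suffices that the stabilizer of one of them permutes its
    extensions transitively. *)
Lemma linked_all x a b : b != inv_step a ->
  (forall c c', c != inv_step b -> c' != inv_step b -> linked x a b c c') ->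
  three_arc_trans.
Proof.
move=> nb L y [|a1 [|b1 [|c1 []]]] // z [|a2 [|b2 [|c2 []]]] // _ _.
case/and4P => nb1 nc1 _ _ /and4P[nb2 nc2 _ _].
have [g1 [g1A g11 g12 g13]] := T2_word x y nb nb1.
have [g2 [g2A g21 g22 g23]] := T2_word x z nb nb2.
have [c nc Dc] := ext_preim g1A g12 g13 nc1.
have [c' nc' Dc'] := ext_preim g2A g22 g23 nc2.
have [h [hA [h1 h2 h3] h4]] := L c c' nc nc'.
exists (g1^-1 * h * g2)%g; rewrite !groupM ?groupV //=.
split=> //; first by rewrite !permM -g11 permK h1.
by rewrite !permM -g12 -g13 -Dc !permK h2 h3 h4 Dc' g22 g23.
Qed.

(** For s >= 3 the reflection h of coordinate 1 fixes [base] and all its neighbours, but exchanges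
    the two upward continuations of U. Conjugating h by an automorphism that takes U U to U D gives
    one that again fixes these neighbours and moves the continuation D, necessarily to an upward
    one. So the stabilizer of a 2-arc through [base] and U is transitive on its three extensions. *)
Lemma T2_s2 : s = 2%N.
Proof.
apply/eqP; rewrite eqn_leq s_ge2 andbT leqNgt; apply/negP => s3.
apply: T3_false; pose x := mvc base D.
have Dx : mvc x U' = base by apply: mvcK.
apply: (@linked_all x U' U) => // c c'.
have [h hG hE] := @cpm_G_flip base 1 s_ge2.
have hA := subsetP cpm_G_aut h hG.
have cls0 : cls 0 = 0%N by rewrite /cls mod0z.
have cls1 : cls 1 = 1%N by rewrite /cls modz_small //; lia.
have clsN1 : cls (-1) != 1%N.
  by rewrite -[1%N]cls1 cls_eq dvdzE /=; apply/negP => /dvdn_leq; lia.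
have h0 : h (pr base) = pr base by have := hE [::].
have h1 a : h (pr (mvc base a)) = pr (mvc base a).
  have := hE [:: a]; rewrite /= => ->; congr (pr (mvc base _)).
  by case: a => [[] b]; rewrite /flip_step /layer /= ?cls0 ?(negPf clsN1) addbF.
have hUU b : h (pr (mvs base [:: U; (true, b)])) = pr (mvs base [:: U; (true, ~~ b)]).
  by rewrite hE /= /flip_step /layer /= cls0 add0r cls1 addbT.
have [g [gA g1 g2 g3]] := T2_word base base (isT : U != inv_step U) (isT : D != inv_step U).
pose fix_nbr k := [/\ k \in A, k (pr base) = pr base & forall a, k (pr (mvc base a)) = pr (mvc base a)].
have lk k c1 c2 : fix_nbr k -> k (pr (mvs base [:: U; c1])) = pr (mvs base [:: U; c2]) ->
    linked x U' U c1 c2.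
  have E c0 : mvs x [:: U'; U; c0] = mvs base [:: U; c0].
    by rewrite -[LHS]/(mvc (mvc (mvc x U') U) c0) Dx.
  by case=> kA k0 k1 k2; exists k; rewrite !E Dx; split=> //; split=> //; apply: k1.
have kh : fix_nbr h by split.
have khg : fix_nbr (h ^ g)%g.
  split; first by rewrite groupJ.
    by rewrite -{1}g1 permJ h0 g1.
  move=> a; have : e (pr base) ((g^-1)%g (pr (mvc base a))).
    by move/graph_autP: gA => <-; rewrite permKV g1; apply: adj_mvc.
  case/cpm_adj_pr => b Db; have -> : pr (mvc base a) = g (pr (mvc base b)).
    by rewrite -Db permKV.
  by rewrite permJ h1.
have lUU b : linked x U' U (true, b) (true, ~~ b) by apply: lk kh (hUU b).
have [b lD] : exists b, linked x U' U D (true, b).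
  have : e (pr (mvc base U)) (g (pr (mvs base [:: U; U']))).
    by rewrite -g2; move/graph_autP: gA => ->; apply: adj_mvc.
  case/cpm_adj_pr => c1 Dc1.
  have gD : (h ^ g)%g (pr (mvs base [:: U; D])) = pr (mvs base [:: U; c1]).
    by rewrite -[pr (mvs base [:: U; D])]/(pr (mvc (mvc base U) D)) -g3 permJ (hUU false) Dc1.
  have := lk _ _ _ khg gD; case: c1 Dc1 {gD} => [[] b1] Dc1; first by exists b1.
  case: b1 Dc1 => Dc1 _.
    have back : mvc (mvc base U) D' = base by apply: mvcK.
    have /perm_inj : g (pr (mvs base [:: U; U'])) = g (pr base) by rewrite Dc1 back g1.
    by rewrite -{2}back; move/pr_mvc_inj.
  have /perm_inj : g (pr (mvs base [:: U; U'])) = g (pr (mvs base [:: U; U])).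
    by rewrite Dc1 -g3.
  by move/pr_mvc_inj.
have lD' b1 : linked x U' U D (true, b1).
  case: (eqVneq b b1) => [<- //|neq]; apply: linked_trans lD _.
  by have := lUU b; congr (linked _ _ _ _ (true, _)); case: (b) (b1) neq => [] [].
have lDc c1 : c1 != inv_step U -> linked x U' U D c1.
  by case: c1 => [[] []] // _; apply: linked_refl.
by move=> nc nc'; apply: linked_trans (linked_sym (lDc _ nc)) (lDc _ nc').
Qed.

Let r2_pow : M = (m * 2)%N. Proof. by rewrite T2_s2. Qed.

Lemma cls_odd j k : (cls j == cls k) = (2 %| j - k)%Z.
Proof. by rewrite cls_eq T2_s2. Qed.

Definition axial (v0 v1 v2 v3 : cpm m s r) := [/\ two_arc e v0 v1 v2, e v2 v3, v1 != v3 &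
  forall g, g \in A -> g v0 = v0 -> g v1 = v1 -> g v2 = v2 -> g v3 = v3].

Lemma axial_aut g v0 v1 v2 v3 : g \in A -> axial v0 v1 v2 v3 ->
  axial (g v0) (g v1) (g v2) (g v3).
Proof.
move=> gA [a e23 v13 fixE]; have /graph_autP gE := gA.
split; rewrite ?gE ?(inj_eq perm_inj) //.
  by rewrite /two_arc !gE (inj_eq perm_inj).
move=> h hA h0 h1 h2; apply: (@perm_inj _ g^-1%g); rewrite permK -!permM.
apply: fixE; rewrite ?groupM ?groupV //.
- by rewrite !permM h0 permK.
- by rewrite !permM h1 permK.
by rewrite !permM h2 permK.
Qed.

(** The reflection centred at y in the coordinate crossed by [a'] there fixes the 2-arc and the
    extension a, and exchanges the other two extensions. If some element of the stabilizer moved a,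
    all three would be linked, contradicting [T3_false]. *)
Lemma axial_zigzag x a :
  axial (pr x) (pr (mvc x a)) (pr (mvs x [:: a; (~~ a.1, a.2)])) (pr (mvs x [:: a; (~~ a.1, a.2); a]))
  /\ forall c, axial (pr x) (pr (mvc x a)) (pr (mvs x [:: a; (~~ a.1, a.2)]))
       (pr (mvs x [:: a; (~~ a.1, a.2); c])) -> c = a.
Proof.
set a' := (~~ a.1, a.2); pose y := mvs x [:: a; a'].
have nb : a' != inv_step a by rewrite /a' /inv_step; case: (a) => [[] []].
have invy : mvs y [:: inv_step a'] = mvc x a by rewrite /= mvcK.
have invyy : mvs y [:: inv_step a'; inv_step a] = x by rewrite /= !mvcK.
have invy1 : mvc y (inv_step a') = mvc x a := invy.
pose j := (val y).1.
have Dj : j = (val x).1.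
  by rewrite /j /= !mv_level /a' /=; case: (a.1) => /=; ring.
have lj : layer j a = layer (val x).1 a by rewrite Dj.
pose l := cls (layer j a').
have [h hG hE] := cpm_G_flip y (cls_lt (layer j a')).
have hA := subsetP cpm_G_aut h hG.
have neq : (cls (layer j a) == l) = false.
  rewrite /l cls_odd /layer /a' /=; case: (a.1) => /=.
    by rewrite (_ : j - (j - 1) = 1) //; ring.
  by rewrite (_ : j - 1 - j = -1) //; ring.
have hy : h (pr y) = pr y by have := hE [::].
have ha : h (pr (mvc y a)) = pr (mvc y a).
  have := hE [:: a]; rewrite /= /flip_step -/j neq addbF => ->.
  by congr (pr (mvc _ _)); case: (a).
have ha' b : h (pr (mvc y (~~ a.1, b))) = pr (mvc y (~~ a.1, ~~ b)).
  have := hE [:: (~~ a.1, b)]; rewrite /= => ->; congr (pr (mvc _ (_, _))).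
  by rewrite /= (_ : layer _ _ = layer j a') // eqxx addbT.
have fw1 : flip_step l j (inv_step a') = inv_step a'.
  rewrite /flip_step (_ : layer j (inv_step a') = layer j a) ?neq ?addbF //.
  by rewrite /layer /inv_step /a' /= negbK.
have fw2 : flip_step l (if (inv_step a').1 then j + 1 else j - 1) (inv_step a) = inv_step a.
  rewrite /flip_step (_ : layer _ (inv_step a) = layer j a) ?neq ?addbF //.
  by rewrite /layer /inv_step /a' /= negbK; case: (a.1); rewrite ?addrK ?subrK.
have hxa : h (pr (mvc x a)) = pr (mvc x a).
  by rewrite -invy hE -/j -/l [flip_word _ _ _]/= fw1.
have hx : h (pr x) = pr x.
  by rewrite -invyy hE -/j -/l [flip_word _ _ _]/= fw1 fw2.
have adm c : c != inv_step a' -> c = a \/ exists b, c = (~~ a.1, b).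
  rewrite /a' /inv_step /=; case: (a) (c) => [a1 a2] [c1 c2] /=; case: (eqVneq c1 a1) => [->|].
    by move=> neq'; left; congr (_, _); move: neq'; rewrite negbK; case: (a2) (c2) => [] [] //; rewrite eqxx.
  by move=> neq' _; right; exists c2; congr (_, _); case: (c1) (a1) neq' => [] [].
split=> [|c [_ _ nc fixE]].
  split=> //.
  - exact: two_arc_word.
  - exact: adj_mvc.
  - rewrite -{1}(mvcK (mvc x a) a') /=; apply/eqP => /pr_mvc_inj.
    by rewrite /inv_step /a'; case: (a) => [[] []].
  move=> g gA g0 g1 g2; apply/eqP; rewrite -[_ == _]negbK; apply/negP => ng; apply: T3_false.
  have [c Dc] : exists c, g (pr (mvc y a)) = pr (mvc y c).
    apply/cpm_adj_pr; rewrite -g2; move/graph_autP: gA => ->; exact: adj_mvc.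
  have lk c1 c2 k : k \in A -> k (pr x) = pr x -> k (pr (mvc x a)) = pr (mvc x a) ->
     k (pr y) = pr y -> k (pr (mvc y c1)) = pr (mvc y c2) -> linked x a a' c1 c2.
    by move=> kA k0 k1 k2 k3; exists k; split=> //; split.
  have lh b : linked x a a' (~~ a.1, b) (~~ a.1, ~~ b) by apply: lk (ha' b).
  have lg : linked x a a' a c by apply: lk Dc.
  have nca : c != a.
    apply: contraNneq ng => Ec; rewrite -[X in g (pr X) == _]/(mvc y a).
    by rewrite -[X in _ == pr X]/(mvc y a) Dc Ec.
  have ncv : c != inv_step a'.
    apply/eqP => Ec; move: Dc; rewrite Ec invy1 -[in RHS]g1 => /perm_inj.
    rewrite -invy1 => /pr_mvc_inj; rewrite /inv_step /a' /=.
    by case: (a) => [[] []].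
  have [b Eb] : exists b, c = (~~ a.1, b).
    by case: (adm c ncv) => // Ec; rewrite Ec eqxx in nca.
  rewrite {}Eb in lg; have lab b1 : linked x a a' a (~~ a.1, b1).
    case: (eqVneq b b1) => [<- //|neq']; apply: linked_trans lg _.
    by have := lh b; congr (linked _ _ _ _ (_, _)); case: (b) (b1) neq' => [] [].
  have la c1 : c1 != inv_step a' -> linked x a a' a c1.
    by case/adm => [->|[b1 ->]]; [apply: linked_refl | apply: lab].
  apply: (linked_all nb) => c1 c2 n1 n2.
  exact: linked_trans (linked_sym (la _ n1)) (la _ n2).
have ncv : c != inv_step a'.
  by apply: contraNneq nc => ->; rewrite -{1}invy.
case: (adm c ncv) => // -[b Eb]; have := fixE h hA hx hxa hy.
by rewrite Eb -[mvs x _]/(mvc y _) ha' => /pr_mvc_inj [] /eqP; case: (b).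
Qed.

Lemma axial_uniq v0 v1 v2 v3 v3' : axial v0 v1 v2 v3 -> axial v0 v1 v2 v3' -> v3 = v3'.
Proof.
move=> B B'; pose a : bool * bool := U.
have [Bz uz] := axial_zigzag base a.
have [g [gA g0 g1 g2]] : exists g, [/\ g \in A, g v0 = pr base, g v1 = pr (mvc base a) &
    g v2 = pr (mvs base [:: a; (~~ a.1, a.2)])].
  by apply: T2; [case: B | case: Bz].
have H v : axial v0 v1 v2 v -> g v = pr (mvs base [:: a; (~~ a.1, a.2); a]).
  move/(axial_aut gA); rewrite g0 g1 g2 => Bw.
  have [c Dc] : exists c, g v = pr (mvs base [:: a; (~~ a.1, a.2); c]).
    by apply/cpm_adj_pr; case: Bw.
  by rewrite Dc in Bw *; rewrite (uz c Bw).
by apply: (@perm_inj _ g); rewrite (H _ B) (H _ B').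
Qed.

Lemma axial_ex v0 v1 v2 : two_arc e v0 v1 v2 -> exists v3, axial v0 v1 v2 v3.
Proof.
move=> a012; have [Bz _] := axial_zigzag base U.
have [g [gA g0 g1 g2]] : exists g, [/\ g \in A, g (pr base) = v0, g (pr (mvc base U)) = v1 &
    g (pr (mvs base [:: U; (~~ U.1, U.2)])) = v2].
  by apply: T2; first by case: Bz.
by have := axial_aut gA Bz; rewrite g0 g1 g2; eexists; eassumption.
Qed.

(* The stabilizers of the two 2-arcs are conjugate, and one contains the other. *)
Lemma axial_rev v0 v1 v2 v3 : axial v0 v1 v2 v3 -> axial v3 v2 v1 v0.
Proof.
case=> a012 e23 v13 fixE; have a321 : two_arc e v3 v2 v1.
  case/and3P: (a012) => _ e12 _.
  by rewrite /two_arc cpm_adj_sym e23 cpm_adj_sym e12 eq_sym.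
have [g [gA g0 g1 g2]] := T2 a012 a321.
pose S (a b c : cpm m s r) := [set h in A | [&& h a == a, h b == b & h c == c]].
have SJ : S v3 v2 v1 = (S v0 v1 v2) :^ g.
  apply/setP => h; have Hc v : ((h ^ g^-1)%g v == v) = (h (g v) == g v).
    by rewrite -{1}(permK g v) permJ -(inj_eq (@perm_inj _ g)) permKV.
  have HA : ((h ^ g^-1)%g \in A) = (h \in A) by apply: groupJr; rewrite groupV.
  rewrite mem_conjg; apply/setIdP/setIdP; rewrite HA !Hc g0 g1 g2; exact: id.
have sub : S v0 v1 v2 \subset S v3 v2 v1.
  apply/subsetP => h /setIdP[hA /and3P[/eqP h0 /eqP h1 /eqP h2]].
  apply/setIdP; split=> //; apply/and3P; split; apply/eqP => //; exact: fixE.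
have ES : S v0 v1 v2 = S v3 v2 v1.
  by apply/eqP; rewrite eqEcard sub SJ cardJg leqnn.
split.
- exact: a321.
- by rewrite cpm_adj_sym; case/and3P: a012.
- by rewrite eq_sym; case/and3P: a012.
move=> h hA h3 h2 h1; have : h \in S v3 v2 v1.
  by apply/setIdP; split; [exact: hA | rewrite h3 h2 h1 !eqxx].
by rewrite -ES => /setIdP[_ /and3P[/eqP]].
Qed.

(** The axial extension of U U cannot turn down: reversed, it would extend the zigzag U' D' by D',
    against the uniqueness in [axial_zigzag]. Its sign defines [b0]; elements of G carry this choice
    to all vertices and signs. *)
Lemma axial_straight_up : exists b0 : bool, forall x a b,
  axial (pr x) (pr (mvc x (true, a))) (pr (mvs x [:: (true, a); (true, b)]))
        (pr (mvs x [:: (true, a); (true, b); (true, a (+) b0)])).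
Proof.
have [v3 B] := axial_ex (two_arc_word base (isT : U != inv_step U)).
have [c Dc] : exists c, v3 = pr (mvs base [:: U; U; c]).
  by apply/cpm_adj_pr; case: B.
rewrite {}Dc in B; case: c B => [[] b0] B; last first.
  have b0F : b0 = false.
    case: b0 B => // -[_ _ nb _]; case/eqP: nb.
    by rewrite -[X in _ = pr X]/(mvc (mvc (mvc base U) U) (inv_step U)) mvcK.
  rewrite {}b0F in B; have := axial_rev B; pose y := mvs base [:: U; U; D].
  have [_ uz] := axial_zigzag y U'; move/(_ D'): uz.
  have E1 : mvc y U' = mvs base [:: U; U] by apply: mvcK.
  have E2 : mvs y [:: U'; D'] = mvc base U.
    by rewrite -[LHS]/(mvc (mvc y U') D') E1; apply: mvcK.
  have E3 : mvs y [:: U'; D'; D'] = base.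
    by rewrite -[LHS]/(mvc (mvs y [:: U'; D']) D') E2; apply: mvcK.
  by rewrite [(~~ U'.1, U'.2)]/= E1 E2 E3 => uz /uz.
exists b0 => x; pose P a b := axial (pr x) (pr (mvc x (true, a)))
  (pr (mvs x [:: (true, a); (true, b)])) (pr (mvs x [:: (true, a); (true, b); (true, a (+) b0)])).
have PUU : P false false.
  have [h hG hE] := cpm_G_trans base x; have hA := subsetP cpm_G_aut h hG.
  have := axial_aut hA B; rewrite -[pr base]/(pr (mvs base [::])).
  by rewrite -[mvc base U]/(mvs base [:: U]) -[mvc (mvs _ _) U]/(mvs base [:: U; U]) !hE.
pose j := (val x).1.
have P1 a b : P a b -> P (~~ a) b.
  have [h hG hE] := cpm_G_flip x (cls_lt j); have hA := subsetP cpm_G_aut h hG.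
  move/(axial_aut hA); rewrite /P -[pr x]/(pr (mvs x [::])).
  rewrite -[mvc x _]/(mvs x [:: (true, a)]) !hE /= /flip_step /layer /= -/j eqxx.
  have -> : (cls (j + 1) == cls j) = false.
    by rewrite cls_odd (_ : _ - _ = 1) //; ring.
  have -> : (cls (j + 1 + 1) == cls j) = true.
    by rewrite cls_odd (_ : _ - _ = 2) //; ring.
  by rewrite !addbT addbF -addNb.
have P2 a b : P a b -> P a (~~ b).
  have [h hG hE] := cpm_G_flip x (cls_lt (j + 1)); have hA := subsetP cpm_G_aut h hG.
  move/(axial_aut hA); rewrite /P -[pr x]/(pr (mvs x [::])).
  rewrite -[mvc x _]/(mvs x [:: (true, a)]) !hE /= /flip_step /layer /= -/j eqxx.
  have -> : (cls j == cls (j + 1)) = false.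
    by rewrite cls_odd (_ : _ - _ = -1) //; ring.
  have -> : (cls (j + 1 + 1) == cls (j + 1)) = false.
    by rewrite cls_odd (_ : _ - _ = 1) //; ring.
  by rewrite !addbF addbT.
change (forall a b, P a b) => -[] [].
- exact: (P2 true false (P1 false false PUU)).
- exact: (P1 false false PUU).
- exact: (P2 false false PUU).
exact: PUU.
Qed.

Lemma axial_straight : exists b0 : bool, forall x d a b,
  axial (pr x) (pr (mvc x (d, a))) (pr (mvs x [:: (d, a); (d, b)]))
        (pr (mvs x [:: (d, a); (d, b); (d, a (+) b0)])).
Proof.
have [b0 H] := axial_straight_up; exists b0 => x [] // a b.
pose z := mvs x [:: (false, a); (false, b); (false, a (+) b0)].
have E1 : mvc z (true, ~~ (a (+) b0)) = mvs x [:: (false, a); (false, b)] by apply: mvcK.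
have E2 : mvs z [:: (true, ~~ (a (+) b0)); (true, ~~ b)] = mvc x (false, a).
  by rewrite -[LHS]/(mvc (mvc z _) (true, ~~ b)) E1; apply: mvcK.
have E3 : mvs z [:: (true, ~~ (a (+) b0)); (true, ~~ b); (true, ~~ (a (+) b0) (+) b0)] = x.
  rewrite -[LHS]/(mvc (mvs z [:: (true, ~~ (a (+) b0)); (true, ~~ b)]) _) E2.
  by rewrite -addNb -addbA addbb addbF; apply: mvcK.
by have := axial_rev (H z (~~ (a (+) b0)) (~~ b)); rewrite E1 E2 E3.
Qed.

Section WithSign.
Variable b0 : bool.
Hypothesis axial_b0 : forall x d a b,
  axial (pr x) (pr (mvc x (d, a))) (pr (mvs x [:: (d, a); (d, b)]))
        (pr (mvs x [:: (d, a); (d, b); (d, a (+) b0)])).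

Lemma axial_label z c c' : c != c' ->
  axial (pr z) (pr (lmv b0 z c)) (pr (lmvs b0 z [:: c; c'])) (pr (lmvs b0 z [:: c; c'; c])).
Proof.
move=> neq; set j := (val z).1; pose st := lstep b0 j c.
have E1 : lmv b0 z c = mvc z st by [].
have L1 : (val (mvc z st)).1 = next_level j st by apply: mv_level.
have [E|E] := eqVneq c'.1 c.1.
  have -> : c' = (c.1, ~~ c.2).
    by case: (c) (c') neq E => [a b] [a' b'] /= neq E; rewrite E in neq *; case: (b) (b') neq => [] []; rewrite ?eqxx.
  have E2 : lmvs b0 z [:: c; (c.1, ~~ c.2)] = mvs z [:: st; (~~ st.1, st.2)].
    by rewrite /= E1 /lmv L1 lstep_zigzag.
  have L2 : (val (mvs z [:: st; (~~ st.1, st.2)])).1 = j.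
    by rewrite level_mvs -/j /=; case: (c.1 == oddz j) => /=; ring.
  have E3 : lmvs b0 z [:: c; (c.1, ~~ c.2); c] = mvs z [:: st; (~~ st.1, st.2); st].
    by rewrite -[LHS]/(lmv b0 (lmvs b0 z [:: c; (c.1, ~~ c.2)]) c) E2 /lmv L2.
  by rewrite E2 E3; case: (axial_zigzag z st).
have [F1 F2] := lstep_straight b0 j E; set st' := lstep _ _ c' in F1 F2.
have E2 : lmvs b0 z [:: c; c'] = mvs z [:: st; (st.1, st'.2)].
  have Est : st' = (st.1, st'.2) by rewrite [LHS]surjective_pairing F1.
  by rewrite -[LHS]/(lmv b0 (lmv b0 z c) c') E1 /lmv L1 -[lstep _ _ c']/st' {1}Est.
have L2 : (val (mvs z [:: st; (st.1, st'.2)])).1 = next_level (next_level j st) st'.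
  by rewrite level_mvs -/j /net /next_level F1; case: (st.1) => /=; ring.
have E3 : lmvs b0 z [:: c; c'; c] = mvs z [:: st; (st.1, st'.2); (st.1, st.2 (+) b0)].
  by rewrite -[LHS]/(lmv b0 (lmvs b0 z [:: c; c']) c) E2 -F2 /lmv L2.
rewrite E2 E3 E1 [st in pr (mvc z st)]surjective_pairing.
rewrite [st in mvs z [:: st; _]]surjective_pairing [st in mvs z [:: st; _; _]]surjective_pairing.
exact: axial_b0.
Qed.

(** The permutation p is read off at x and then propagates. At the neighbour along c0 the label c0
    leads back, and for any other c the edge labelled c ends the axial extension of the 2-arc that
    comes from c through x; automorphisms preserve axial extensions. *)
Lemma aut_label g x y : g \in A -> g (pr x) = pr y ->
  exists p : {perm bool * bool}, forall w, g (pr (lmvs b0 x w)) = pr (lmvs b0 y (map p w)).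
Proof.
move=> gA gx; have /graph_autP gE := gA.
have ex c : exists c', g (pr (lmv b0 x c)) == pr (lmv b0 y c').
  have /(adj_lmvP b0)[c' ->] : e (pr y) (g (pr (lmv b0 x c))).
    by rewrite -gx gE; apply/(adj_lmvP b0); exists c.
  by exists c'.
have [f fE] : exists f, forall c, g (pr (lmv b0 x c)) = pr (lmv b0 y (f c)).
  by exists (fun c => xchoose (ex c)) => c; apply/eqP/(xchooseP (ex c)).
have f_inj : injective f.
  move=> c c' Ef; have := fE c; rewrite Ef -fE => /perm_inj; exact: pr_lmv_inj.
exists (perm f_inj) => w; rewrite (eq_map (permE f_inj)).
elim: w x y gx fE {ex} => [|c0 w IHw] x y gx fE //=.
apply: IHw => [|c]; first exact: fE.
have [-> | neq] := eqVneq c c0; first by rewrite !lmvK.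
have := axial_aut gA (axial_label (lmv b0 x c) neq); rewrite /= !lmvK.
rewrite gx !fE; have := axial_label (lmv b0 y (f c)) (contra_neq (@f_inj c c0) neq).
by rewrite /= !lmvK => B1 B2; apply: axial_uniq B2 B1.
Qed.

(** * Label permutations *)

Definition real (K : {group {perm cpm m s r}}) x (p : {perm bool * bool}) :=
  exists2 g, g \in K & forall w, g (pr (lmvs b0 x w)) = pr (lmvs b0 x (map p w)).

Lemma real_mul K x p q : real K x p -> real K x q -> real K x (p * q)%g.
Proof.
case=> g gK gE [h hK hE]; exists (g * h)%g; first exact: groupM.
move=> w; rewrite permM gE hE -map_comp; congr (pr (lmvs b0 x _)).
by apply: eq_map => c; rewrite /= permM.
Qed.

Lemma real_inv K x p : real K x p -> real K x p^-1%g.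
Proof.
case=> g gK gE; exists g^-1%g; first by rewrite groupV.
move=> w; apply: (@perm_inj _ g); rewrite permKV gE -map_comp (eq_map (g := id)) ?map_id //.
by move=> c; rewrite /= permKV.
Qed.

Lemma real_conj K x p q : real K x p -> real K x q -> real K x (p ^ q)%g.
Proof. by move=> rp rq; rewrite conjgE; do 2?[apply: real_mul => //]; apply: real_inv. Qed.

Lemma real_tperm_same K x c : real K x (tperm c c).
Proof.
rewrite tperm1; exists 1%g => [|w]; first exact: group1.
by rewrite perm1 (eq_map (perm1 (T := _))) map_id.
Qed.

Definition flip_label (a : bool) : {perm bool * bool} := tperm (a, false) (a, true).

Lemma flip_labelE a c : flip_label a c = (c.1, c.2 (+) (c.1 == a)).
Proof. by case: c a => [[] []] [] /=; rewrite /flip_label ?tpermL ?tpermR ?tpermD. Qed.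

Lemma label_perm g x y (p p' : {perm bool * bool}) :
  (forall w, g (pr (lmvs b0 x w)) = pr (lmvs b0 y (map p w))) ->
  (forall c, g (pr (lmv b0 x c)) = pr (lmv b0 y (p' c))) -> p = p'.
Proof.
move=> H H'; apply/permP => c; apply: (@pr_lmv_inj b0 y).
by rewrite -H' -[pr (lmv _ _ _)](H [:: c]).
Qed.

Lemma cpm_G_flip_label x a : exists2 g, g \in cpm_G m s r &
  forall w, g (pr (lmvs b0 x w)) = pr (lmvs b0 x (map (flip_label a) w)).
Proof.
set j := (val x).1; pose l := cls (layer j (lstep b0 j (a, false))).
have [h hG hE] := cpm_G_flip x (cls_lt (layer j (lstep b0 j (a, false)))).
exists h => // w; have hA := subsetP cpm_G_aut h hG.
have [p pE] := aut_label hA (hE [::]).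
rewrite pE; suff -> : p = flip_label a by []; apply: (label_perm pE) => c.
rewrite -[lmv b0 x c]/(mvs x [:: lstep b0 j c]) hE -/j -/l.
congr (pr (mvc x _)); rewrite flip_labelE /flip_step.
have -> : (cls (layer j (lstep b0 j c)) == l) = (c.1 == a).
  rewrite /l cls_odd /layer /lstep /=; case: (c.1) (a) (oddz j) => [] [] [] /=; rewrite ?subrr //.
  - by rewrite (_ : j - (j - 1) = 1) //; ring.
  - by rewrite (_ : j - 1 - j = -1) //; ring.
  - by rewrite (_ : j - 1 - j = -1) //; ring.
  by rewrite (_ : j - (j - 1) = 1) //; ring.
rewrite /lstep /= -[(sval x).1]/j; congr (_, _); set k := half_sign b0 _.
by move: k (oddz j) (c.1 == a) (c.2) => [] [] [] [].
Qed.

(** Conjugating one transposition that mixes the coordinates by the two flips gives all mixed ones;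
    with the flips these are all transpositions. *)
Lemma real_all K x c c' : c.1 != c'.1 -> (forall a, real K x (flip_label a)) ->
  real K x (tperm c c') -> forall p, real K x p.
Proof.
move=> neq rf rc p.
have flip2 d d' : d.1 != d'.1 -> real K x (tperm d d') ->
    real K x (tperm (d.1, ~~ d.2) d').
  move=> nd rd; have := real_conj rd (rf d.1); rewrite tpermJ !flip_labelE eqxx addbT.
  by rewrite [d'.1 == _]eq_sym (negPf nd) addbF -surjective_pairing.
have rb b : real K x (tperm (c.1, b) c').
  have [-> | nb] := eqVneq b c.2; first by rewrite -surjective_pairing.
  by have := flip2 _ _ neq rc; congr (real _ _ (tperm (_, _) _)); case: (b) (c.2) nb => [] [].
have rbb b b' : real K x (tperm (c.1, b) (c'.1, b')).
  have [-> | nb] := eqVneq b' c'.2; first by rewrite -surjective_pairing.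
  rewrite tpermC; have := flip2 c' (c.1, b); rewrite eq_sym tpermC => /(_ neq (rb b)).
  by congr (real _ _ (tperm (_, _) _)); case: (b') (c'.2) nb => [] [].
have rt d d' : real K x (tperm d d').
  case: (eqVneq d d') => [->|nd]; first exact: real_tperm_same.
  have [E|E] := eqVneq d.1 d'.1.
    have -> : tperm d d' = flip_label d.1.
      by rewrite /flip_label; case: d d' nd E => [a []] [a' []] /= nd Ea;
        move: nd; rewrite -Ea ?eqxx // tpermC.
    exact: rf.
  have [Ec|Ec] := eqVneq d.1 c.1.
    have Ec' : d'.1 = c'.1 by rewrite Ec in E; case: (c.1) (c'.1) (d'.1) neq E => [] [] [].
    by rewrite [d]surjective_pairing [d']surjective_pairing Ec Ec'; apply: rbb.
  have Ec' : d'.1 = c.1 by case: (d.1) (c.1) (d'.1) Ec E => [] [] [].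
  have Ed : d.1 = c'.1 by case: (d.1) (c.1) (c'.1) Ec neq => [] [] [].
  by rewrite tpermC [d]surjective_pairing [d']surjective_pairing Ed Ec'; apply: rbb.
have [ts -> _] := prod_tpermP p.
elim: ts => [|t ts IHts]; rewrite ?big_nil ?big_cons; last exact: real_mul.
by rewrite -(tperm1 (true, true)); apply: real_tperm_same.
Qed.

(** An automorphism taking the 2-arc from 00 through x to 01 to the one from 00 to 10 conjugates a
    flip into a mixed transposition. *)
Lemma real_graph_aut x p : real [group of A] x p.
Proof.
have rf a : real [group of A] x (flip_label a).
  have [g gG gE] := cpm_G_flip_label x a; exists g => //.
  exact: (subsetP cpm_G_aut g gG).
have arc c c' : c != c' -> two_arc e (pr (lmv b0 x c)) (pr x) (pr (lmv b0 x c')).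
  move=> nc; apply/and3P; split.
  - by rewrite cpm_adj_sym; apply/(adj_lmvP b0); exists c.
  - by apply/(adj_lmvP b0); exists c'.
  by apply: contra_neq nc; apply: pr_lmv_inj.
have n1 : (false, false) != (false, true) by [].
have n2 : (false, false) != (true, false) by [].
have [g [gA g0 g1 g2]] := T2 (arc _ _ n1) (arc _ _ n2).
have [q qE] := aut_label gA g1.
have q0 : q (false, false) = (false, false).
  by apply: (@pr_lmv_inj b0 x); rewrite -[LHS](qE [:: (false, false)]).
have q1 : q (false, true) = (true, false).
  by apply: (@pr_lmv_inj b0 x); rewrite -[LHS](qE [:: (false, true)]).
have rq : real [group of A] x q by exists g.
apply: (@real_all _ x (false, false) (true, false)) => //.
have := real_conj (rf false) rq; by rewrite tpermJ q0 q1.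
Qed.

Lemma closed_label w (p : {perm bool * bool}) : pr (lmvs b0 base w) = pr base ->
  pr (lmvs b0 base (map p w)) = pr base.
Proof.
have [g gA gE] := real_graph_aut base p.
by rewrite -gE => ->; apply: (gE [::]).
Qed.

(** * The parameters *)

Let s2 := T2_s2.
Let v : 'Z_n := (-1) ^+ b0 * val r ^+ 2.

Lemma map_pw (f : bool * bool -> bool * bool) c w : map f (pw c w) = pw c (map f w).
Proof. by rewrite /pw map_flatten map_nseq. Qed.

Lemma closed_labelE w (p : {perm bool * bool}) :
  pr (lmvs b0 base (map p w)) = pr base <-> pr (lmvs b0 base w) = pr base.
Proof.
split; last exact: closed_label.
move/(closed_label p^-1); rewrite -map_comp (eq_map (g := id)) ?map_id //.
by move=> c; rewrite /= permK.
Qed.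

(** Exchanging the labels 01 and 10 turns (00 01)^c into (00 10)^c. *)
Lemma order02 c : (n %| 2 * c)%N <-> (m %| c)%N /\ geom v c = 0.
Proof.
rewrite -(closed_pw01 s2 b0) -closed_pw02 //.
rewrite -(closed_labelE _ (tperm (false, true) (true, false))) map_pw /=.
by rewrite tpermL tpermD.
Qed.

Lemma order0213 c : (n %| 2 * c)%N <-> (m %| 2 * c)%N /\ (1 - v ^+ c) * geom v c = 0.
Proof.
rewrite -(closed_pw0123 s2 b0) -closed_pw0213 //.
rewrite -(closed_labelE _ (tperm (false, true) (true, false))) map_cat !map_pw /=.
by rewrite tpermL tpermR !tpermD.
Qed.

(* Applying the transposition of the labels 01 and 10 to the closed word w. *)
Lemma double_v : v *+ 2 = 2%:R.
Proof.
pose w : seq (bool * bool) := [:: (false, false); (true, false); (true, true); (false, false);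
  (false, true); (true, true); (true, false); (false, true)].
pose tau := tperm (false, true) (true, false).
have cl : pr (lmvs b0 base w) = pr base.
  apply/eqP; rewrite lmvs_mvs [(val base).1]/= closed_conds ?size_lword //.
  have -> : net (lword b0 0 w) = 0 by case: (b0); vm_compute.
  have -> : conds s (lword b0 0 w) = [:: [::]; [::]] by rewrite T2_s2; case: (b0); vm_compute.
  by rewrite dvdz0 /= ?eqxx.
have := closed_label tau cl; have -> : map tau w =
    [:: (false, false); (false, true); (true, true); (false, false);
        (true, false); (true, true); (false, true); (true, false)].
  by rewrite /= /tau ?tpermL ?tpermR !tpermD.
move/eqP; rewrite lmvs_mvs [(val base).1]/= closed_conds ?size_lword //.
set w' := lword _ _ _; have -> : conds s w' = nseq 2 [:: 2; if b0 then 2 else -2].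
  by rewrite T2_s2 /w'; case: (b0); vm_compute.
case/andP => _ /andP[/eqP Z _]; move: Z; rewrite lev2 /u T2_s2 /v.
case: (b0) => Z; apply/eqP; rewrite -subr_eq0 -oppr_eq0 -[X in _ == X]Z; apply/eqP;
  by rewrite ?expr0 ?expr1; ring.
Qed.

Lemma classify : [/\ odd n, m = n & (-1) ^+ b0 * val r ^+ 2 = 1] \/
  b0 /\ ([/\ n = (2 * m)%N, (m %% 4 = 2)%N & val r ^+ 2 + 1 = m%:R] \/ m = 1%N /\ n = 4%N).
Proof.
have rp : val r ^+ (m * 2) = 1 \/ val r ^+ (m * 2) = -1 by move: r_pow; rewrite r2_pow.
case: (boolP (odd n)) => n_odd.
  by left; have [] := odd_params n_ge3 double_v order02 order0213 n_odd.
right; apply: (even_params m_gt0 n_ge3 double_v order02 order0213 rp n_odd).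
Qed.

(** * Stabilizers and generation *)

Section Stabiliser.
Variables (x : ccover) (K : {group {perm cpm m s r}}).

Lemma label_inj (g h : {perm cpm m s r}) (p : {perm bool * bool}) :
  (forall w, g (pr (lmvs b0 x w)) = pr (lmvs b0 x (map p w))) ->
  (forall w, h (pr (lmvs b0 x w)) = pr (lmvs b0 x (map p w))) -> g = h.
Proof.
move=> gE hE; apply/permP => y; have [z ->] := prP y.
by have [w <-] := lmvs_connected b0 x z; rewrite gE hE.
Qed.

Lemma stabiliser_sub : (forall p, real K x p) -> 'C_A[pr x | 'P] \subset K.
Proof.
move=> Kx; apply/subsetP => g /setIP[gA /astab1P gx].
have [p pE] := aut_label gA gx; have [h hK hE] := Kx p.
by rewrite (label_inj pE hE).
Qed.

Let acts (p : {perm bool * bool}) (g : {perm cpm m s r}) :=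
  [&& g \in A, g (pr x) == pr x & [forall c, g (pr (lmv b0 x c)) == pr (lmv b0 x (p c))]].

Lemma actsP p g : acts p g ->
  forall w, g (pr (lmvs b0 x w)) = pr (lmvs b0 x (map p w)).
Proof.
case/and3P => gA /eqP gx /forallP gc; have [q qE] := aut_label gA gx.
by have <- : q = p by apply: (label_perm qE) => c; apply/eqP/gc.
Qed.

Lemma card_stabiliser : #|'C_A[pr x | 'P]| = 24%N.
Proof.
have ex p : exists g, acts p g.
  have [g gA gE] := real_graph_aut x p; exists g; apply/and3P; split; first exact: gA.
    by apply/eqP; apply: (gE [::]).
  by apply/forallP => c; apply/eqP; apply: (gE [:: c]).
pose f p := xchoose (ex p); have fE p : acts p (f p) by apply: xchooseP.
have f_inj : injective f.
  move=> p q Ef; apply: (label_perm (actsP (fE p))) => c.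
  by rewrite Ef; case/and3P: (fE q) => _ _ /forallP/(_ c)/eqP.
have -> : 'C_A[pr x | 'P] = f @: [set: {perm bool * bool}].
  apply/setP => g; apply/idP/imsetP => [/setIP[gA /astab1P gx]|[p _ ->]].
    have [p pE] := aut_label gA gx; exists p; rewrite ?inE //.
    exact: label_inj pE (actsP (fE p)).
  by case/and3P: (fE p) => fA /eqP fx _; apply/setIP; split=> //; apply/astab1P.
rewrite card_imset // (_ : [set: _] = [set p | perm_on [set: bool * bool] p]).
  by rewrite cardsE card_perm cardsT card_prod card_bool.
by apply/setP => p; rewrite !inE; apply/esym/subsetP => c; rewrite inE.
Qed.

End Stabiliser.

(** G is transitive on vertices, so G and one full vertex-stabilizer generate the whole group. *)
Lemma graph_aut_sub (K : {group {perm cpm m s r}}) x : cpm_G m s r \subset K ->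
  (forall p, real K x p) -> A \subset K.
Proof.
move=> GK Kx; apply/subsetP => g gA; have [y Dy] := prP (g (pr x)).
have [h hG hE] := cpm_G_trans y x; have hK := subsetP GK h hG.
have hA := subsetP cpm_G_aut h hG.
rewrite -[g](mulgK h) groupMr ?groupV //; apply: (subsetP (stabiliser_sub Kx)).
apply/setIP; split; first by rewrite groupM.
by apply/astab1P; rewrite /= apermE permM Dy; apply: (hE [::]).
Qed.

Lemma graph_aut_gen (nu : {perm cpm m s r}) x c c' : nu \in A -> c.1 != c'.1 ->
  (forall w, nu (pr (lmvs b0 x w)) = pr (lmvs b0 x (map (tperm c c') w))) ->
  A = <<nu |: cpm_G m s r>>.
Proof.
move=> nuA neq nuE; apply/eqP; rewrite eqEsubset; apply/andP; split; last first.
  by rewrite gen_subG subUset sub1set nuA cpm_G_aut.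
pose K := [group of <<nu |: cpm_G m s r>>].
have GK : cpm_G m s r \subset K by apply: subset_trans (subset_gen _); apply: subsetUr.
have nuK : nu \in K by apply: mem_gen; apply: setU11.
apply: (@graph_aut_sub K x GK); apply: (real_all neq) => [a|]; last by exists nu.
by have [g gG gE] := cpm_G_flip_label x a; exists g => //; apply: (subsetP GK).
Qed.

End WithSign.

Lemma two_arc_transitive_params : exists b0 : bool, [/\ s = 2%N,
  [/\ odd n, m = n & (-1) ^+ b0 * val r ^+ 2 = 1] \/
  b0 /\ ([/\ n = (2 * m)%N, (m %% 4 = 2)%N & val r ^+ 2 + 1 = m%:R] \/ m = 1%N /\ n = 4%N),
  forall v : cpm m s r, #|'C_A[v | 'P]| = 24%N &
  forall x c c', c.1 != c'.1 -> exists2 nu : {perm cpm m s r},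
    forall w, nu (pr (lmvs b0 x w)) = pr (lmvs b0 x (map (tperm c c') w)) &
    A = <<nu |: cpm_G m s r>>].
Proof.
have [b0 ax] := axial_straight; exists b0; split.
- exact: T2_s2.
- exact: classify ax.
- by move=> v; have [y ->] := prP v; apply: card_stabiliser ax y.
move=> x c c' neq; have [nu nuA nuE] := real_graph_aut ax x (tperm c c').
by exists nu => //; apply: (graph_aut_gen ax nuA neq nuE).
Qed.

End TwoArcTransitive.
End Cover.

(** * Coordinates modulo a divisor *)

Section Reduction.
Variables (n d : nat).
Hypotheses (n_gt1 : (1 < n)%N) (d_gt1 : (1 < d)%N) (dn : (d %| n)%N).

Definition red (a : 'Z_n) : 'Z_d := (a : nat)%:R.

Lemma red_nat k : red k%:R = k%:R.
Proof. by apply/eqP; rewrite /red Zp_natr_eq // val_Zp_nat // modn_dvdm. Qed.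

Lemma redD a b : red (a + b) = red a + red b.
Proof. by rewrite -[a]natr_Zp -[b]natr_Zp -natrD !red_nat natrD. Qed.

Lemma redM a b : red (a * b) = red a * red b.
Proof. by rewrite -[a]natr_Zp -[b]natr_Zp -natrM !red_nat natrM. Qed.

Lemma red0 : red 0 = 0. Proof. exact: (red_nat 0). Qed.
Lemma red1 : red 1 = 1. Proof. exact: (red_nat 1). Qed.

Lemma redN a : red (- a) = - red a.
Proof. by apply/eqP; rewrite -addr_eq0 -redD addNr red0. Qed.

Lemma red_sign (b : bool) : red ((-1) ^+ b) = (-1) ^+ b.
Proof. by case: b; rewrite ?expr1 ?expr0 ?redN red1. Qed.

Lemma red_level M (j : int) : (1 < M)%N -> (d %| M)%N ->
  (((j%:~R : 'Z_M) : nat)%:R : 'Z_d) = j%:~R.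
Proof.
move=> M_gt1 dM; have [q {2}->] := Zp_intr_mod j M_gt1.
rewrite intrD intrM (_ : M%:Z%:~R = 0 :> 'Z_d) ?mul0r ?addr0 //.
by apply/eqP; rewrite Zp_intr_eq0.
Qed.
End Reduction.

(** For comparing coefficients of layers: advancing by two layers multiplies them by a fixed
    unit. *)
Lemma two_step (R : comUnitRingType) (a : R) (f g : int -> R) : a \is a GRing.unit ->
  (forall j, f (j + 2) = a * f j) -> (forall j, g (j + 2) = a * g j) ->
  f 0 = g 0 -> f 1 = g 1 -> forall j, f j = g j.
Proof.
move=> aU fE gE E0 E1.
have H (k : nat) j : f j = g j -> f (j + k%:Z * 2) = g (j + k%:Z * 2) /\
    f (j - k%:Z * 2) = g (j - k%:Z * 2).
  elim: k => [|k IHk] E; first by rewrite mul0r oppr0 addr0.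
  have [I1 I2] := IHk E; split.
    by rewrite (_ : _ + _ = (j + k%:Z * 2) + 2) ?fE ?gE ?I1 //; lia.
  apply: (mulrI aU); rewrite -fE -gE.
  by rewrite (_ : _ + 2 = j - k%:Z * 2) //; lia.
move=> j; have [b [k ->]] : exists b : bool, exists k : int, j = b%:Z + k * 2.
  by exists (oddz j), (j %/ 2)%Z; rewrite /oddz; lia.
have Eb : f b%:Z = g b%:Z by case: b.
case: k => k; first by case: (H k _ Eb).
by rewrite NegzE mulNr; case: (H k.+1 _ Eb).
Qed.

Lemma layer_parity b0 j (c : bool * bool) : oddz (layer j (lstep b0 j c)) = c.1.
Proof.
rewrite /layer /lstep /=.
by case: (c.1); case E: (oddz j) => /=; rewrite ?oddzB1 E.
Qed.

(** * Label steps in the coordinates (i, y, z) *)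

Section TwoCoordinates.
Variables (m n : nat) (r : {unit 'Z_n}) (m_gt0 : (0 < m)%N) (s_ge2 : (2 <= 2)%N).
Hypothesis n_ge3 : (3 <= n)%N.
Variables (r_pow : val r ^+ (m * 2) = 1 \/ val r ^+ (m * 2) = -1) (b0 : bool).
Local Notation lmv := (lmv m_gt0 s_ge2 r_pow b0).
Local Notation lmvs := (lmvs m_gt0 s_ge2 r_pow b0).
Implicit Types (x : ccover m 2 r) (w : seq (bool * bool)).
Variable d : nat.
Hypotheses (d_gt1 : (1 < d)%N) (dn : (d %| n)%N) (dm : (d %| 2 * m)%N).
Let n_gt1 : (1 < n)%N := ltnW n_ge3.
Local Notation red := (@red n d).

Definition coords (z : cover 2 n) : triple d := (z.1%:~R, red (z.2 0 0), red (z.2 0 1)).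

Lemma coordsE x : reduce d (val (pr x)) = coords (val x).
Proof.
rewrite /reduce /coords /= red_level //; last by rewrite mulnC.
by rewrite mulnC; lia.
Qed.

Definition amp (lay : int) : 'Z_n := (-1) ^+ half_sign b0 lay * val r ^ lay.

Lemma amp2 lay : amp (lay + 2) = ((-1) ^+ b0 * val r ^+ 2) * amp lay.
Proof.
rewrite /amp half_signD2.
by rewrite exprzDr ?r_unit // signr_addb -exprnP; ring.
Qed.

Lemma coords_lmv x (c : bool * bool) : let j := (val x).1 in
  let a := (-1) ^+ (oddz j) * (-1) ^+ c.2 * red (amp (layer j (lstep b0 j c))) in
  coords (val (lmv x c)) = let: (i, y, z) := coords (val x) in
    if c.1 then (i - (-1) ^+ (oddz j), y, z + a) else (i + (-1) ^+ (oddz j), y + a, z).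
Proof.
move=> j a; rewrite /coords lmv_vec level_lmv -/j.
set lay := layer j _ in a *.
have Dc : cls 2 lay = c.1.
  rewrite /lay /layer /lstep /cls /=; case: (c.1); rewrite /oddz; case: ifP; lia.
have Di : (next_level j (lstep b0 j c))%:~R =
    (if c.1 then j%:~R - (-1) ^+ oddz j else j%:~R + (-1) ^+ oddz j) :> 'Z_d.
  rewrite /next_level /lstep /=; case: (c.1) (oddz j) => [] [] /=;
  by rewrite ?intrD ?intrB ?expr0 ?expr1 ?opprK.
have Da (k : 'I_2) : red (((val x).2 + (-1) ^+ (c.2 (+) oddz j) *: dv 2 r b0 lay) 0 k) =
    red ((val x).2 0 k) + (if (k : nat) == c.1 :> nat then a else 0).
  rewrite mxE redD //; congr (_ + _); rewrite mxE /dv /dvec mxE -/(amp lay) mxE Dc.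
  case: eqP => _; last by rewrite !mulr0 red0.
  by rewrite mulr1 redM // red_sign // signr_addb /a [_ ^+ c.2 * _]mulrC.
by rewrite !Da Di /=; case: (c.1) => /=; rewrite addr0.
Qed.

Lemma level_parity x (c : bool * bool) : oddz (val (lmv x c)).1 = ~~ oddz (val x).1.
Proof. by rewrite level_lmv oddz_next. Qed.

Section Beta.
Variables (q : 'Z_d) (h : bool).
Hypotheses (sign_r : red ((-1) ^+ b0 * val r ^+ 2) = 1) (q_r : q * red (val r) = (-1) ^+ h).
Hypothesis d_odd : odd d.

(** As q r is 1 or -1, the labelled steps become vectors with entries 0, 1 and -1; [beta q] is the
    conjugate of [beta 1] under this scaling. *)
Definition scaled x : triple d := let: (i, y, z) := coords (val x) in (i, y, q * z).

Lemma red_amp lay : red (amp lay) = if oddz lay then red (val r) else 1.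
Proof.
apply: (@two_step _ 1 (fun j => red (amp j)) (fun j => if oddz j then red (val r) else 1)).
- exact: unitr1.
- by move=> j; rewrite amp2 redM // sign_r.
- by move=> j; rewrite mul1r (_ : j + 2 = j + 1 + 1) ?oddzD1 ?negbK //; lia.
- by rewrite /amp /half_sign andbF expr0z mulr1 red1.
by rewrite /amp /half_sign andbF expr1z mul1r.
Qed.

Lemma scaled_lmv x (c : bool * bool) : let e := (-1) ^+ oddz (val x).1 in
  scaled (lmv x c) = let: (i, y, z) := scaled x in
    if c.1 then (i - e, y, z + e * (-1) ^+ c.2 * (-1) ^+ h)
    else (i + e, y + e * (-1) ^+ c.2, z).
Proof.
move=> e; rewrite /scaled coords_lmv -/e /coords red_amp.
rewrite layer_parity.
case: (c.1) => /=; last by rewrite mulr1.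
by congr (_, _, _); rewrite mulrDr -q_r; ring.
Qed.

Let half : 'Z_d := 2%:R^-1.

Lemma half_step (a a0 k : 'Z_d) : a = a0 + k * 2%:R -> half * a = half * a0 + k.
Proof.
move=> ->; rewrite mulrDr; congr (_ + _); rewrite mulrC -mulrA mulrV ?mulr1 //.
by rewrite unitZpE // coprimen2.
Qed.

Lemma half_same (a a0 : 'Z_d) : a = a0 -> half * a = half * a0.
Proof. by move->. Qed.

(** [beta 1] fixes (1, 1, 0) and (-1, 0, 1) and exchanges (1, -1, 0) with (-1, 0, -1). Up to the
    common sign [e], the last two are the steps with labels (false, true) and (true, ~~ h). *)
Lemma beta_lmv x x' c : oddz (val x).1 = oddz (val x').1 ->
  beta 1 (scaled x) = scaled x' ->
  beta 1 (scaled (lmv x c)) = scaled (lmv x' (tperm (false, true) (true, ~~ h) c)).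
Proof.
rewrite !scaled_lmv => <- <-; set e := (-1) ^+ _; case: (scaled x) => -[i y] z.
have e2 : 1^-1 = 1 :> 'Z_d by rewrite invr1.
rewrite /beta e2 -/half; case: c => [[] []]; case: (h) => /=;
  rewrite ?tpermL ?tpermR ?tpermD //= ?expr0 ?expr1;
  congr (_, _, _); try (apply: half_step; ring); try (apply: half_same; ring); ring.
Qed.

Lemma beta_lmvs x0 w : scaled x0 = (0, 0, 0) ->
  beta 1 (scaled (lmvs x0 w)) =
    scaled (lmvs x0 (map (tperm (false, true) (true, ~~ h)) w)).
Proof.
move=> s0; have : beta 1 (scaled x0) = scaled x0.
  by rewrite s0 /beta !mulr0 !addr0 !subr0 mulr0.
suff H x x' : oddz (val x).1 = oddz (val x').1 -> beta 1 (scaled x) = scaled x' ->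
  beta 1 (scaled (lmvs x w)) =
    scaled (lmvs x' (map (tperm (false, true) (true, ~~ h)) w)) by exact: H.
elim: w x x' => [|c w IHw] x x' E1 E2 //=.
by apply: IHw; [rewrite !level_parity E1 | apply: beta_lmv].
Qed.

End Beta.

End TwoCoordinates.

(** * The automorphism nubar *)

Section OddComponent.
Variables (m n : nat) (r : {unit 'Z_n}) (m_gt0 : (0 < m)%N).
Hypotheses (n_ge3 : (3 <= n)%N) (n_odd : odd n).
Hypothesis r_pow : val r ^+ (m * 2) = 1 \/ val r ^+ (m * 2) = -1.
Let n_gt1 : (1 < n)%N := ltnW n_ge3.

Let inS (z : cover 2 n) := proj m z \in cpm_set m 2 r.

Let inS_mv z st : inS z -> inS (mv r z st).
Proof. exact: proj_mv_set. Qed.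

(** Going up and down across a layer adds twice its vector, and 2 is invertible modulo n; so all of
    level 0 is reached, and then every level. Thus permutations of the component are permutations of
    all vertices, as [is_nubar] demands. *)
Lemma odd_component : cpm_set m 2 r = setT.
Proof.
have step (v d : 'rV['Z_n]_2) c : v + d *+ (2 * c) + d + d = v + d *+ (2 * c.+1).
  by rewrite (_ : (2 * c.+1 = (2 * c).+2)%N) ?mulrSr -?addrA //; lia.
have H0 v c : inS (0, v) -> inS (0, v + dvec 2 r 0 false *+ (2 * c)).
  move=> Sv; elim: c => [|c IHc]; first by rewrite muln0 mulr0n addr0.
  have := inS_mv (false, false) (inS_mv (true, false) IHc).
  by rewrite /mv /= subrr step.
have H1 v c : inS (0, v) -> inS (0, v + dvec 2 r (-1) false *+ (2 * c)).
  move=> Sv; elim: c => [|c IHc]; first by rewrite muln0 mulr0n addr0.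
  have := inS_mv (true, false) (inS_mv (false, false) IHc).
  by rewrite /mv /= sub0r addNr step.
have half (a : 'Z_n) : exists c, (2 * c)%:R = a.
  exists (a * n.+1./2)%N; rewrite mulnCA (_ : 2 * _ = n + 1)%N; last by lia.
  rewrite mulnDr muln1 natrD natrM (_ : n%:R = 0) ?mulr0 ?add0r ?natr_Zp //.
  by apply/eqP; rewrite Zp_natr_eq0.
have S0 v : inS (0, v).
  have [c Dc] := half (v 0 0); have [c' Dc'] := half (v 0 1 * val r).
  have := H1 _ c' (H0 _ c (base_in m 2 r)).
  congr (inS (_, _)); rewrite add0r -!scaler_nat Dc Dc' /dvec expr0z !mul1r.
  apply/rowP => k; rewrite !mxE; have [->|->] : k = 0 \/ k = 1.
  - by case: k => [[|[|k]] lt_k] //; [left | right]; apply: val_inj.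
  - by rewrite /= !mulr0 addr0 !mulr1.
  by rewrite /= !mulr0 add0r !mulr1 exprN1 mulrK //; exact: r_unit.
have Sk (k : nat) v : inS (k%:Z, v).
  elim: k v => [|k IHk] v; first exact: S0.
  have := inS_mv (true, false) (IHk (v - dvec 2 r k%:Z false)).
  by rewrite /mv /= subrK (_ : k%:Z + 1 = k.+1%:Z) //; lia.
apply/setP => -[i v]; have := Sk i v.
by rewrite /inS /proj /= -pmulrn natr_Zp => ->; rewrite inE.
Qed.

End OddComponent.

Lemma level_parity_lmvs m n (r : {unit 'Z_n}) (m_gt0 : (0 < m)%N) (s_ge2 : (2 <= 2)%N) r_pow b0
    (x : ccover m 2 r) w :
  oddz (val (lmvs m_gt0 s_ge2 r_pow b0 x w)).1 = oddz (val x).1 (+) odd (size w).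
Proof.
elim: w x => [|c w IHw] x; first by rewrite addbF.
by rewrite [lmvs _ _ _ _ _ _]/= IHw level_parity /= addNb addbN.
Qed.

Lemma odd_level M (j : int) : (1 < M)%N -> ~~ odd M -> odd (j%:~R : 'Z_M) = oddz j.
Proof.
move=> M_gt1 M_ev; have [q Dj] := Zp_intr_mod j M_gt1.
have DM : M%:Z = 2 * M./2%:Z by lia.
by rewrite [in RHS]Dj DM -mulrA /oddz; lia.
Qed.

Section OddCase.
Variables (n : nat) (r : {unit 'Z_n}) (n_gt0 : (0 < n)%N) (s_ge2 : (2 <= 2)%N).
Hypotheses (n_ge3 : (3 <= n)%N) (n_odd : odd n).
Variables (r_pow : val r ^+ (n * 2) = 1 \/ val r ^+ (n * 2) = -1) (b0 : bool).
Hypothesis r_sqr : (-1) ^+ b0 * val r ^+ 2 = 1.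
Variable nu : {perm cpm n 2 r}.
Local Notation lmvs := (lmvs n_gt0 s_ge2 r_pow b0).
Local Notation tau := (tperm (false, true) (true, true)).
Hypothesis nuE : forall w,
  nu (pr (lmvs (base n 2 r) w)) = pr (lmvs (base n 2 r) (map tau w)).
Let n_gt1 : (1 < n)%N := ltnW n_ge3.
Let M_gt1 : (1 < n * 2)%N. Proof. by lia. Qed.

Let r_setT v : v \in cpm_set n 2 r.
Proof. by rewrite odd_component ?inE. Qed.

Let one_setT v : v \in cpm_set n 2 (1%g : {unit 'Z_n}).
Proof. by rewrite odd_component ?inE //; left; rewrite expr1n. Qed.

Let unscale (v : bvertex n 2 n) : bvertex n 2 n :=
  (v.1, \row_j (if j == 0 then v.2 0 j else (val r)^-1 * v.2 0 j)).

Let unscaleK : cancel unscale (rescale r).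
Proof.
move=> [i v]; congr (_, _); apply/rowP => k; rewrite !mxE.
by case: eqP => //= _; rewrite mulVKr //; exact: r_unit.
Qed.

Let rescaleK : cancel (rescale r) unscale.
Proof.
move=> [i v]; congr (_, _); apply/rowP => k; rewrite !mxE.
by case: eqP => //= _; rewrite mulKr //; exact: r_unit.
Qed.

Let to_r (v : bvertex n 2 n) : cpm n 2 r := exist _ (rescale r v) (r_setT _).

Let nubar_fun (v : bvertex n 2 n) : bvertex n 2 n := unscale (val (nu (to_r v))).

Let nubar_inj : injective nubar_fun.
Proof.
move=> v v' /(can_inj unscaleK) /val_inj /perm_inj /(congr1 val).
exact: (can_inj rescaleK).
Qed.

Let nu1_fun (v : cpm n 2 (1%g : {unit 'Z_n})) : cpm n 2 (1%g : {unit 'Z_n}) :=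
  exist _ (nubar_fun (val v)) (one_setT _).

Let nu1_inj : injective nu1_fun.
Proof. by move=> v v' /(congr1 val) /nubar_inj /val_inj. Qed.

Let reduce_unscale (x : ccover n 2 r) : reduce n (unscale (val (pr x))) = scaled (d := n) (val r)^-1 x.
Proof.
rewrite /scaled -coordsE //; last exact: dvdn_mull.
rewrite /reduce; have -> : (unscale (val (pr x))).2 0 0 = (val (pr x)).2 0 0 by rewrite mxE.
have -> : (unscale (val (pr x))).2 0 1 = (val r)^-1 * (val (pr x)).2 0 1 by rewrite mxE.
by congr (_, _, _); rewrite !natr_Zp.
Qed.

(** Here [nubar] is [nu] transported along [unscale]. The formula for [beta] is verified on label
    words, and the parity of the level is kept because relabelling preserves the length of a
    word. *)
Lemma odd_nu_or_nubar : nu_or_nubar nu.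
Proof.
have r2 : val r ^+ 2 = 1 \/ val r ^+ 2 = -1.
  move: r_sqr; case: b0 => /=; rewrite ?mul1r ?mulN1r; last by left.
  by move=> H; right; rewrite -H opprK.
have one2 : val (1%g : {unit 'Z_n}) = 1 by [].
pose nubar := perm nubar_inj; pose nu1 := perm nu1_inj.
have nubarP : is_nubar nubar.
  move=> v; have [x Dx] := prP (to_r v).
  have [w Dw] := lmvs_connected n_gt0 s_ge2 r_pow b0 (base n 2 r) x.
  have nuv : nubar v = unscale (val (pr (lmvs (base n 2 r) (map tau w)))).
    by rewrite permE /nubar_fun Dx -Dw nuE.
  have Dv : v = unscale (val (pr (lmvs (base n 2 r) w))) by rewrite Dw -Dx /= rescaleK.
  split; first by rewrite nuv [in RHS]Dv /= !odd_level ?level_parity_lmvs ?size_map // oddM andbF.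
  rewrite nuv [in RHS]Dv !reduce_unscale.
  have sgn : red n ((-1) ^+ b0 * val r ^+ 2) = 1 by rewrite r_sqr red1.
  have q_r : (val r)^-1 * red n (val r) = (-1) ^+ false.
    by rewrite /red natr_Zp mulVr //; exact: r_unit.
  have s0 : scaled (val r)^-1 (base n 2 r) = (0, 0, 0) :> triple n.
    by rewrite /scaled /coords /= !mxE red0 //; congr (_, _, _); apply: mulr0.
  have nn : (n %| 2 * n)%N by apply: dvdn_mull.
  by rewrite (beta_lmvs n_gt0 s_ge2 n_ge3 r_pow n_gt1 (dvdnn n) nn sgn q_r n_odd w s0).
apply: (Rescaled r2 (nu' := nu1)).
  apply: (IsNubar n_odd nubarP) => v; by rewrite !permE.
have D v : val (nu1 v) = nubar_fun (val v) by rewrite permE.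
move=> y; have [x0 D0] : exists x0 : cpm n 2 (1%g : {unit 'Z_n}), val x0 = unscale (val y).
  by exists (exist _ (unscale (val y)) (one_setT _)).
have D1 : rescale r (val x0) = val y := etrans (congr1 (rescale r) D0) (unscaleK (val y)).
have E : to_r (val x0) = y by apply: val_inj; exact: D1.
have D2 : nubar_fun (val x0) = unscale (val (nu y)) by rewrite /nubar_fun E.
exists x0; first exact: esym D1.
exact: (etrans (esym (unscaleK _)) (congr1 (rescale r) (esym (etrans (D x0) D2)))).
Qed.
End OddCase.

(** * The 4-cube *)

Lemma r_pow4 : val (1%g : {unit 'Z_4}) ^+ (2 * 2) = 1 \/
  val (1%g : {unit 'Z_4}) ^+ (2 * 2) = -1.
Proof. by left; rewrite expr1n. Qed.

Section FourCube.
Local Notation one4 := (1%g : {unit 'Z_4}).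
Let m_gt0 : (0 < 2)%N := isT.
Let s_ge2 : (2 <= 2)%N := isT.
Let n_ge3 : (3 <= 4)%N := isT.
Local Notation r_pow := r_pow4.
Local Notation lmv := (lmv m_gt0 s_ge2 r_pow true).
Local Notation lmvs := (lmvs m_gt0 s_ge2 r_pow true).
Local Notation base := (base 2 2 one4).
Local Notation e := (@cpm_adj 2 2 4 one4).
Implicit Types (x y : ccover 2 2 one4) (w : seq (bool * bool)) (c : bool * bool).

Lemma half_sign4 b0 lay q : half_sign b0 (lay + 4 * q) = half_sign b0 lay.
Proof.
rewrite /half_sign; have -> : ((lay + 4 * q) %/ 2)%Z = (lay %/ 2)%Z + 2 * q by lia.
by congr (_ && _); rewrite /oddz; lia.
Qed.

Lemma layer4 j q st : layer (j + 4 * q) st = layer j st + 4 * q.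
Proof. by rewrite /layer; case: st.1 => //; rewrite addrAC. Qed.

Lemma lstep4 b0 j q c : lstep b0 (j + 4 * q) c = lstep b0 j c.
Proof.
have E : oddz (j + 4 * q) = oddz j by rewrite /oddz; lia.
by rewrite /lstep E layer4 half_sign4.
Qed.

Lemma dv4 lay q : dv 2 one4 true (lay + 4 * q) = dv 2 one4 true lay.
Proof.
rewrite /dv half_sign4 /dvec (_ : val one4 = 1) // !exp1rz; congr (_ *: stdvec _ _ _).
by rewrite /cls; lia.
Qed.

(** The labelling has period 4 in the level, because [half_sign] does and r = 1; so here labels
    belong to the edges of the graph itself. *)
Lemma pr_lmv4 x y c : pr x = pr y -> pr (lmv x c) = pr (lmv y c).
Proof.
move=> /(pr_eq m_gt0 s_ge2) [/dvdzP[q Dq] Dv].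
have Dx : (val x).1 = (val y).1 + 4 * q by rewrite mulrC -Dq addrC subrK.
have E : oddz (val x).1 = oddz (val y).1 by rewrite Dx /oddz; lia.
apply: (eq_pr m_gt0 s_ge2).
  rewrite !level_lmv Dx lstep4 /next_level; apply/dvdzP; exists q.
  by case: (lstep _ _ _).1; ring.
by rewrite !lmv_vec Dv E Dx lstep4 layer4 dv4.
Qed.

Lemma pr_lmvs4 x y w : pr x = pr y -> pr (lmvs x w) = pr (lmvs y w).
Proof. by elim: w x y => [|c w IHw] x y //= /(pr_lmv4 c)/IHw. Qed.

Lemma lmvs_rev x w : lmvs (lmvs x w) (rev w) = x.
Proof.
elim: w x => [|c w IHw] x //=.
by rewrite rev_cons -cats1 lmvs_cat IHw /= lmvK.
Qed.

Lemma pr_lmvs_rev x w w' : (pr (lmvs x (w ++ rev w')) == pr x) =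
  (pr (lmvs x w) == pr (lmvs x w')).
Proof.
rewrite lmvs_cat; apply/eqP/eqP => [|H]; last by rewrite (pr_lmvs4 _ H) lmvs_rev.
by move/(pr_lmvs4 w'); rewrite -{2}[w']revK lmvs_rev.
Qed.

(** A vertex of the 4-cube is recorded by how often, modulo 2, each label is used on a walk from
    [base]; relabelling then permutes the four entries. *)
Definition quad : finType := (bool * bool * bool * bool)%type.

Definition quad_word (a : quad) : seq (bool * bool) := let: (a0, a1, a2, a3) := a in
  nseq a0 (false, false) ++ nseq a1 (false, true) ++ nseq a2 (true, false) ++
  nseq a3 (true, true).

Definition toggle c (a : quad) : quad := let: (a0, a1, a2, a3) := a in
  (a0 (+) (c == (false, false)), a1 (+) (c == (false, true)),
   a2 (+) (c == (true, false)), a3 (+) (c == (true, true))).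

Definition quads : seq quad := [seq (p, b) | p <- [seq (p, b) | p <-
  [seq (b, b') | b <- [:: true; false], b' <- [:: true; false]], b <- [:: true; false]],
  b <- [:: true; false]].

Lemma mem_quads a : a \in quads. Proof. by case: a => [[[[] []] []] []]. Qed.

Definition closed4 w := let w' := lword true 0 w in
  (4%:Z %| net w')%Z && all (zero1 4) (conds 2 w').

Lemma closed4E w : (size w <= 8)%N -> (pr (lmvs base w) == pr base) = closed4 w.
Proof.
move=> sw; rewrite lmvs_mvs [(val base).1]/= closed_conds ?size_lword //.
by rewrite zero1_all // expr1n.
Qed.

Lemma size_quad_word a : (size (quad_word a) <= 4)%N.
Proof. by case: a => [[[[] []] []] []]. Qed.

Lemma test_toggle : all (fun a => all (fun c =>
    closed4 (rcons (quad_word a) c ++ rev (quad_word (toggle c a))))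
  [:: (false, false); (false, true); (true, false); (true, true)]) quads.
Proof. by vm_compute. Qed.

Lemma test_quads : all (fun a => all (fun b =>
  closed4 (quad_word a ++ rev (quad_word b)) ==> (a == b)) quads) quads.
Proof. by vm_compute. Qed.

Definition vertex4 (a : quad) : cube4 := pr (lmvs base (quad_word a)).

Lemma vertex4_toggle a c : pr (lmv (lmvs base (quad_word a)) c) = vertex4 (toggle c a).
Proof.
have /allP/(_ _ (mem_quads a))/allP/(_ c) := test_toggle.
have -> : c \in [:: (false, false); (false, true); (true, false); (true, true)].
  by case: c => [[] []].
move=> /(_ isT); rewrite -closed4E.
  by rewrite pr_lmvs_rev -cats1 lmvs_cat => /eqP.
by case: a c => [[[[] []] []] []] [[] []].
Qed.

Lemma vertex4_inj : injective vertex4.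
Proof.
move=> a b /eqP; rewrite -pr_lmvs_rev closed4E.
  by move=> H; have /allP/(_ _ (mem_quads a))/allP/(_ _ (mem_quads b)) := test_quads;
    rewrite H => /eqP.
by rewrite size_cat size_rev (leq_add (size_quad_word _) (size_quad_word _)).
Qed.

Lemma vertex4_surj (v : cube4) : exists a, v = vertex4 a.
Proof.
have [x ->] := prP v; have [w <-] := lmvs_connected m_gt0 s_ge2 r_pow true base x.
elim/last_ind: w => [|w c [a IHw]]; first by exists (false, false, false, false).
exists (toggle c a); rewrite -vertex4_toggle -cats1 lmvs_cat; exact: pr_lmv4 IHw.
Qed.

Local Notation tau := (tperm (false, true) (true, true)).
Definition swap13 (a : quad) : quad := let: (a0, a1, a2, a3) := a in (a0, a3, a2, a1).

Lemma swap13K : involutive swap13. Proof. by case=> [[[]]]. Qed.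

Lemma toggle_swap13 c a : toggle (tau c) (swap13 a) = swap13 (toggle c a).
Proof. by case: a => [[[a0 a1] a2] a3]; case: c => [[] []]; rewrite ?tpermL ?tpermR ?tpermD. Qed.

Lemma ex_quad (v : cube4) : exists a, v == vertex4 a.
Proof. by have [a ->] := vertex4_surj v; exists a. Qed.

Definition nu4_fun (v : cube4) : cube4 := vertex4 (swap13 (xchoose (ex_quad v))).

Lemma nu4_fun_vertex a : nu4_fun (vertex4 a) = vertex4 (swap13 a).
Proof.
rewrite /nu4_fun; congr (vertex4 (swap13 _)); apply: vertex4_inj.
by rewrite -(eqP (xchooseP (ex_quad (vertex4 a)))).
Qed.

Lemma nu4_inj : injective nu4_fun.
Proof.
move=> v v'; have [a ->] := vertex4_surj v; have [a' ->] := vertex4_surj v'.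
by rewrite !nu4_fun_vertex => /vertex4_inj /(inv_inj swap13K) ->.
Qed.

Definition nu4 : {perm cube4} := perm nu4_inj.

Lemma nu4_vertex a : nu4 (vertex4 a) = vertex4 (swap13 a).
Proof. by rewrite permE nu4_fun_vertex. Qed.

Lemma nu4_lmvs w : nu4 (pr (lmvs base w)) = pr (lmvs base (map tau w)).
Proof.
suff [a [-> ->]] : exists a, pr (lmvs base w) = vertex4 a /\
    pr (lmvs base (map tau w)) = vertex4 (swap13 a) by exact: nu4_vertex.
elim/last_ind: w => [|w c [a [E1 E2]]]; first by exists (false, false, false, false).
exists (toggle c a); rewrite map_rcons -toggle_swap13 -!vertex4_toggle -!cats1 !lmvs_cat.
by split; exact: pr_lmv4.
Qed.

Lemma nu4_aut : nu4 \in graph_aut e.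
Proof.
apply/graph_autP => v v'; have [x ->] := prP v.
have [w <-] := lmvs_connected m_gt0 s_ge2 r_pow true base x; rewrite nu4_lmvs.
have P := adj_lmvP m_gt0 s_ge2 r_pow true.
apply/P/P => -[c Dc]; exists (tau c); last first.
  by rewrite Dc -[lmv _ c]/(lmvs (lmvs base w) [:: c]) -lmvs_cat nu4_lmvs map_cat lmvs_cat.
apply: (@perm_inj _ nu4); rewrite Dc -[lmv _ (tau c)]/(lmvs (lmvs base w) [:: tau c]).
by rewrite -lmvs_cat nu4_lmvs map_cat lmvs_cat /= tpermK.
Qed.

Definition ipos (p : int * int * int) c : int * int * int :=
  let: (j, y, z) := p in
  let lay := layer j (lstep true j c) in
  let a : int := if c.2 (+) oddz j (+) half_sign true lay then -1 else 1 in
  (next_level j (lstep true j c), if c.1 then y else y + a, if c.1 then z + a else z).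

Lemma coords_ipos x p c : (val x).1 = p.1.1 ->
  coords 4 (val x) = (p.1.1%:~R, p.1.2%:~R, p.2%:~R) ->
  (val (lmv x c)).1 = (ipos p c).1.1 /\
  coords 4 (val (lmv x c)) = ((ipos p c).1.1%:~R, (ipos p c).1.2%:~R, (ipos p c).2%:~R).
Proof.
case: p => [[j y] z] Dj Dx; change ((val x).1 = j) in Dj.
change (coords 4 (val x) = (j%:~R, y%:~R, z%:~R)) in Dx.
split; first by rewrite level_lmv Dj.
have := coords_lmv m_gt0 s_ge2 n_ge3 r_pow true (d := 4) isT (dvdnn 4) (dvdnn 4) x c.
cbv zeta; rewrite Dx Dj; set lay := layer _ _; set E := coords 4 _ => DE.
have E1 : E.1.1 = (next_level j (lstep true j c))%:~R by rewrite -[E.1.1]/((val (lmv x c)).1%:~R) level_lmv Dj.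
have Ea : (-1) ^+ oddz j * (-1) ^+ c.2 * red 4 (amp one4 true lay) =
    (if c.2 (+) oddz j (+) half_sign true lay then -1 else 1 : int)%:~R :> 'Z_4.
  rewrite /amp (_ : val one4 = 1) // exp1rz mulr1 red_sign // -!signr_addb.
  by rewrite [oddz j (+) _]addbC; case: (_ (+) _).
rewrite [E]surjective_pairing [E.1]surjective_pairing E1 DE Ea.
by rewrite /ipos -/lay /=; case: (c.1) => /=; rewrite ?intrD.
Qed.

Definition int_triple (p : int * int * int) : triple 4 :=
  (p.1.1%:~R, p.1.2%:~R, p.2%:~R).

Lemma coords_iposs w : coords 4 (val (lmvs base w)) = int_triple (foldl ipos (0, 0, 0) w).
Proof.
have E1 : coords 4 (val base) = int_triple (0, 0, 0) by rewrite /coords /= !mxE red0.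
have E2 : (val base).1 = (0, 0, 0).1.1 :> int by [].
elim: w (base) (0, 0, 0) E1 E2 => [|c w IHw] x p E1 E2; first exact: E1.
by have [F1 F2] := coords_ipos c E2 E1; apply: IHw.
Qed.

Lemma reduce4_inj (v v' : cube4) : reduce 4 (val v) = reduce 4 (val v') -> v = v'.
Proof.
case=> E0 E1 E2; apply: val_inj; rewrite !natr_Zp in E0 E1 E2.
rewrite [LHS]surjective_pairing [RHS]surjective_pairing; congr (_, _).
  exact: E0.
apply/rowP => k; have [->|->] // : k = 0 \/ k = 1.
by case: k => [[|[|k]] lt_k] //; [left | right]; apply: val_inj.
Qed.

Lemma nu4P : is_nu4 nu4.
Proof.
split; first exact: nu4_aut.
  apply/eqP => /permP /(_ (pr (lmvs base [:: (false, true)]))).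
  by rewrite nu4_lmvs perm1 => H; have := pr_lmv_inj n_ge3 H; rewrite tpermL.
have fixE a (v : cube4) t : reduce 4 (val v) = t -> swap13 a = a ->
    coords 4 (val (lmvs base (quad_word a))) = t -> nu4 v = v.
  move=> Dv Da; rewrite -coordsE // -Dv => /reduce4_inj <-.
  by rewrite -/(vertex4 a) nu4_vertex Da.
(* The prescribed 4-cycle consists of the quads whose second and fourth entries are true, and
   [swap13] fixes these. *)
move=> v; rewrite !inE => /or4P[] /eqP Dv.
- apply: (fixE (false, true, false, true) v _ Dv) => //.
  by rewrite coords_iposs; congr (_, _, _); apply: val_inj.
- apply: (fixE (true, true, false, true) v _ Dv) => //.
  by rewrite coords_iposs; congr (_, _, _); apply: val_inj.
- apply: (fixE (true, true, true, true) v _ Dv) => //.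
  by rewrite coords_iposs; congr (_, _, _); apply: val_inj.
apply: (fixE (false, true, true, true) v _ Dv) => //.
by rewrite coords_iposs; congr (_, _, _); apply: val_inj.
Qed.

End FourCube.

(** * The automorphism nu *)

Section EvenCase.
Variables (m : nat) (r : {unit 'Z_(2 * m)}) (m_gt0 : (0 < m)%N) (s_ge2 : (2 <= 2)%N).
Hypotheses (m_mod4 : (m %% 4 = 2)%N) (r_sqr : val r ^+ 2 + 1 = m%:R).
Variable r_pow : val r ^+ (m * 2) = 1 \/ val r ^+ (m * 2) = -1.
Variable nu : {perm cpm m 2 r}.
Local Notation one4 := (1%g : {unit 'Z_4}).
Local Notation lmv4 := (lmv (isT : (0 < 2)%N) (isT : (2 <= 2)%N) r_pow4 true).
Local Notation lmvs4 := (lmvs (isT : (0 < 2)%N) (isT : (2 <= 2)%N) r_pow4 true).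
Local Notation base4 := (base 2 2 one4).
Local Notation lmv := (lmv m_gt0 s_ge2 r_pow true).
Local Notation lmvs := (lmvs m_gt0 s_ge2 r_pow true).
Local Notation base := (base m 2 r).
Implicit Types (x : ccover m 2 r) (y : ccover 2 2 one4).

(* The r0 of is_nu is r if this holds, and - r otherwise. *)
Definition r_mod4 : bool := (val r %% 4 == 3)%N.
Local Notation h := r_mod4.
Local Notation tau := (tperm (false, true) (true, ~~ h)).
Hypothesis nuE : forall w, nu (pr (lmvs base w)) = pr (lmvs base (map tau w)).

Let n_ge3 : (3 <= 2 * m)%N. Proof. by lia. Qed.
Let n_gt1 : (1 < 2 * m)%N := ltnW n_ge3.
Let n4 : (4 %| 2 * m)%N. Proof. by lia. Qed.

Let r_sqr' : val r ^+ 2 = m%:R - 1. Proof. by rewrite -r_sqr addrK. Qed.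

Let red4_r : red 4 (val r) = (-1) ^+ h.
Proof.
have co : coprime (2 * m) (val r) by rewrite -unitZpE // natr_Zp; exact: (valP r).
have r_odd : odd (val r) by rewrite -coprime2n; apply: coprime_dvdl co; exact: dvdn_mulr.
apply/eqP; rewrite /red (_ : (-1) ^+ h = (if h then 3 else 1)%:R); last first.
  by case: h; apply: val_inj.
rewrite Zp_natr_eq // /r_mod4; move: r_odd; move: (nat_of_ord _) => a.
by have [a3|a3] := eqVneq (a %% 4)%N 3%N; lia.
Qed.

(** Here -r^2 = 1 - m, which is -1 modulo 4 and 1 modulo m / 2. *)
Let sign_sqr4 : red 4 ((-1) ^+ true * val r ^+ 2) = -1.
Proof.
rewrite r_sqr' expr1 mulN1r redN // redD // redN // red1 // red_nat //.
by rewrite -[m%:R]natr_Zp val_Zp_nat // m_mod4; apply: val_inj.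
Qed.

(** Modulo 4 the unit r is (-1)^h, so the reduction is the 4-cube with the two labels of the second
    coordinate exchanged if h holds; [relabel] carries [tau] to the transposition behind [nu4]. *)
Definition relabel (c : bool * bool) := (c.1, c.2 (+) (h && c.1)).

Lemma amp_0 n (q : {unit 'Z_n}) : amp q true 0 = 1.
Proof. by rewrite /amp (_ : half_sign true 0 = false) // expr0z mulr1. Qed.

Lemma amp_1 n (q : {unit 'Z_n}) : amp q true 1 = val q.
Proof. by rewrite /amp (_ : half_sign true 1 = false) // expr1z mul1r. Qed.

Lemma red_amp4 lay : red 4 (amp r true lay) =
  (-1) ^+ (h && oddz lay) * red 4 (amp one4 true lay).
Proof.
pose g j : 'Z_4 := (-1) ^+ (h && oddz j) * red 4 (amp one4 true j).
apply: (@two_step _ (-1) (fun j => red 4 (amp r true j)) g); first exact: unitrN1.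
- by move=> j; rewrite amp2 // redM // sign_sqr4.
- move=> j; rewrite /g amp2 // (_ : val one4 = 1) // expr1n mulr1 expr1 redM // redN // red1 //.
  by rewrite (_ : j + 2 = j + 1 + 1) ?oddzD1 ?negbK; [ring | lia].
- by rewrite /g !amp_0 (_ : oddz 0 = false) // andbF expr0 mul1r !red1.
by rewrite /g !amp_1 (_ : oddz 1 = true) // andbT red4_r (_ : val one4 = 1) // red1 // mulr1.
Qed.

Lemma coords4_lmv x y c : (val x).1 = (val y).1 -> coords 4 (val x) = coords 4 (val y) ->
  let y' := lmv4 y (relabel c) in
  (val (lmv x c)).1 = (val y').1 /\ coords 4 (val (lmv x c)) = coords 4 (val y').
Proof.
move=> D E; split; first by rewrite !level_lmv D.
have := coords_lmv m_gt0 s_ge2 n_ge3 r_pow true (d := 4) isT n4 n4 x c.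
have := coords_lmv (isT : (0 < 2)%N) (isT : (2 <= 2)%N) (isT : (2 < 4)%N) r_pow4 true (d := 4) isT
  (dvdnn 4) (dvdnn 4) y (relabel c).
cbv zeta; rewrite D E => -> ->; case: (coords 4 (val y)) => -[i a] b.
have -> : layer (val y).1 (lstep true (val y).1 (relabel c)) =
  layer (val y).1 (lstep true (val y).1 c) by [].
rewrite red_amp4 layer_parity /relabel signr_addb.
by case: (c.1) => /=; rewrite ?andbF ?andbT ?mul1r ?mulr1 ?mulrA.
Qed.

Lemma coords4_lmvs w :
  coords 4 (val (lmvs base w)) = coords 4 (val (lmvs4 base4 (map relabel w))).
Proof.
have : (val base).1 = (val base4).1 by [].
have : coords 4 (val base) = coords 4 (val base4) by rewrite /coords /= !mxE !red0.
elim: w (base) (base4) => [|c w IHw] x y // E D.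
by have [D' E'] := coords4_lmv c D E; apply: IHw.
Qed.

Lemma relabel_tau c : relabel (tau c) = tperm (false, true) (true, true) (relabel c).
Proof.
rewrite /relabel; case: h c => -[[] []] /=;
  by rewrite ?tpermL ?tpermR ?tpermD //= ?tpermL ?tpermR ?tpermD.
Qed.

Lemma beta_conj (d : nat) (q : 'Z_d) (a b : triple d) : q \is a GRing.unit ->
  beta 1 (a.1.1, a.1.2, q * a.2) = (b.1.1, b.1.2, q * b.2) -> beta q a = b.
Proof.
case: a b => [[a1 a2] a3] [[b1 b2] b3] /= qU; rewrite invr1 !mul1r => E.
have E1 := congr1 (fun t : triple d => t.1.1) E; have E2 := congr1 (fun t : triple d => t.1.2) E.
have E3 := congr1 (fun t : triple d => t.2) E; rewrite /= in E1 E2 E3.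
congr (_, _, _) => //; apply: (mulrI qU); rewrite -[RHS]E3 mulrCA; congr (_ * _).
by rewrite mulrDr mulrBr !mulVKr.
Qed.

Lemma even_is_nu : is_nu nu.
Proof.
pose r0 : 'Z_(2 * m) := if h then val r else - val r.
exists r0, nu4; split.
- by rewrite /r0; case: h; [left | right].
- have /eqP : red 4 r0 = 3%:R.
    have <- : -1 = 3%:R :> 'Z_4 by apply: val_inj.
    by move: red4_r; rewrite /r0; case: h => E; rewrite ?redN // E.
  by rewrite /red Zp_natr_eq // => /eqP.
- exact: nu4P.
- move=> v; have [x ->] := prP v; have [w <-] := lmvs_connected m_gt0 s_ge2 r_pow true base x.
  exists (pr (lmvs4 base4 (map relabel w))); first by rewrite !coordsE // coords4_lmvs.
  rewrite nuE nu4_lmvs !coordsE // coords4_lmvs -!map_comp.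
  by congr (coords 4 (val (lmvs4 base4 _))); apply: eq_map => c; apply: relabel_tau.
move=> k_gt1 v; have [x ->] := prP v.
have [w <-] := lmvs_connected m_gt0 s_ge2 r_pow true base x.
set k := m./2 in k_gt1 *.
have k_odd : odd k by rewrite /k; lia.
have kn : (k %| 2 * m)%N by rewrite /k; apply/dvdnP; exists 4%N; lia.
have sgn : red k ((-1) ^+ true * val r ^+ 2) = 1.
  rewrite r_sqr' expr1 mulN1r opprB redD // redN // red1 // red_nat //.
  have -> : m%:R = 0 :> 'Z_k.
    by apply/eqP; rewrite Zp_natr_eq0 //; apply/dvdnP; exists 2%N; rewrite /k; lia.
  by rewrite subr0.
(* As r^2 = -1 modulo k, the sign of [r0] gives this product the same h as modulo 4, so one
   transposition serves both reductions. *)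
have q_r : red k r0 * red k (val r) = (-1) ^+ h.
  have E : red k (val r) * red k (val r) = -1.
    by move: sgn; rewrite expr1 mulN1r redN // expr2 redM // => <-; rewrite opprK.
  by rewrite /r0; case: h; rewrite ?redN // ?mulNr E ?opprK.
have qU : red k r0 \is a GRing.unit.
  have : red k r0 * red k (val r) \is a GRing.unit by rewrite q_r unitrX ?unitrN1.
  by rewrite unitrM => /andP[].
have := beta_lmvs m_gt0 s_ge2 n_ge3 r_pow k_gt1 kn kn sgn q_r k_odd (x0 := base) w.
rewrite nuE !coordsE //; set w' := map _ _ => H; apply/esym; apply: (beta_conj qU).
by rewrite [LHS]H // /scaled /coords /= !mxE red0 // mulr0.
Qed.

End EvenCase.

(** * The 4-cube as CPM(1, 2, 4; r) *)

Section FoldCase.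
Variables (r : {unit 'Z_4}) (one_gt0 : (0 < 1)%N) (s_ge2 : (2 <= 2)%N).
Variables (r_pow : val r ^+ (1 * 2) = 1 \/ val r ^+ (1 * 2) = -1).
Variable (nu : {perm cpm 1 2 r}).
Local Notation base1 := (base 1 2 r).
Local Notation base2 := (base 2 2 r).
Local Notation tau := (tperm (false, true) (true, ~~ @r_mod4 2 r)).

Let r_sqr : val r ^+ 2 = 1.
Proof. exact: (@sqr_unit_small 1 2 4 r one_gt0 s_ge2 isT isT). Qed.

Let two_gt0 : (0 < 2)%N := isT.
Let r_pow2 : val r ^+ (2 * 2) = 1 \/ val r ^+ (2 * 2) = -1.
Proof. by left; rewrite exprM r_sqr expr1n. Qed.

Local Notation lmv2 := (lmv two_gt0 s_ge2 r_pow2 true).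
Local Notation lmvs2 := (lmvs two_gt0 s_ge2 r_pow2 true).
Local Notation lmvs := (lmvs one_gt0 s_ge2 r_pow true).
Hypothesis nuE : forall w, nu (pr (lmvs base1 w)) = pr (lmvs base1 (map tau w)).

Lemma fold_pr (x : ccover 2 2 r) (y : ccover 1 2 r) : val x = val y ->
  fold_levels (m := 1) (val (pr x)) = val (pr y).
Proof.
by move=> E; rewrite /fold_levels /= /proj E /=; congr (_, _); apply: red_level.
Qed.

Lemma val_lmvs w (x : ccover 2 2 r) (y : ccover 1 2 r) : val x = val y ->
  val (lmvs2 x w) = val (lmvs y w).
Proof.
elim: w x y => [|c w IHw] x y E //; apply: IHw.
by rewrite /= E.
Qed.

Lemma fold_word w : fold_levels (m := 1) (val (pr (lmvs2 base2 w))) = val (pr (lmvs base1 w)).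
Proof. by apply: fold_pr; apply: val_lmvs. Qed.

Lemma fold_in (v : cpm 2 2 r) : fold_levels (m := 1) (val v) \in cpm_set 1 2 r.
Proof.
have [x ->] := prP v; have [w <-] := lmvs_connected two_gt0 s_ge2 r_pow2 true base2 x.
by rewrite fold_word; apply: valP.
Qed.

Definition fold (v : cpm 2 2 r) : cpm 1 2 r := exist _ (fold_levels (m := 1) (val v)) (fold_in v).

Lemma fold_lmvs w : fold (pr (lmvs2 base2 w)) = pr (lmvs base1 w).
Proof. by apply: val_inj; apply: fold_word. Qed.

Lemma red2_unit (a : 'Z_4) : a \is a GRing.unit -> red 2 a = 1.
Proof.
move=> aU; have co : coprime 4 a by rewrite -unitZpE // natr_Zp.
have a_odd : odd a by rewrite -coprime2n; apply: coprime_dvdl co.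
by apply/eqP; rewrite /red -[1]/(1%:R) Zp_natr_eq // !modn2 a_odd.
Qed.

(** The first coordinate changes by an odd amount exactly when an even layer is crossed. Its parity
    thus separates levels differing by 2, which makes [fold] injective. *)
Lemma parity_lmvs w : let z := val (lmvs2 base2 w) in
  red 2 (z.2 0 0) = (oddz ((z.1 + 1) %/ 2)%Z)%:R.
Proof.
elim/last_ind: w => [|w c IHw]; first by rewrite /= mxE red0.
rewrite -cats1 lmvs_cat; change (lmvs2 (lmvs2 base2 w) [:: c]) with (lmv2 (lmvs2 base2 w) c).
move: IHw; cbv zeta; move: (lmvs2 base2 w) => x IHw.
have ampU lay : amp r true lay \is a GRing.unit.
  by rewrite /amp unitrM unitrX ?unitrN1 // unitrXz //; exact: r_unit.
have signU (b : bool) : (-1) ^+ b = 1 :> 'Z_2 by case: b; apply: val_inj.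
have := coords_lmv two_gt0 s_ge2 (isT : (2 < 4)%N) r_pow2 true (d := 2) isT isT isT x c.
cbv zeta; rewrite (red2_unit (ampU _)) !signU !mulr1 => /(congr1 (fun t : triple 2 => t.1.2)).
rewrite [LHS]/= => ->; rewrite level_lmv /coords IHw /lstep /next_level.
move: (val x).1 => j; case: (c.1) => /=; last first.
  have -> : oddz (((if false == oddz j then j + 1 else j - 1) + 1) %/ 2)%Z =
    ~~ oddz ((j + 1) %/ 2)%Z by case E: (oddz j) => /=; move: E; rewrite /oddz; lia.
  by case: (oddz _); apply: val_inj.
by congr (_%:R); congr nat_of_bool; case E: (oddz j) => /=; move: E; rewrite /oddz; lia.
Qed.

Lemma fold_inj : injective fold.
Proof.
move=> v v'; have [x ->] := prP v; have [x' ->] := prP v'.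
have [w <-] := lmvs_connected two_gt0 s_ge2 r_pow2 true base2 x.
have [w' <-] := lmvs_connected two_gt0 s_ge2 r_pow2 true base2 x'.
rewrite !fold_lmvs => /(pr_eq one_gt0 s_ge2) [H1 H2].
have E w0 : val (lmvs base1 w0) = val (lmvs2 base2 w0) by apply/esym/val_lmvs.
rewrite !E in H1 H2; apply: (eq_pr two_gt0 s_ge2) => //.
have := parity_lmvs w; have := parity_lmvs w'; rewrite /= H2 => ->.
move: (val (lmvs2 base2 w)).1 (val (lmvs2 base2 w')).1 H1 => a b H1 H.
have {}H : oddz ((b + 1) %/ 2)%Z = oddz ((a + 1) %/ 2)%Z by case: (oddz _) (oddz _) H => [] [].
by move: H1 H; rewrite /oddz; lia.
Qed.

Lemma fold_surj v : exists v', fold v' == v.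
Proof.
have [x ->] := prP v; have [w <-] := lmvs_connected one_gt0 s_ge2 r_pow true base1 x.
by exists (pr (lmvs2 base2 w)); rewrite fold_lmvs.
Qed.

Let nu2_fun (v : cpm 2 2 r) : cpm 2 2 r := xchoose (fold_surj (nu (fold v))).

Let nu2_funE v : fold (nu2_fun v) = nu (fold v).
Proof. exact: (eqP (xchooseP (fold_surj (nu (fold v))))). Qed.

Let nu2_inj : injective nu2_fun.
Proof.
move=> v v' /(congr1 fold) E; apply: fold_inj; apply: (@perm_inj _ nu).
exact: etrans (esym (nu2_funE v)) (etrans E (nu2_funE v')).
Qed.

Lemma fold_nu_or_nubar : nu_or_nubar nu.
Proof.
pose nu2 : {perm cpm 2 2 r} := perm nu2_inj.
have nu2E w : nu2 (pr (lmvs2 base2 w)) = pr (lmvs2 base2 (map tau w)).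
  by rewrite permE; apply: fold_inj; rewrite nu2_funE !fold_lmvs nuE.
have r_sqr2 : val r ^+ 2 + 1 = 2%:R by rewrite r_sqr.
have H : nu_or_nubar (m := 2 * 1) nu2.
  apply: (@IsNu 2 r nu2) => //; exact: (@even_is_nu 2 r two_gt0 s_ge2 _ r_sqr2 r_pow2 nu2 nu2E).
apply: (Folded (m := 1) _ _ H) => // y.
have [x /eqP Dx] := fold_surj y; exists x; first by rewrite -Dx.
by rewrite -Dx -nu2_funE permE.
Qed.

End FoldCase.

Theorem theorem8p1 (m s n : nat) (r : {unit 'Z_n})
    (m_gt0 : (0 < m)%N) (s_ge2 : (2 <= s)%N) (n_ge3 : (3 <= n)%N)
    (r_pow : val r ^+ (m * s) = 1 \/ val r ^+ (m * s) = -1) :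
  two_arc_transitive (@cpm_adj m s n r) ->
  (forall x : cpm m s r,
     #|'C_(graph_aut (@cpm_adj m s n r))[x | 'P]| = 24%N) /\
  (exists2 nu : {perm cpm m s r}, nu_or_nubar nu &
     graph_aut (@cpm_adj m s n r) = <<nu |: cpm_G m s r>>).
Proof.
move=> T2; have [b0 [s2 params card gen]] := two_arc_transitive_params m_gt0 s_ge2 n_ge3 r_pow T2.
split=> //; subst s; case: params => [[n_odd Dm r2]|[b0T [[Dn m4 r2]|[Dm Dn]]]].
(* In each case the transposition passed to [gen] is the one that [beta] or [nu4] induces on
   labels. *)
- subst m; have [//|nu nuE nuG] := gen (base n 2 r) (false, true) (true, true).
  by exists nu => //; exact: (odd_nu_or_nubar n_ge3 n_odd r2 nuE).
- subst n; case: b0 b0T gen => // _ gen.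
  have [//|nu nuE nuG] := gen (base m 2 r) (false, true) (true, ~~ r_mod4 r).
  by exists nu => //; apply: IsNu m4 r2 (even_is_nu m4 r2 nuE).
subst m n; case: b0 b0T gen => // _ gen.
have [//|nu nuE nuG] := gen (base 1 2 r) (false, true) (true, ~~ @r_mod4 2 r).
by exists nu => //; apply: fold_nu_or_nubar nuE.
Qed.
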